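(* Let $T>0$, let $k\ge 2$ be an integer, and let $\varepsilon\in(0,1]$. Consider the charged-particle dynamics under a maximal ordering scaling strong magnetic field, $$\dot{\boldsymbol x}(t)=\boldsymbol v(t),\qquad \dot{\boldsymbol v}(t)=\frac{b(\varepsilon \boldsymbol x(t))}{\varepsilon}J\boldsymbol v(t)+E(\boldsymbol x(t)),\qquad \boldsymbol x(0)=\boldsymbol x_0,\ \boldsymbol v(0)=\boldsymbol v_0,\qquad 0\le t\le T,$$ with $\boldsymbol x(t),\boldsymbol v(t)\in\mathbb R^2$, $J=\begin{pmatrix}0&1\\-1&0\end{pmatrix}$, $E=-\nabla U:\mathbb R^2\to\mathbb R^2$ and $b:\mathbb R^2\to\mathbb R$ independent of $\varepsilon$, and $b(\boldsymbol x)\ge c_0>0$ for all $\boldsymbol x\in\mathbb R^2$. Assume that $E$ and $b$ are globally Lipschitz continuous up to order $k$ with constants independent of $\varepsilon$, and that the initial data $\boldsymbol x_0,\boldsymbol v_0$ are bounded uniformly in $\varepsilon$. Let $(\boldsymbol x_n,\boldsymbol v_n)$, $0\le n\le N$, be the numerical solution produced by the local linear extension exponential integrator with extension order $k$ and step size $h=T/N$ (defined in the context), and let $t_n=nh$. Then there are constants $C>0$ and $h_0>0$, independent of $\varepsilon$ and $h$, such that for any $0<h<h_0$ and all $0\le n\le N$, $$\|\boldsymbol x_n-\boldsymbol x(t_n)\|\le C\,\varepsilon\, h^{k+1},\qquad \|\boldsymbol v_n-\boldsymbol v(t_n)\|\le C\,h^{k+1}.$$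
   Context: **Norms and regularity.** $\|\cdot\|$ is the Euclidean norm for vectors. ''Globally Lipschitz continuous up to order $k$'' means that all partial derivatives of order $0,1,\dots,k$ exist, are continuous and are globally Lipschitz on $\mathbb R^2$. **Reformulation.** Put $b_0=b(\varepsilon\boldsymbol x_0)$, $\boldsymbol w=\varepsilon\boldsymbol v$, $\boldsymbol y=(\boldsymbol x^\intercal,\boldsymbol w^\intercal)^\intercal$, $d=4$. The system becomes $\dot{\boldsymbol y}=\frac1\varepsilon A\boldsymbol y+F(\boldsymbol y)$ with $$A=\begin{pmatrix}0_{2\times2}&I_{2\times 2}\\0_{2\times2}&b_0J\end{pmatrix},\qquad F(\boldsymbol y)=\begin{pmatrix}0_{2\times 1}\\ \frac{b(\varepsilon\boldsymbol x)-b_0}{\varepsilon}J\boldsymbol w+\varepsilon E(\boldsymbol x)\end{pmatrix}.$$ With $\boldsymbol z=(\boldsymbol y^\intercal,t)^\intercal$ (dimension $d+1$) this is $\dot{\boldsymbol z}=\frac1\varepsilon A_1\boldsymbol z+\boldsymbol f(\boldsymbol z)$, where $A_1=\begin{pmatrix}A&0_{d\times1}\\0_{1\times d}&0\end{pmatrix}$, $\boldsymbol f(\boldsymbol z)=\begin{pmatrix}F(\boldsymbol y)\\1\end{pmatrix}$, and $\boldsymbol z(0)=\boldsymbol z_0=(\boldsymbol x_0^\intercal,\varepsilon\boldsymbol v_0^\intercal,0)^\intercal$. **Extension variables.** For a multi-index $\xi=(\xi_1,\dots,\xi_j)$ with $\xi_i\in\{1,\dots,d+1\}$ write $|\xi|=j$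 and $(\boldsymbol z-\hat{\boldsymbol z})^\xi=\prod_{i=1}^j(z_{\xi_i}-\hat z_{\xi_i})$ (equal to $1$ if $j=0$); $\chi(\xi;l)$ denotes $\xi$ with its $l$-th entry deleted. For a reference point $\hat{\boldsymbol z}$, let $\boldsymbol z^{[k,\hat{\boldsymbol z}]}$ be the vector of all monomials $(\boldsymbol z-\hat{\boldsymbol z})^{\xi}$ with $\xi_1\le\dots\le\xi_j$, $0\le j\le k$, ordered by increasing degree and lexicographically within each degree; so its first component is $1$ and components $2,\dots,d+2$ form $\boldsymbol z-\hat{\boldsymbol z}$. Let $D^{[k]}$ be its length. The $D^{[k]}\times D^{[k]}$ matrices $A_1^{[k]}(\hat{\boldsymbol z})$ and $A_0^{[k]}(\hat{\boldsymbol z})$ are the ones determined by the following polynomial identities in $\boldsymbol z$, for the row indexed by each nondecreasing $\xi$ with $|\xi|=j\le k$ (the row of $\xi=\emptyset$ is zero): $$\big(A_1^{[k]}(\hat{\boldsymbol z})\boldsymbol z^{[k,\hat{\boldsymbol z}]}\big)_\xi=\sum_{l=1}^{j}\sum_{m=1}^{d+1}(A_1)_{\xi_l m}\big[(\boldsymbol z-\hat{\boldsymbol z})^{\chi(\xi;l)}(z_m-\hat z_m)+\hat z_m(\boldsymbol z-\hat{\boldsymbol z})^{\chi(\xi;l)}\big],$$ $$\big(A_0^{[k]}(\hat{\boldsymbol z})\boldsymbol z^{[k,\hat{\boldsymbol z}]}\big)_\xi=\sum_{l=1}^{j}(\boldsymbol z-\hat{\boldsymbol z})^{\chi(\xi;l)}\,\big(\mathcal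 T_{\hat{\boldsymbol z}}^{\,k-j+1}f_{\xi_l}\big)(\boldsymbol z),$$ where $\mathcal T_{\hat{\boldsymbol z}}^{\,m}g$ is the Taylor polynomial of degree $m$ of $g$ at $\hat{\boldsymbol z}$ and $f_i$ is the $i$-th component of $\boldsymbol f$. **The integrator.** With $e_1$ the first canonical basis vector of $\mathbb R^{D^{[k]}}$ and $\Pi_2^{d+2}$ the matrix extracting components $2,\dots,d+2$, set $\boldsymbol Z_0=\boldsymbol z_0$ and $$\boldsymbol Z_{n+1}=\boldsymbol Z_n+\Pi_2^{d+2}\exp\!\Big(h\big(\tfrac1\varepsilon A_1^{[k]}(\boldsymbol Z_n)+A_0^{[k]}(\boldsymbol Z_n)\big)\Big)e_1,\qquad n=0,\dots,N-1.$$ The first $d=4$ components of $\boldsymbol Z_n$ are $\boldsymbol y_n=(\boldsymbol x_n^\intercal,\boldsymbol w_n^\intercal)^\intercal$, and $\boldsymbol v_n=\boldsymbol w_n/\varepsilon$. *)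

(* Defs.v *)
From HB Require Import structures.
From mathcomp Require Import all_boot all_order all_algebra.
From mathcomp Require Import all_classical all_reals all_analysis.
From mathcomp Require Import zify.
Set Implicit Arguments.
Unset Strict Implicit.
Unset Printing Implicit Defensive.
Import Order.TTheory GRing.Theory Num.Theory.
Import numFieldNormedType.Exports.
Local Open Scope classical_set_scope.
Local Open Scope ring_scope.

(* The library norm on matrices is the sup norm. *)
Definition enorm (R : realType) (n : nat) (x : 'cV[R]_n) : R :=
  Num.sqrt (\sum_(i < n) x i 0 ^+ 2).

Definition pderiv (R : realType) (n : nat) (i : 'I_n) (g : 'cV[R]_n -> R) :
    'cV[R]_n -> R :=
  fun x => 'D_(delta_mx i 0) g x.

(* pderivs [:: i1; ...; ij] g = d/dx_{i1} (... (d/dx_{ij} g)) *)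
Definition pderivs (R : realType) (n : nat) (s : seq 'I_n) (g : 'cV[R]_n -> R) :
    'cV[R]_n -> R :=
  foldr (@pderiv R n) g s.

Definition glob_lipschitz (R : realType) (n : nat) (g : 'cV[R]_n -> R) : Prop :=
  exists L : R, forall x y : 'cV[R]_n, `|g x - g y| <= L * enorm (x - y).

Definition glob_lipschitz_upto (R : realType) (n k : nat) (g : 'cV[R]_n -> R) :
    Prop :=
  forall s : seq 'I_n, (size s <= k)%N ->
    [/\ (size s < k)%N ->
          forall (i : 'I_n) (x : 'cV[R]_n), derivable (pderivs s g) x (delta_mx i 0),
        continuous (pderivs s g)
      & glob_lipschitz (pderivs s g)].

Definition grad (R : realType) (n : nat) (g : 'cV[R]_n -> R) (x : 'cV[R]_n) :
    'cV[R]_n :=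
  \col_(i < n) pderiv i g x.

Definition expmx (R : realType) (n : nat) (M : 'M[R]_n) : 'M[R]_n :=
  limn (series (fun l : nat => (l`!%:R)^-1 *: M ^+ l)).

Definition monom (R : realType) (n : nat) (z : 'cV[R]_n) (xi : seq 'I_n) : R :=
  \prod_(i <- xi) z i 0.

(* The sum runs over all (not only nondecreasing) words of length j, whence the
   weight 1/j! instead of 1/alpha!. *)
Definition taylor (R : realType) (n m : nat) (zh : 'cV[R]_n) (g : 'cV[R]_n -> R)
    (z : 'cV[R]_n) : R :=
  \sum_(j < m.+1) (j`!%:R)^-1 *
    \sum_(s : j.-tuple 'I_n) pderivs s g zh * monom (z - zh) s.

(* words n j lists the words of length j over 'I_n in lexicographic order *)
Fixpoint words (n j : nat) : seq (seq 'I_n) :=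
  if j is j'.+1 then [seq i :: s | i <- enum 'I_n, s <- words n j'] else [:: [::]].

Definition nondecr (n : nat) (s : seq 'I_n) : bool :=
  sorted (fun i j : 'I_n => (i <= j)%N) s.

Definition midx (n k : nat) : seq (seq 'I_n) :=
  flatten [seq [seq s <- words n j | nondecr s] | j <- iota 0 k.+1].

Definition extdim (n k : nat) : nat := size (midx n k).

Definition midx_at (n k : nat) (p : 'I_(extdim n k)) : seq 'I_n :=
  tnth (in_tuple (midx n k)) p.

Definition zext (R : realType) (n k : nat) (zh z : 'cV[R]_n) : 'cV[R]_(extdim n k) :=
  \col_(p < extdim n k) monom (z - zh) (midx_at p).

Definition chi (n : nat) (xi : seq 'I_n) (l : nat) : seq 'I_n :=
  take l xi ++ drop l.+1 xi.

(* ext_lin A zh M and ext_nonlin f zh M say that M is A_1^{[k]}(zh), respectively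
   A_0^{[k]}(zh), through the polynomial identities that determine these matrices;
   existence and uniqueness are proved at the end of the file. *)
Definition ext_lin (R : realType) (n k : nat) (A : 'M[R]_n) (zh : 'cV[R]_n)
    (M : 'M[R]_(extdim n k)) : Prop :=
  forall (z : 'cV[R]_n) (p : 'I_(extdim n k)),
    let xi := midx_at p in
    (M *m zext k zh z) p 0 =
    \sum_(l < size xi) \sum_(m < n) A (tnth (in_tuple xi) l) m *
      (monom (z - zh) (chi xi l) * (z m 0 - zh m 0) +
       zh m 0 * monom (z - zh) (chi xi l)).

Definition ext_nonlin (R : realType) (n k : nat) (f : 'cV[R]_n -> 'cV[R]_n)
    (zh : 'cV[R]_n) (M : 'M[R]_(extdim n k)) : Prop :=
  forall (z : 'cV[R]_n) (p : 'I_(extdim n k)),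
    let xi := midx_at p in
    (M *m zext k zh z) p 0 =
    \sum_(l < size xi) monom (z - zh) (chi xi l) *
      taylor (k - size xi + 1) zh (fun y => f y (tnth (in_tuple xi) l) 0) z.

(* Extracts components 2, ..., n+1 (positions 1, ..., n counted from 0). *)
Definition ext_proj (R : realType) (n k : nat) : 'M[R]_(n, extdim n k) :=
  \matrix_(i, q) (val q == i.+1)%:R.

Definition ext_e1 (R : realType) (n k : nat) : 'cV[R]_(extdim n k) :=
  \col_q (val q == 0)%N%:R.

Definition lee_step (R : realType) (n k : nat) (A : 'M[R]_n)
    (f : 'cV[R]_n -> 'cV[R]_n) (eps h : R) (Z Z' : 'cV[R]_n) : Prop :=
  exists M1 M0 : 'M[R]_(extdim n k),
    [/\ ext_lin A Z M1, ext_nonlin f Z M0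
      & Z' = Z + ext_proj R n k *m expmx (h *: (eps^-1 *: M1 + M0)) *m ext_e1 R n k].

Definition Jmx (R : realType) : 'M[R]_2 := delta_mx 0 1 - delta_mx 1 0.

Definition cpd_solution (R : realType) (b : 'cV[R]_2 -> R)
    (E : 'cV[R]_2 -> 'cV[R]_2) (eps T : R) (x0 v0 : 'cV[R]_2)
    (x v : R -> 'cV[R]_2) : Prop :=
  [/\ {within `[0, T], continuous x}, {within `[0, T], continuous v},
      forall t : R, 0 < t < T ->
        is_derive t 1 x (v t) /\
        is_derive t 1 v ((b (eps *: x t) / eps) *: (Jmx R *m v t) + E (x t))
    & x 0 = x0 /\ v 0 = v0].

Definition cpd_A (R : realType) (b0 : R) : 'M[R]_(2 + 2) :=
  block_mx 0 1%:M 0 (b0 *: Jmx R).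

Definition cpd_F (R : realType) (b : 'cV[R]_2 -> R) (E : 'cV[R]_2 -> 'cV[R]_2)
    (eps b0 : R) (y : 'cV[R]_(2 + 2)) : 'cV[R]_(2 + 2) :=
  let x := usubmx y in let w := dsubmx y in
  col_mx 0 (((b (eps *: x) - b0) / eps) *: (Jmx R *m w) + eps *: E x).

Definition cpd_A1 (R : realType) (b0 : R) : 'M[R]_(2 + 2 + 1) :=
  block_mx (cpd_A b0) 0 0 (0 : 'M[R]_1).

Definition cpd_f (R : realType) (b : 'cV[R]_2 -> R) (E : 'cV[R]_2 -> 'cV[R]_2)
    (eps b0 : R) (z : 'cV[R]_(2 + 2 + 1)) : 'cV[R]_(2 + 2 + 1) :=
  col_mx (cpd_F b E eps b0 (usubmx z)) (1%:M : 'cV[R]_1).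

Definition num_x (R : realType) (z : 'cV[R]_(2 + 2 + 1)) : 'cV[R]_2 :=
  usubmx (usubmx z).

Definition num_v (R : realType) (eps : R) (z : 'cV[R]_(2 + 2 + 1)) : 'cV[R]_2 :=
  eps^-1 *: dsubmx (usubmx z).

Definition numerical_solution (R : realType) (k : nat) (b : 'cV[R]_2 -> R)
    (E : 'cV[R]_2 -> 'cV[R]_2) (eps h : R) (N : nat) (x0 v0 : 'cV[R]_2)
    (Z : nat -> 'cV[R]_(2 + 2 + 1)) : Prop :=
  let b0 := b (eps *: x0) in
  Z 0%N = col_mx (col_mx x0 (eps *: v0)) 0 /\
  forall n : nat, (n < N)%N ->
    lee_step k (cpd_A1 b0) (cpd_f b E eps b0) eps h (Z n) (Z n.+1).

Section ExtensionMatrices.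
Variables (R : realType) (n k : nat).
Implicit Types (s t xi : seq 'I_n) (u zh : 'cV[R]_n) (p q : 'I_(extdim n k)).

Lemma mem_words j s : (s \in words n j) = (size s == j).
Proof.
elim: j s => [|j IH] [|i s] //=.
  by apply/negbTE/negP => /allpairsP[[a t] /= [_ _ ]].
rewrite eqSS -IH; apply/allpairsP/idP => [[[a t] /= [_ ht [_ ->]]] //|hs].
by exists (i, s); rewrite /= mem_enum.
Qed.

Lemma words_uniq j : uniq (words n j).
Proof.
elim: j => //= j IH; apply: allpairs_uniq => //; first exact: enum_uniq.
by move=> [a s] [a' s'] _ _ /= [-> ->].
Qed.

Lemma mem_midx s : (s \in midx n k) = (size s <= k)%N && nondecr s.
Proof.
apply/flatten_mapP/andP => [[j]|[hs hn]].
  by rewrite mem_iota mem_filter mem_words => hj /andP[-> /eqP->]; split => //; lia.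
by exists (size s); rewrite ?mem_iota ?mem_filter ?mem_words ?eqxx ?hn //; lia.
Qed.

Lemma midx_uniq : uniq (midx n k).
Proof.
rewrite /midx; elim: (iota _ _) (iota_uniq 0 k.+1) => //= j js IH /andP[hj hjs].
rewrite cat_uniq filter_uniq ?words_uniq // IH // andbT /=.
apply/hasPn => s /flatten_mapP[j' hj']; rewrite !mem_filter !mem_words.
move=> /andP[_ /eqP e]; rewrite -e in hj'; rewrite negb_and; apply/orP; right.
by apply: contra hj => /eqP <-.
Qed.

Let leo : rel 'I_n := fun i j => (i <= j)%N.
Let leo_total : total leo. Proof. by move=> i j; exact: leq_total. Qed.
Let leo_trans : transitive leo. Proof. by move=> j i l; exact: leq_trans. Qed.
Let leo_anti : antisymmetric leo.
Proof. by move=> i j h; apply/val_inj/anti_leq. Qed.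

Lemma monom_perm u s t : perm_eq s t -> monom u s = monom u t.
Proof. by move=> h; apply: perm_big. Qed.

Let ind t q : R := (midx_at q == sort leo t)%:R.

Lemma monom_rcons u s i : monom u (rcons s i) = monom u s * u i 0.
Proof. by rewrite /monom -cats1 big_cat big_seq1. Qed.

Lemma monom_cat u s t : monom u (s ++ t) = monom u s * monom u t.
Proof. by rewrite /monom big_cat. Qed.

Lemma sum_ind u t : (size t <= k)%N ->
  \sum_q ind t q * monom u (midx_at q) = monom u t.
Proof.
move=> ht; have ht' : sort leo t \in midx n k.
  by rewrite mem_midx size_sort ht /nondecr sort_sorted.
have [q0 hq0] : exists q, midx_at q = sort leo t.
  have/tnthP[q ->] : sort leo t \in in_tuple (midx n k) by [].
  by exists q.
rewrite (bigD1 q0) //= big1 ?addr0 => [|q qq0].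
  by rewrite /ind hq0 eqxx mul1r; apply: monom_perm; rewrite perm_sort.
rewrite /ind -hq0; case: eqP => [e|_]; last by rewrite mul0r.
case/eqP: qq0; apply/val_inj/eqP.
move: e; rewrite /midx_at !(tnth_nth [::]) /= => /eqP.
by rewrite nth_uniq // midx_uniq.
Qed.

Lemma size_midx_at p : (size (midx_at p) <= k)%N.
Proof.
have : midx_at p \in midx n k by exact: (mem_tnth p (in_tuple _)).
by rewrite mem_midx => /andP[].
Qed.

Lemma size_chi xi l : (l < size xi)%N -> size (chi xi l) = (size xi).-1.
Proof. by move=> h; rewrite size_cat size_takel ?size_drop; lia. Qed.

Lemma ext_lin_exists (A : 'M[R]_n) zh : exists M, ext_lin (k := k) A zh M.
Proof.
exists (\matrix_(p, q)
  let xi := midx_at p in \sum_(l < size xi) \sum_(m < n)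
    A (tnth (in_tuple xi) l) m *
    (ind (rcons (chi xi l) m) q + zh m 0 * ind (chi xi l) q)) => z p /=.
rewrite mxE; under [LHS]eq_bigr do rewrite !mxE mulr_suml.
rewrite exchange_big; apply: eq_bigr => l _ /=.
under [LHS]eq_bigr do rewrite mulr_suml.
rewrite exchange_big; apply: eq_bigr => m _ /=.
have hs := size_midx_at p; have hc := size_chi (ltn_ord l); have hl := ltn_ord l.
under [LHS]eq_bigr do rewrite -mulrA mulrDl -(mulrA (zh m 0)).
have h1 : (size (rcons (chi (midx_at p) l) m) <= k)%N by rewrite size_rcons hc; lia.
have h2 : (size (chi (midx_at p) l) <= k)%N by rewrite hc; lia.
rewrite -mulr_sumr big_split /= -mulr_sumr !sum_ind //.
by rewrite monom_rcons !mxE.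
Qed.

Lemma ext_nonlin_exists (f : 'cV[R]_n -> 'cV[R]_n) zh :
  exists M, ext_nonlin (k := k) f zh M.
Proof.
exists (\matrix_(p, q)
  let xi := midx_at p in \sum_(l < size xi) \sum_(j < (k - size xi + 1).+1)
    (j`!%:R)^-1 * \sum_(s : j.-tuple 'I_n)
      pderivs s (fun y => f y (tnth (in_tuple xi) l) 0) zh *
      ind (chi xi l ++ s) q) => z p /=.
rewrite mxE; under [LHS]eq_bigr do rewrite !mxE mulr_suml.
rewrite exchange_big; apply: eq_bigr => l _ /=.
under [LHS]eq_bigr do rewrite mulr_suml.
rewrite exchange_big mulr_sumr; apply: eq_bigr => j _ /=.
under [LHS]eq_bigr do rewrite -mulrA.
rewrite -mulr_sumr mulrCA; congr (_ * _).
under [LHS]eq_bigr do rewrite mulr_suml.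
rewrite exchange_big mulr_sumr; apply: eq_bigr => s _ /=.
under [LHS]eq_bigr do rewrite -mulrA.
have hs := size_midx_at p; have hc := size_chi (ltn_ord l); have hl := ltn_ord l.
have hj := ltn_ord j.
have h1 : (size (chi (midx_at p) l ++ s) <= k)%N by rewrite size_cat hc size_tuple; lia.
rewrite -mulr_sumr sum_ind //.
by rewrite monom_cat mulrCA.
Qed.

(* Kronecker substitution u_i = t ^ ((k+1) ^ i) *)
Let kron s : nat := (\sum_(i <- s) k.+1 ^ i)%N.

Let digits_inj m (a b : nat -> nat) :
  (forall i, a i < k.+1)%N -> (forall i, b i < k.+1)%N ->
  (\sum_(i < m) a i * k.+1 ^ i = \sum_(i < m) b i * k.+1 ^ i)%N ->
  forall i, (i < m)%N -> a i = b i.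
Proof.
elim: m a b => // m IH a b ha hb.
have E (c : nat -> nat) : (\sum_(i < m.+1) c i * k.+1 ^ i =
    (\sum_(i < m) c i.+1 * k.+1 ^ i) * k.+1 + c 0)%N.
  rewrite big_ord_recl expn0 muln1 addnC; congr (_ + _)%N.
  by rewrite big_distrl /=; apply: eq_bigr => i _; rewrite expnSr mulnA.
rewrite !E => h.
have h0 : a 0%N = b 0%N.
  by have := congr1 (modn^~ k.+1) h; rewrite /= !modnMDl !modn_small.
move: h; rewrite h0 => /addIn /eqP; rewrite eqn_mul2r /= => /eqP h [|i] //= hi.
by apply: (IH (fun i => a i.+1) (fun i => b i.+1)).
Qed.

Let kron_inj s t : s \in midx n k -> t \in midx n k -> kron s = kron t -> s = t.
Proof.
rewrite !mem_midx => /andP[hs ss] /andP[ht st] e.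
pose c s i := count (fun j : 'I_n => val j == i) s.
have E r : kron r = (\sum_(i < n) c r i * k.+1 ^ i)%N.
  rewrite /kron /c; elim: r => [|x r IH].
    by rewrite big_nil big1 // => i _; rewrite mul0n.
  rewrite big_cons IH [in RHS](eq_bigr
     (fun i : 'I_n => (x == i :> nat) * k.+1 ^ i + c r i * k.+1 ^ i)%N);
    last by move=> i _ /=; rewrite mulnDl.
  rewrite big_split /=; congr (_ + _)%N.
  rewrite (bigD1 x) //= eqxx mul1n big1 ?addn0 // => i ix.
  by rewrite eq_sym (negbTE (_ : val i != val x)) // mul0n.
apply: (sorted_eq leo_trans leo_anti ss st).
apply/allP => x _ /=.
have := digits_inj (a := c s) (b := c t) _ _ _ (ltn_ord x).
rewrite -!E => h; apply/eqP.
have C r : c r x = count_mem x r by apply: eq_count => y; rewrite /= -val_eqE.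
by rewrite -!C; apply: h => // i; rewrite ltnS; apply: leq_trans (count_size _ _) _.
Qed.

Lemma monom_free (a : 'rV[R]_(extdim n k)) zh :
  (forall z, (a *m zext k zh z) 0 0 = 0) -> a = 0.
Proof.
move=> h; pose P := \sum_q a 0 q *: 'X^(kron (midx_at q)) : {poly R}.
have ev (x : R) : P.[x] = 0.
  rewrite -(h (zh + \col_(i < n) x ^+ (k.+1 ^ i))) mxE horner_sum.
  apply: eq_bigr => q _; rewrite hornerZ hornerXn mxE; congr (_ * _).
  rewrite addrC addKr /kron /monom.
  by elim: (midx_at q) => [|i s IH]; rewrite ?big_nil ?expr0 // !big_cons exprD IH mxE.
have P0 : P = 0.
  apply/eqP/negPn/negP => P0.
  have := max_poly_roots (rs := [seq i%:R | i <- iota 0 (size P)]) P0.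
  rewrite size_map size_iota ltnn => H.
  suff: false by []; apply: H; first by apply/allP => x _; rewrite /root ev.
  by rewrite map_inj_uniq ?iota_uniq // => i j /eqP; rewrite eqr_nat => /eqP.
apply/rowP => q; rewrite mxE -[LHS]/(a 0 q).
have := congr1 (fun Q : {poly R} => Q`_(kron (midx_at q))) P0.
rewrite coef0 /= coef_sum (bigD1 q) //= coefZ coefXn eqxx mulr1 big1 ?addr0 //.
move=> q' qq'; rewrite coefZ coefXn; case: eqP => [/kron_inj e|_]; last by rewrite mulr0.
case/eqP: qq'; apply/val_inj/eqP.
have : midx_at q' = midx_at q by symmetry; apply: e; exact: (mem_tnth _ (in_tuple _)).
by rewrite /midx_at !(tnth_nth [::]) /= => /eqP; rewrite nth_uniq // midx_uniq.
Qed.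

Let ext_unique (g : 'cV[R]_n -> 'I_(extdim n k) -> R) zh (M M' : 'M[R]_(extdim n k)) :
  (forall z p, (M *m zext k zh z) p 0 = g z p) ->
  (forall z p, (M' *m zext k zh z) p 0 = g z p) -> M = M'.
Proof.
move=> hM hM'; apply/eqP; rewrite -subr_eq0; apply/eqP/row_matrixP => p.
rewrite row0; apply: (@monom_free _ zh) => z.
by rewrite -row_mul mxE mulmxBl mxE [X in _ + X]mxE hM hM' subrr.
Qed.

Lemma ext_lin_unique (A : 'M[R]_n) zh (M M' : 'M[R]_(extdim n k)) :
  ext_lin A zh M -> ext_lin A zh M' -> M = M'.
Proof. by move=> h h'; apply: (ext_unique h h'). Qed.

Lemma ext_nonlin_unique (f : 'cV[R]_n -> 'cV[R]_n) zh (M M' : 'M[R]_(extdim n k)) :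
  ext_nonlin f zh M -> ext_nonlin f zh M' -> M = M'.
Proof. by move=> h h'; apply: (ext_unique h h'). Qed.

End ExtensionMatrices.

(* Main.v *)
(* The vector p(t) = exp((t - a) M) e_1, M = A_1/eps + A_0, computed by one step of the
   integrator approximates the vector of all monomials of degree <= k of z(t) - Z_n along the
   exact solution: their difference D solves D' = M D + r, where r consists of Taylor
   remainders of f. Read as a family of symmetric tensors and rewritten in the coordinates
   (X, w, t), X = b0 x + J w, the stiff part A_1/eps acts slot-wise by a skew-symmetric matrix
   (plus a bounded shift), so it does not contribute to the growth of the sum of squares of
   all tensor entries, and everything else is bounded uniformly in eps. Since w varies by
   O(min(eps, h)) and b is evaluated at eps x, r is O(eps h^k), and even O(eps h^(k+1)) in
   degree 1. Two Gronwall arguments, first for all degrees, then for degree 1, turn the squared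
   error N_n of (X, w, t) into N_(n+1) <= N_n + C h (N_n + eps^2 h^(2k+2)). Finally
   x = (X - J w) / b0 and v = w / eps. *)

Require Import Defs.
From HB Require Import structures.
From mathcomp Require Import all_boot all_order all_algebra.
From mathcomp Require Import all_classical all_reals all_analysis.
From mathcomp Require Import zify ring lra.
Set Implicit Arguments.
Unset Strict Implicit.
Unset Printing Implicit Defensive.
Import Order.TTheory GRing.Theory Num.Theory.
Import numFieldNormedType.Exports.
Local Open Scope classical_set_scope.
Local Open Scope ring_scope.

(** * Differential inequalities on an interval *)

Section OnInterval.
Variable R : realType.
Implicit Types (a b c x : R) (f g df dg : R -> R).

(** The comparison starts from the exact solution at t_n, not from a solution restarted at Z_n, so
    consistency and stability are a single estimate: D(t_n) already holds all monomials of the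
    incoming error. Its higher powers are controlled by N_n only if N_n <= 1, and the bounds at Z_n
    need N_n <= (eps h)^2: then Z_n still has w = O(eps), and the shift caused by A_1 Z_n / eps
    stays bounded. This bootstrap hypothesis survives because eps^2 h^(2k+2) exp(CT) <= (eps h)^2 as
    soon as h exp(CT) <= 1, which is the origin of h0. There are two Gronwall arguments because N_n
    must return with a factor 1 + O(h). The sum over all degrees starts from a multiple of N_n, so
    it only serves to bound the coupling terms; degree 1 starts from N_n exactly. The extension
    matrices are never written out: identities between linear forms are checked on the spanning
    vectors [zext k zh z], where they concern derivatives of monomials. *)

Definition c1on a b f df :=
  {within `[a, b], continuous f} /\
  forall x, a < x < b -> is_derive x 1 f (df x).

Lemma c1on_ext a b f g df dg : f =1 g ->
  (forall x, a < x < b -> df x = dg x) -> c1on a b f df -> c1on a b g dg.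
Proof.
move=> /funext -> e [cg dgx]; split=> // x hx.
by rewrite -e //; exact: dgx.
Qed.

Lemma c1on_cst a b c : c1on a b (fun _ => c) (fun _ => 0).
Proof.
split; first by move=> x; exact: cvg_cst.
by move=> x _; exact: is_derive_cst.
Qed.

Lemma c1onD a b f g df dg : c1on a b f df -> c1on a b g dg ->
  c1on a b (fun x => f x + g x) (fun x => df x + dg x).
Proof.
move=> [cf hf] [cg hg]; split.
  by move=> x; apply: cvgD; [exact: cf|exact: cg].
by move=> x hx; apply: is_deriveD; [exact: hf|exact: hg].
Qed.

Lemma c1onM a b f g df dg : c1on a b f df -> c1on a b g dg ->
  c1on a b (fun x => f x * g x) (fun x => f x * dg x + g x * df x).
Proof.
move=> [cf hf] [cg hg]; split.
  by move=> x; apply: cvgM; [exact: cf|exact: cg].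
by move=> x hx; apply: is_deriveM; [exact: hf|exact: hg].
Qed.

Lemma c1onZ a b c f df : c1on a b f df ->
  c1on a b (fun x => c * f x) (fun x => c * df x).
Proof.
move=> hf; apply: c1on_ext (c1onM (c1on_cst a b c) hf) => // x _.
by rewrite mulr0 addr0.
Qed.

Lemma c1onB a b f g df dg : c1on a b f df -> c1on a b g dg ->
  c1on a b (fun x => f x - g x) (fun x => df x - dg x).
Proof.
move=> hf /(c1onZ (-1)) hg; apply: c1on_ext (c1onD hf hg) => x *;
by rewrite mulN1r.
Qed.

Lemma c1on_sum a b I (r : seq I) (F dF : I -> R -> R) :
  (forall i, c1on a b (F i) (dF i)) ->
  c1on a b (fun x => \sum_(i <- r) F i x) (fun x => \sum_(i <- r) dF i x).
Proof.
move=> h; elim: r => [|i r IH].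
  by apply: c1on_ext (c1on_cst a b 0) => x *; rewrite big_nil.
by apply: c1on_ext (c1onD (h i) IH) => x *; rewrite big_cons.
Qed.

Lemma c1on_derive a b f df : (forall x, is_derive x 1 f (df x)) -> c1on a b f df.
Proof.
move=> h; split=> [|x _]; last exact: h.
apply: continuous_subspaceT => x.
by apply: differentiable_continuous; apply/derivable1_diffP; case: (h x).
Qed.

Lemma c1onW a b a' b' f df : a <= a' -> b' <= b -> c1on a b f df -> c1on a' b' f df.
Proof.
move=> ha hb [cf hf]; split.
  apply: continuous_subspaceW cf => x /=.
  by rewrite !in_itv /= => /andP[h1 h2]; rewrite (le_trans ha) // (le_trans h2).
by move=> x /andP[h1 h2]; apply: hf; rewrite (le_lt_trans ha) // (lt_le_trans h2).
Qed.

Lemma c1on_le0 a b f df : c1on a b f df -> (forall x, a < x < b -> df x <= 0) ->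
  forall x, a <= x <= b -> f x <= f a.
Proof.
move=> [cf hf] h x /andP[ax xb].
have d y : y \in `]a, b[ -> is_derive y 1 f (df y).
  by rewrite in_itv => /hf.
apply: (@ler0_derive1_nincr _ f a b) => // y hy.
  by case: (d y hy).
by rewrite derive1E (@derive_val _ _ _ _ _ _ _ (d y hy)); apply: h; move: hy; rewrite in_itv.
Qed.

Lemma c1on_lip a b f df K : c1on a b f df ->
  (forall x, a < x < b -> `|df x| <= K) -> a <= b -> `|f b - f a| <= K * (b - a).
Proof.
move=> cf hK ab.
have cid : c1on a b (fun x => x) (fun=> 1).
  by apply: c1on_derive => x; exact: is_derive_id.
have hb : a <= b <= b by rewrite ab lexx.
have h1 x : a < x < b -> - K * 1 - df x <= 0.
  by move=> /hK; rewrite ler_norml => /andP[]; lra.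
have h2 x : a < x < b -> df x - K * 1 <= 0.
  by move=> /hK; rewrite ler_norml => /andP[]; lra.
have := c1on_le0 (c1onB (c1onZ (- K) cid) cf) h1 hb.
have := c1on_le0 (c1onB cf (c1onZ K cid)) h2 hb.
by rewrite ler_norml => h3 h4; apply/andP; split; lra.
Qed.

(** The function exp(-A (x - a)) f(x) - B (x - a) is nonincreasing. Estimating the exponential in
    front of B by 1 avoids a division by A, so A = 0 is covered, the case of the degree 1
    argument. *)
Lemma gronwall a b f df A B : c1on a b f df -> 0 <= A -> 0 <= B ->
  (forall x, a < x < b -> df x <= A * f x + B) ->
  forall x, a <= x <= b -> f x <= expR (A * (x - a)) * (f a + B * (x - a)).
Proof.
move=> cf A0 B0 hdf x hx.
pose e (x : R) := expR (- A * (x - a)).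
have ce : c1on a b e (fun x => - A * e x).
  apply: c1on_derive => y; rewrite mulrC.
  apply: (@is_derive1_comp _ expR (fun x => - A * (x - a))).
  have -> : (fun x : R => - A * (x - a)) = (- A) \*: (id - cst a).
    by apply/funext => z.
  by apply: is_derive_eq; rewrite subr0 [_ *: _]mulr1.
have cid : c1on a b (fun x => x - a) (fun=> 1).
  apply: c1on_derive => y; have -> : (fun x : R => x - a) = id - cst a.
    by apply/funext => z.
  by apply: is_derive_eq; rewrite subr0.
have e1 y : a <= y -> e y <= 1.
  by move=> ay; rewrite /e -expR0 ler_expR mulNr oppr_le0 mulr_ge0 // subr_ge0.
have he y : a < y < b -> e y * df y + f y * (- A * e y) - B * 1 <= 0.
  move=> hy; have := hdf y hy.
  have ey : 0 < e y by exact: expR_gt0.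
  have /andP[/ltW /e1 h1 _] := hy => h2.
  have : e y * df y <= e y * (A * f y + B) by rewrite ler_pM2l.
  have : e y * B <= 1 * B by rewrite ler_wpM2r.
  by lra.
have := c1on_le0 (c1onB (c1onM ce cf) (c1onZ B cid)) he hx.
rewrite {2}/e subrr !mulr0 expR0 mul1r subr0 => h.
have -> : f x = expR (A * (x - a)) * (e x * f x).
  by rewrite mulrA -expRD mulNr subrr expR0 mul1r.
by rewrite ler_pM2l ?expR_gt0 //; lra.
Qed.

End OnInterval.

(** * The matrix exponential *)

Lemma cvg_mx (R : realType) (m n : nat) (u : nat -> 'M[R]_(m, n)) (l : 'M[R]_(m, n)) :
  (forall i j, (fun N => u N i j) @ \oo --> l i j) -> u @ \oo --> l.
Proof.
move=> h A [P hP sPA].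
apply: (@filterS _ \oo _ (fun N => forall i j, P i j (u N i j))).
  by move=> N hN; exact: sPA.
apply: (@filter_forall _ _ (fun i N => forall j, P i j (u N i j)) \oo _) => i.
apply: (@filter_forall _ _ (fun j N => P i j (u N i j)) \oo _) => j.
by apply: h; exact: hP.
Qed.

Section Expmx.
Variables (R : realType) (n : nat) (M : 'M[R]_n).
Implicit Types (x t : R) (q r : 'I_n).

Lemma cvg_pseries_fact (a : nat -> R) (K B x : R) :
  (forall l, `|a l| <= K * (B ^+ l / l`!%:R)) -> cvgn (pseries a x).
Proof.
move=> hc; apply: normed_cvg.
have K0 : 0 <= K by have := le_trans (normr_ge0 _) (hc 0%N); rewrite expr0 divr1 mulr1.
apply: (@series_le_cvg _ _ (K *: exp_coeff (`|B| * `|x|))).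
- by move=> l; exact: normr_ge0.
- by move=> l; rewrite mulr_ge0 // exp_coeff_ge0 // mulr_ge0.
- move=> l; rewrite /exp_coeff /= normrM normrX.
  apply: (@le_trans _ _ (K * (`|B| ^+ l / l`!%:R) * `|x| ^+ l)).
    rewrite ler_wpM2r ?exprn_ge0 // (le_trans (hc l)) // ler_wpM2l //.
    rewrite ler_wpM2r ?invr_ge0 // -normrX; exact: ler_norm.
  by rewrite -[X in _ <= X]/(K * ((`|B| * `|x|) ^+ l / l`!%:R)) exprMn -!mulrA [_^-1 * _]mulrC.
- by apply: is_cvg_seriesZ; exact: is_cvg_series_exp_coeff.
Qed.

Let B : R := \sum_i \sum_j `|M i j|.

Let expmx_pow_bound l q r : `|(M ^+ l) q r| <= B ^+ l.
Proof.
have B0 : 0 <= B by rewrite sumr_ge0 // => i _; exact: sumr_ge0.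
elim: l q r => [|l IH] q r.
  by rewrite !expr0 mxE; case: eqP => _; rewrite ?normr1 ?normr0.
rewrite exprS mxE (le_trans (ler_norm_sum _ _ _)) // exprS.
apply: (@le_trans _ _ (\sum_j `|M q j| * B ^+ l)).
  by apply: ler_sum => j _; rewrite normrM ler_wpM2l.
rewrite -mulr_suml ler_wpM2r ?exprn_ge0 // /B [X in _ <= X](bigD1 q) //=.
by rewrite lerDl sumr_ge0 // => i _; exact: sumr_ge0.
Qed.

Let c q r l : R := l`!%:R^-1 * (M ^+ l) q r.

Let pdiffs q r : pseries_diffs (c q r) = fun l => l`!%:R^-1 * (M ^+ l.+1) q r.
Proof.
apply/funext => l; rewrite /pseries_diffs /c factS natrM invfM mulrA.
by rewrite mulrA mulfV ?mul1r // pnatr_eq0.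
Qed.

Let pdiffs2 q r :
  pseries_diffs (pseries_diffs (c q r)) = fun l => l`!%:R^-1 * (M ^+ l.+2) q r.
Proof.
apply/funext => l; rewrite pdiffs /pseries_diffs factS natrM invfM mulrA.
by rewrite mulrA mulfV ?mul1r // pnatr_eq0.
Qed.

(** Term-by-term differentiation asks for convergence of the series and of its first two formal
    derivatives; these only shift the power of [M], hence the parameter j, used with the values 0, 1
    and 2. *)
Let cvg_gen (j : nat) q r x : cvgn (pseries (fun l => l`!%:R^-1 * (M ^+ (j + l)) q r) x).
Proof.
apply: (@cvg_pseries_fact _ (B ^+ j) B) => l.
rewrite normrM ger0_norm ?invr_ge0 // [X in _ <= X]mulrA -exprD mulrC.
by rewrite ler_wpM2r ?invr_ge0.
Qed.

Let cvg_c q r x : (fun N => pseries (c q r) x N) @ \oo --> limn (pseries (c q r) x).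
Proof. exact: (@cvg_gen 0). Qed.

Let expZmx x l : (x *: M) ^+ l = x ^+ l *: M ^+ l.
Proof.
elim: l => [|l IH]; first by rewrite !expr0 scale1r.
by rewrite !exprS IH -[LHS]scalemxAl -scalemxAr scalerA.
Qed.

Lemma expmx_entry x q r : expmx (x *: M) q r = limn (pseries (c q r) x).
Proof.
rewrite /expmx; suff -> : limn (series (fun l => (l`!%:R)^-1 *: (x *: M) ^+ l)) =
  \matrix_(q, r) limn (pseries (c q r) x) by rewrite mxE.
apply: cvg_lim => //; apply: cvg_mx => i j; rewrite mxE.
rewrite [X in X @ _ --> _](_ : _ = pseries (c i j) x); first exact: cvg_c.
apply/funext => N; rewrite /pseries /series /= summxE; apply: eq_bigr => l _.
by rewrite expZmx !mxE /c mulrAC mulrA.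
Qed.

Lemma expmx0 : expmx (0 *: M) = 1%:M.
Proof.
apply/matrixP => i j; rewrite expmx_entry; apply: cvg_lim => //.
apply: (cvg_near_cst); near=> N.
rewrite /pseries /series /= (_ : N = N.-1.+1); last by rewrite prednK //; near: N; exists 1%N.
rewrite big_nat_recl // big1 ?addr0; last by move=> l _; rewrite expr0n mulr0.
by rewrite expr0 mulr1 /c fact0 invr1 mul1r expr0.
Unshelve. all: by end_near. Qed.

Lemma is_derive_expmx x q r :
  is_derive x 1 (fun t => expmx (t *: M) q r) ((M *m expmx (x *: M)) q r).
Proof.
have -> : (fun t => expmx (t *: M) q r) = fun t => limn (pseries (c q r) t).
  by apply/funext => t; rewrite expmx_entry.
have -> : (M *m expmx (x *: M)) q r = limn (pseries (pseries_diffs (c q r)) x).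
  apply/esym/cvg_lim => //; rewrite mxE.
  rewrite [X in X @ _ --> _](_ : _ = fun N => \sum_j M q j * pseries (c j r) x N).
    apply: cvg_big => [|j _]; first exact: add_continuous.
    apply: cvgM; first exact: cvg_cst.
    by rewrite expmx_entry; exact: cvg_c.
  apply/funext => N; rewrite pdiffs /pseries /series /=.
  under [RHS]eq_bigr do rewrite mulr_sumr.
  rewrite exchange_big /=; apply: eq_bigr => l _.
  rewrite exprS mxE mulr_sumr mulr_suml; apply: eq_bigr => j _.
  by rewrite /c mulrCA !mulrA.
apply: (@pseries_snd_diffs _ _ (`|x| + 1)).
- exact: (@cvg_gen 0).
- by rewrite pdiffs; exact: (@cvg_gen 1).
- by rewrite pdiffs2; exact: (@cvg_gen 2).
- by rewrite [X in _ < X]ger0_norm ?addr_ge0 // ltrDl.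
Qed.

Lemma c1on_expmx a b (v : 'cV[R]_n) q :
  c1on a b (fun t => (expmx ((t - a) *: M) *m v) q 0)
           (fun t => (M *m (expmx ((t - a) *: M) *m v)) q 0).
Proof.
have h : c1on a b (fun t => \sum_j expmx ((t - a) *: M) q j * v j 0)
           (fun t => \sum_j (M *m (expmx ((t - a) *: M))) q j * v j 0).
  apply: c1on_sum => j.
  apply: c1on_ext (c1onZ (v j 0) _) => [x|x _|]; [exact: mulrC|exact: mulrC|].
  apply: c1on_derive => x.
  have := @is_derive1_comp _ (fun t => expmx (t *: M) q j) (fun t => t - a) x _ 1
    (is_derive_expmx (x - a) q j).
  rewrite mulr1; apply.
  have -> : (fun x : R => x - a) = id - cst a by apply/funext.
  by apply: is_derive_eq; rewrite subr0.
by apply: c1on_ext h => x *; rewrite ?mulmxA mxE.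
Qed.

End Expmx.

(** * Functions of words and their derivations *)

Section Scalar.
Variables (R : realType) (V : lmodType R).
Implicit Types (phi psi : V -> R).

Lemma is_scalarD phi psi : scalar phi -> scalar psi -> scalar (fun v => phi v + psi v).
Proof. by move=> hp hq a u v; rewrite hp hq; ring. Qed.

Lemma is_scalarZ (c : R) phi : scalar phi -> scalar (fun v => c * phi v).
Proof. by move=> hp a u v; rewrite hp; ring. Qed.

Lemma is_scalar0 : scalar (fun _ : V => 0 : R).
Proof. by move=> a u v; rewrite mulr0 addr0. Qed.

Lemma is_scalar_sum I (r : seq I) (P : pred I) (phi : I -> V -> R) :
  (forall i, scalar (phi i)) -> scalar (fun v => \sum_(i <- r | P i) phi i v).
Proof.
move=> h a u v; rewrite mulr_sumr -big_split /=.
by apply: eq_bigr => i _; exact: h.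
Qed.

End Scalar.


Section Monomials.
Variables (R : realType) (n : nat).
Implicit Types (s t xi pre : seq 'I_n) (u c a zh z : 'cV[R]_n) (Q B A : 'M[R]_n)
  (e W : seq 'I_n -> R).

Lemma monom_cons u i s : monom u (i :: s) = u i 0 * monom u s.
Proof. by rewrite /monom big_cons. Qed.

Lemma monom_nil u : monom u [::] = 1.
Proof. by rewrite /monom big_nil. Qed.

Lemma monom0 s : monom (0 : 'cV[R]_n) s = (s == [::])%:R.
Proof. by case: s => [|i s]; rewrite ?monom_nil // monom_cons mxE mul0r. Qed.

(* derivative of [monom _ s] at u in the direction c *)
Fixpoint dmon u c s : R :=
  if s is i :: s' then c i 0 * monom u s' + u i 0 * dmon u c s' else 0.

Lemma dmonD u c c' s : dmon u (c + c') s = dmon u c s + dmon u c' s.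
Proof.
by elim: s => [|i s IH] /=; rewrite ?addr0 // IH mxE; ring.
Qed.

(** The recursion reads the letters in order, but [dmon u c s] is the coefficient of X in the
    product of the polynomials u_i + c_i X over the letters i of s, and that product is
    commutative. *)
Lemma dmon_perm u c s t : perm_eq s t -> dmon u c s = dmon u c t.
Proof.
pose P s : {poly R} := \prod_(i <- s) ((u i 0)%:P + c i 0 *: 'X).
have P0 r : (P r)`_0 = monom u r.
  rewrite /P; elim: r => [|i r IH]; first by rewrite big_nil coef1 monom_nil.
  by rewrite big_cons coef0M IH coefD coefC coefZ coefX mulr0 addr0 monom_cons.
have P1 r : dmon u c r = (P r)`_1.
  elim: r => [|i r IH] /=; first by rewrite /P big_nil coef1.
  rewrite IH -P0 /P big_cons mulrDl coefD coefCM -scalerAl coefZ mulrC.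
  by rewrite coefXM /= [X in _ = _ + X]mulrC addrC.
by move=> h; rewrite !P1 /P (perm_big _ h).
Qed.

(** Recognizes the sums over deleted letters in [ext_lin] and [ext_nonlin] as the Leibniz rule for a
    monomial. *)
Lemma sum_chi u (c : 'I_n -> R) xi :
  \sum_(l < size xi) monom u (chi xi l) * c (tnth (in_tuple xi) l) =
  dmon u (\col_i c i) xi.
Proof.
elim: xi => [|i xi IH] /=; first by rewrite big_ord0.
rewrite big_ord_recl /= (tnth_nth i) /= mxE -IH mulr_sumr /chi take0 drop1 /=.
congr (_ + _); first by rewrite mulrC.
apply: eq_bigr => l _; rewrite !(tnth_nth i) /= /bump /= add1n /= monom_cons.
by rewrite mulrA.
Qed.

(* e read as a tensor, with Q applied in the slots of s *)
Fixpoint wlift Q e pre s : R :=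
  if s is i :: s' then \sum_m Q i m * wlift Q e (m :: pre) s' else e pre.

Lemma wlift_monom Q e u pre s :
  (forall t, size t = (size pre + size s)%N -> e t = monom u t) ->
  wlift Q e pre s = monom u pre * monom (Q *m u) s.
Proof.
elim: s pre => [|i s IH] pre h /=.
  by rewrite monom_nil mulr1 h ?addn0.
under eq_bigr => m _ do rewrite IH /= ?addSnnS // monom_cons.
rewrite monom_cons mxE mulrCA mulr_suml.
by apply: eq_bigr => m _; ring.
Qed.

Lemma wlift_dmon Q e u c pre s :
  (forall t, size t = (size pre + size s)%N -> e t = dmon u c t) ->
  wlift Q e pre s = dmon u c pre * monom (Q *m u) s +
                   monom u pre * dmon (Q *m u) (Q *m c) s.
Proof.
elim: s pre => [|i s IH] pre h /=.
  by rewrite monom_nil mulr1 mulr0 addr0 h ?addn0.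
under eq_bigr => m _ do rewrite IH /= ?addSnnS // monom_cons.
rewrite monom_cons [(Q *m u) i 0]mxE [(Q *m c) i 0]mxE.
rewrite !mulr_suml mulrDr !mulr_sumr -!big_split /=.
by apply: eq_bigr => m _; ring.
Qed.

Lemma wlift_bound Q e pre s K beta : (forall i j, `|Q i j| <= K) -> 0 <= K -> 0 <= beta ->
  (forall t, size t = (size pre + size s)%N -> `|e t| <= beta) ->
  `|wlift Q e pre s| <= (n%:R * K) ^+ size s * beta.
Proof.
move=> hQ K0 b0; elim: s pre => [|i s IH] pre h /=.
  by rewrite expr0 mul1r h ?addn0.
rewrite (le_trans (ler_norm_sum _ _ _)) //.
apply: (@le_trans _ _ (\sum_(m < n) K * ((n%:R * K) ^+ size s * beta))).
  apply: ler_sum => m _; rewrite normrM; apply: ler_pM => //.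
  by apply: IH => t ht; apply: h; rewrite ht /= addSnnS.
by rewrite sumr_const card_ord -[X in X <= _]mulr_natl exprS !mulrA.
Qed.

Lemma wlift_scalar (V : lmodType R) Q (E : V -> seq 'I_n -> R) pre s :
  (forall t, scalar (fun v => E v t)) -> scalar (fun v => wlift Q (E v) pre s).
Proof.
move=> h; elim: s pre => [|i s IH] pre //=.
by apply: is_scalar_sum => m; exact: is_scalarZ.
Qed.

Lemma wlift_c1on Q (a b : R) (E dE : R -> seq 'I_n -> R) pre s :
  (forall t, c1on a b (E ^~ t) (dE ^~ t)) ->
  c1on a b (fun x => wlift Q (E x) pre s) (fun x => wlift Q (dE x) pre s).
Proof.
move=> h; elim: s pre => [|i s IH] pre //=.
by apply: c1on_sum => m; exact: c1onZ.
Qed.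

(* slot_lin and slot_shift: the derivation of tensors induced by the field w |-> B w + a *)
Fixpoint slot_lin B W pre s : R :=
  if s is i :: s' then \sum_m B i m * W (pre ++ m :: s') + slot_lin B W (rcons pre i) s'
  else 0.

Fixpoint slot_shift a W pre s : R :=
  if s is i :: s' then a i 0 * W (pre ++ s') + slot_shift a W (rcons pre i) s' else 0.

Lemma slot_lin_monom B W w pre s :
  (forall t, size t = (size pre + size s)%N -> W t = monom w t) ->
  slot_lin B W pre s = monom w pre * dmon w (B *m w) s.
Proof.
elim: s pre => [|i s IH] pre h /=; first by rewrite mulr0.
rewrite IH; last by move=> t ht; apply: h; rewrite ht size_rcons /= addSnnS.
under eq_bigr => m _ do rewrite h ?size_cat // monom_cat monom_cons.
rewrite monom_rcons mxE mulrDr; congr (_ + _); last by ring.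
rewrite mulr_suml mulr_sumr; apply: eq_bigr => m _; ring.
Qed.

Lemma slot_shift_monom a W w pre s :
  (forall t, (size t).+1 = (size pre + size s)%N -> W t = monom w t) ->
  slot_shift a W pre s = monom w pre * dmon w a s.
Proof.
elim: s pre => [|i s IH] pre h /=; first by rewrite mulr0.
rewrite IH; last by move=> t ht; apply: h; rewrite ht size_rcons /= addSnnS.
rewrite h ?size_cat ?addnS // monom_cat monom_rcons; ring.
Qed.

Lemma slot_lin_scalar (V : lmodType R) B (E : V -> seq 'I_n -> R) pre s :
  (forall t, scalar (fun v => E v t)) -> scalar (fun v => slot_lin B (E v) pre s).
Proof.
move=> h; elim: s pre => [|i s IH] pre /=; first exact: is_scalar0.
by apply: is_scalarD => //; apply: is_scalar_sum => m; exact: is_scalarZ.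
Qed.

Lemma slot_shift_scalar (V : lmodType R) a (E : V -> seq 'I_n -> R) pre s :
  (forall t, scalar (fun v => E v t)) -> scalar (fun v => slot_shift a (E v) pre s).
Proof.
move=> h; elim: s pre => [|i s IH] pre /=; first exact: is_scalar0.
by apply: is_scalarD => //; exact: is_scalarZ.
Qed.

Lemma slot_shift_bound a W pre s K beta : (forall i, `|a i 0| <= K) -> 0 <= beta ->
  (forall t, (size t).+1 = (size pre + size s)%N -> `|W t| <= beta) ->
  `|slot_shift a W pre s| <= (size s)%:R * K * beta.
Proof.
move=> ha b0; elim: s pre => [|i s IH] pre h /=; first by rewrite normr0 !mul0r.
rewrite -[X in X%:R]add1n natrD 2!mulrDl mul1r.
rewrite (le_trans (ler_normD _ _)) // lerD //.
  by rewrite normrM; apply: ler_pM => //; apply: h; rewrite size_cat addnS.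
by apply: IH => t ht; apply: h; rewrite ht size_rcons /= addSnnS.
Qed.

(* The stiff part is skew-symmetric in every tensor slot, so it drops out of the energy. *)
Lemma slot_lin_skew B W j pre : (forall i m, B i m = - B m i) ->
  \sum_(s <- words n j) W (pre ++ s) * slot_lin B W pre s = 0.
Proof.
move=> hB; elim: j pre => [|j IH] pre; first by rewrite /= big_seq1 mulr0.
rewrite big_allpairs_dep /= big_enum /=.
under eq_bigr do under eq_bigr do rewrite mulrDr.
under eq_bigr do rewrite big_split /=.
(* The slots after the first vanish by the induction hypothesis, with the first letter moved into
   the prefix. *)
rewrite big_split /= [X in _ + X]big1 ?addr0; last first.
  by move=> i _; rewrite -[RHS](IH (rcons pre i)); apply: eq_bigr => s _; rewrite cat_rcons.
rewrite exchange_big /= big1 // => s _.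
(* For a fixed tail, T pairs the antisymmetric B i m with a product symmetric in i and m; exchanging
   the two indices changes its sign. *)
set T := \sum_i _; suff : T = - T by move=> h; lra.
rewrite /T; under eq_bigr do rewrite mulr_sumr.
rewrite [in RHS]exchange_big /= -sumrN; apply: eq_bigr => i _.
rewrite -sumrN; apply: eq_bigr => m _; rewrite hB; ring.
Qed.

End Monomials.

(** * Extension vectors as symmetric functions of words *)

Lemma norm_sum_le (R : realType) m (F : 'I_m -> R) C :
  (forall i, `|F i| <= C) -> `|\sum_i F i| <= m%:R * C.
Proof.
move=> hF; rewrite (le_trans (ler_norm_sum _ _ _)) //.
rewrite (le_trans (ler_sum _ (fun i _ => hF i))) // sumr_const card_ord.
by rewrite -[X in X <= _]mulr_natl.
Qed.

Section Extension.
Variables (R : realType) (n k : nat).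
Implicit Types (s t xi : seq 'I_n) (u c zh z : 'cV[R]_n) (Q B A : 'M[R]_n)
  (V : 'cV[R]_(extdim n k)) (M : 'M[R]_(extdim n k)) (q p : 'I_(extdim n k)).

(* V, indexed by the nondecreasing words of length at most k, read as a symmetric
   function of all words *)
Definition ev V s : R :=
  \sum_q (midx_at q == sort (fun i j : 'I_n => (i <= j)%N) s)%:R * V q 0.

Lemma ev_scalar s : scalar (ev ^~ s).
Proof.
apply: is_scalar_sum => q a u w; rewrite !mxE; ring.
Qed.

Lemma ev_zext zh z s : (size s <= k)%N -> ev (zext k zh z) s = monom (z - zh) s.
Proof.
move=> h; rewrite -(sum_ind (z - zh) h); apply: eq_bigr => q _.
by rewrite mxE.
Qed.

Lemma ev_bound V s (beta : R) :
  (forall q, size (midx_at q) = size s -> `|V q 0| <= beta) -> 0 <= beta ->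
  `|ev V s| <= beta.
Proof.
move=> h b0; rewrite /ev.
have [q hq|h0] := pickP (fun q => midx_at q == sort (fun i j : 'I_n => (i <= j)%N) s);
  last by rewrite big1 ?normr0 // => q _; rewrite h0 mul0r.
rewrite (bigD1 q) //= hq mul1r big1 ?addr0 => [|q' qq'].
  by apply: h; rewrite (eqP hq) size_sort.
case: eqP => [e|_]; last by rewrite mul0r.
case/eqP: qq'; apply/val_inj/eqP; move: hq; rewrite -e /midx_at !(tnth_nth [::]) /=.
by rewrite nth_uniq // ?midx_uniq // eq_sym.
Qed.

Lemma midx_at_sort p : sort (fun i j : 'I_n => (i <= j)%N) (midx_at p) = midx_at p.
Proof.
have : midx_at p \in midx n k by exact: (mem_tnth p (in_tuple _)).
rewrite mem_midx => /andP[_ h]; apply: sorted_sort h => i j l.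
exact: leq_trans.
Qed.

Lemma ev_midx_at V p : ev V (midx_at p) = V p 0.
Proof.
rewrite /ev midx_at_sort (bigD1 p) //= eqxx mul1r big1 ?addr0 // => q qp.
case: eqP => [e|_]; last by rewrite mul0r.
case/eqP: qp; apply/val_inj/eqP; move/eqP: e; rewrite /midx_at !(tnth_nth [::]) /=.
by rewrite nth_uniq // midx_uniq.
Qed.

(* Distinct monomials being linearly independent, the vectors [zext k zh z] span. *)
Lemma zext_span (phi psi : 'cV[R]_(extdim n k) -> R) zh : scalar phi -> scalar psi ->
  (forall z, phi (zext k zh z) = psi (zext k zh z)) -> forall V, phi V = psi V.
Proof.
move=> hp hq h V; pose a : 'rV[R]_(extdim n k) := \row_q (phi (delta_mx q 0) - psi (delta_mx q 0)).
pose chi0 V := phi V + (-1) * psi V.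
have hc : scalar chi0 by exact: is_scalarD hp (is_scalarZ (-1) hq).
have c0 : chi0 0 = 0 by have := hc (-1) 0 0; rewrite scaleN1r addNr; lra.
have aE W : chi0 W = (a *m W) 0 0.
  rewrite mxE [in LHS](matrix_sum_delta W).
  have -> : \sum_i \sum_(j < 1) W i j *: delta_mx i j = \sum_i W i 0 *: delta_mx i 0.
    by apply: eq_bigr => i _; rewrite big_ord1.
  elim/big_ind2: _ => [//|x x' y y' hx hy|q _].
    by have := hc 1 x' y'; rewrite scale1r mul1r => ->; rewrite hx hy.
  have := hc (W q 0) (delta_mx q 0) 0; rewrite addr0 c0 addr0 => ->.
  by rewrite mxE /chi0; ring.
have a0 : a = 0 by apply: (@monom_free _ _ _ _ zh) => z; rewrite -aE /chi0 h; ring.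
by have := aE V; rewrite a0 mul0mx mxE /chi0; lra.
Qed.

Lemma scalar_mulmx M (phi : 'cV[R]_(extdim n k) -> R) :
  scalar phi -> scalar (fun V => phi (M *m V)).
Proof. by move=> h a u w; rewrite mulmxDr -scalemxAr h. Qed.

Definition evQ Q V s := wlift Q (ev V) [::] s.

Lemma evQ_scalar Q s : scalar (evQ Q ^~ s).
Proof. by apply: wlift_scalar; exact: ev_scalar. Qed.

Lemma evB V V' s : ev (V - V') s = ev V s - ev V' s.
Proof.
have := ev_scalar s (-1) V' V; rewrite scaleN1r [- V' + V]addrC => ->; ring.
Qed.

Lemma evQB Q V V' s : evQ Q (V - V') s = evQ Q V s - evQ Q V' s.
Proof.
have := evQ_scalar Q s (-1) V' V; rewrite scaleN1r [- V' + V]addrC => ->; ring.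
Qed.

Lemma evQ_zext Q zh z s : (size s <= k)%N ->
  evQ Q (zext k zh z) s = monom (Q *m (z - zh)) s.
Proof.
move=> h; rewrite /evQ (@wlift_monom _ _ _ _ (z - zh)) ?monom_nil ?mul1r // => t ht.
by rewrite ev_zext // ht.
Qed.

(** Q' undoes the change of coordinates slot by slot. This recovers the entries of V from those in
    the new coordinates, which are the ones that the energy controls. *)
Lemma evQ_inv Q Q' V s : Q' *m Q = 1%:M -> (size s <= k)%N ->
  ev V s = wlift Q' (evQ Q V) [::] s.
Proof.
move=> hQ hs; apply: (@zext_span (ev ^~ s) (fun V => wlift Q' (evQ Q V) [::] s) 0).
- exact: ev_scalar.
- by apply: wlift_scalar => t; exact: evQ_scalar.
- move=> z; rewrite (@wlift_monom _ _ _ _ (Q *m (z - 0))).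
    by rewrite monom_nil mul1r mulmxA hQ mul1mx ev_zext.
  by move=> t ht; rewrite evQ_zext // ht.
Qed.

(** The two terms of the defining identity add up to A z in the slot of the deleted letter, so a row
    is the derivative of a monomial along the field A z; [dmon_perm] carries this from nondecreasing
    words to all words. *)
Lemma ext_linE A zh M : ext_lin A zh M -> forall z s, (size s <= k)%N ->
  ev (M *m zext k zh z) s = dmon (z - zh) (A *m z) s.
Proof.
move=> hM z s hs.
have E p : (M *m zext k zh z) p 0 = dmon (z - zh) (A *m z) (midx_at p).
  rewrite hM; have -> : A *m z = \col_i (A *m z) i 0 by apply/colP => i; rewrite mxE.
  rewrite -sum_chi; apply: eq_bigr => l _.
  rewrite mxE mulr_sumr; apply: eq_bigr => m _; ring.
have [p hp] : exists p, midx_at p = sort (fun i j : 'I_n => (i <= j)%N) s.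
  have /tnthP[p ->] : sort (fun i j : 'I_n => (i <= j)%N) s \in in_tuple (midx n k).
    rewrite /= mem_midx size_sort hs /nondecr /=.
    by apply: sort_sorted => i j; exact: leq_total.
  by exists p.
transitivity (ev (M *m zext k zh z) (midx_at p)).
  by rewrite /ev midx_at_sort hp.
by rewrite ev_midx_at E hp; apply: dmon_perm; rewrite perm_sort.
Qed.

(** In the coordinates w = Q (z - zh) the field A z becomes B w + Q A zh. The linear part preserves
    the degree of a word, the constant part lowers it by one. *)
Lemma evQ_ext_lin A B Q zh M V s : ext_lin A zh M -> Q *m A = B *m Q -> (size s <= k)%N ->
  evQ Q (M *m V) s = slot_lin B (evQ Q V) [::] s + slot_shift (Q *m A *m zh) (evQ Q V) [::] s.
Proof.
move=> hM hQ hs.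
apply: (@zext_span (fun V => evQ Q (M *m V) s)
  (fun V => slot_lin B (evQ Q V) [::] s + slot_shift (Q *m A *m zh) (evQ Q V) [::] s) zh).
- exact: (scalar_mulmx M (evQ_scalar Q s)).
- apply: is_scalarD; first by apply: slot_lin_scalar => t; exact: evQ_scalar.
  by apply: slot_shift_scalar => t; exact: evQ_scalar.
move=> z; set w := Q *m (z - zh).
rewrite (@slot_lin_monom _ _ _ _ w); last by move=> t ht; rewrite evQ_zext // ht.
rewrite (@slot_shift_monom _ _ _ _ w); last first.
  by move=> t ht; rewrite evQ_zext //; move: ht hs; rewrite /=; lia.
rewrite /evQ (@wlift_dmon _ _ _ _ (z - zh) (A *m z)); last first.
  by move=> t ht; rewrite (ext_linE hM) // ht.
rewrite /= mul0r add0r !monom_nil !mul1r -dmonD; congr dmon.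
by rewrite /w [B *m _]mulmxA -hQ -!mulmxA -mulmxDr -mulmxDr subrK.
Qed.

(** The difference of the exact and the computed extension vector is not of the form [zext k zh z];
    spanning extends the defining identity to it. *)
Lemma ext_nonlinE (f : 'cV[R]_n -> 'cV[R]_n) zh M : ext_nonlin f zh M ->
  forall V p, let xi := midx_at p in
  (M *m V) p 0 = \sum_(l < size xi) \sum_(j < (k - size xi + 1).+1) j`!%:R^-1 *
    \sum_(s : j.-tuple 'I_n) pderivs s (fun y => f y (tnth (in_tuple xi) l) 0) zh *
      ev V (chi xi l ++ s).
Proof.
move=> hM V p /=.
set xi := midx_at p.
apply: (@zext_span (fun V => (M *m V) p 0) (fun V => \sum_(l < size xi)
  \sum_(j < (k - size xi + 1).+1) j`!%:R^-1 * \sum_(s : j.-tuple 'I_n)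
    pderivs s (fun y => f y (tnth (in_tuple xi) l) 0) zh * ev V (chi xi l ++ s)) zh).
- by move=> a u w; rewrite mulmxDr -scalemxAr !mxE.
- apply: is_scalar_sum => l; apply: is_scalar_sum => j; apply: is_scalarZ.
  by apply: is_scalar_sum => s; exact: (is_scalarZ _ (ev_scalar _)).
move=> z; rewrite hM /=; apply: eq_bigr => l _; rewrite mulr_sumr.
apply: eq_bigr => j _; rewrite mulrCA; congr (_ * _); rewrite mulr_sumr.
apply: eq_bigr => s _; rewrite mulrCA; congr (_ * _).
rewrite ev_zext ?monom_cat // size_cat size_chi // size_tuple.
have := ltn_ord l; have := ltn_ord j; have := @size_midx_at n k p; rewrite -/xi; lia.
Qed.

Lemma ext_nonlin_bound (f : 'cV[R]_n -> 'cV[R]_n) zh M (K : R) V (beta : R) : ext_nonlin f zh M ->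
  0 <= K ->
  (forall s i, (size s <= k)%N -> `|pderivs s (fun y => f y i 0) zh| <= K) ->
  (forall s, (size s <= k)%N -> `|ev V s| <= beta) ->
  forall p, `|(M *m V) p 0| <= (k * (k.+1 * n.+1 ^ k))%:R * (K * beta).
Proof.
move=> hM K0 hK hb p; rewrite (ext_nonlinE hM).
have b0 : 0 <= beta by exact: (le_trans (normr_ge0 _) (hb [::] _)).
have hk := @size_midx_at n k p.
set xi := midx_at p in hk *.
have Kb : 0 <= K * beta by exact: mulr_ge0.
rewrite natrM -mulrA; apply: (@le_trans _ _ ((size xi)%:R * ((k.+1 * n.+1 ^ k)%:R * (K * beta)))); last first.
  by rewrite ler_wpM2r ?mulr_ge0 // ler_nat.
apply: norm_sum_le => l.
have hl : (k - size xi + 1 <= k)%N by have := ltn_ord l; move: hk; lia.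
rewrite natrM -mulrA.
apply: (@le_trans _ _ ((k - size xi + 1).+1%:R * ((n.+1 ^ k)%:R * (K * beta)))); last first.
  by rewrite ler_wpM2r ?mulr_ge0 // ler_nat ltnS.
apply: norm_sum_le => j.
have hj : (j <= k)%N by have := ltn_ord j; lia.
rewrite normrM ger0_norm ?invr_ge0 //.
apply: (@le_trans _ _ (1 * ((n ^ j)%:R * (K * beta)))).
  apply: ler_pM => //.
    by rewrite invf_le1 ?ler1n ?ltr0n fact_gt0.
  rewrite (le_trans (ler_norm_sum _ _ _)) //.
  apply: (@le_trans _ _ (\sum_(s : j.-tuple 'I_n) K * beta)).
    apply: ler_sum => s _; rewrite normrM; apply: ler_pM => //.
      by apply: hK; rewrite size_tuple.
    apply: hb; rewrite size_cat size_chi // size_tuple.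
    have := ltn_ord l; have := ltn_ord j; move: hk; lia.
  by rewrite sumr_const -[X in X <= _]mulr_natl card_tuple card_ord.
(* The base n + 1 in place of n makes the power monotone in the exponent even for n = 0. *)
rewrite mul1r ler_wpM2r // ler_nat.
apply: (@leq_trans (n.+1 ^ j)); last by rewrite leq_pexp2l.
by case: (nat_of_ord j) => [|j']; rewrite ?expn0 // leq_exp2r.
Qed.

End Extension.

(** * Energy *)

Section FirstComponents.
Variables (R : realType) (n k : nat).

Lemma midx_at_eq0 (q : 'I_(extdim n k)) : (midx_at q == [::]) = (val q == 0%N).
Proof.
have h0 : nth [::] (midx n k) 0 = [::] by [].
rewrite /midx_at (tnth_nth [::]) -[X in _ == X]h0 nth_uniq ?midx_uniq //.
Qed.

Lemma midx_at_eq1 (q : 'I_(extdim n k)) (i : 'I_n) : (0 < k)%N ->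
  (midx_at q == [:: i]) = (val q == i.+1).
Proof.
case: k q => // k' q _.
have hm : midx n k'.+1 = [::] :: [seq [:: j] | j <- enum 'I_n] ++
    flatten [seq [seq s <- words n j | nondecr s] | j <- iota 2 k'].
  rewrite /midx /=; congr (_ :: _ ++ _).
  have -> : [seq j :: s | j <- enum 'I_n, s <- [:: [::]]] = [seq [:: j] | j <- enum 'I_n].
    by elim: (enum 'I_n) => //= j l ->.
  by elim: (enum 'I_n) => //= j l ->.
have hi : nth [::] (midx n k'.+1) i.+1 = [:: i].
  rewrite hm /= nth_cat size_map size_enum_ord ltn_ord.
  by rewrite (nth_map i) ?size_enum_ord // nth_ord_enum.
rewrite /midx_at (tnth_nth [::]) -[X in _ == X]hi nth_uniq ?midx_uniq //.
by rewrite hm /= size_cat size_map size_enum_ord ltnS (leq_trans (ltn_ord i)) ?leq_addr.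
Qed.

(** So the exponential starts from an extension vector, and the initial difference consists of
    monomials of the incoming error. *)
Lemma ext_e1E (zh : 'cV[R]_n) : ext_e1 R n k = zext k zh zh.
Proof.
by apply/colP => q; rewrite !mxE subrr monom0 midx_at_eq0.
Qed.

Lemma ext_projE (V : 'cV[R]_(extdim n k)) i : (0 < k)%N ->
  (ext_proj R n k *m V) i 0 = ev V [:: i].
Proof.
move=> k0; rewrite mxE; apply: eq_bigr => q _; rewrite mxE.
by rewrite -(midx_at_eq1 q i k0).
Qed.

Lemma sum_words1 (F : seq 'I_n -> R) : \sum_(s <- words n 1) F s = \sum_i F [:: i].
Proof.
by rewrite big_allpairs_dep /= big_enum /=; apply: eq_bigr => i _; rewrite big_seq1.
Qed.

Lemma c1on_monom a b (u du : R -> 'cV[R]_n) s :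
  (forall i, c1on a b (fun t => u t i 0) (fun t => du t i 0)) ->
  c1on a b (fun t => monom (u t) s) (fun t => dmon (u t) (du t) s).
Proof.
move=> h; elim: s => [|i s IH] /=.
  by apply: c1on_ext (c1on_cst a b 1) => x *; rewrite ?monom_nil.
apply: c1on_ext (c1onM (h i) IH) => x *; first by rewrite monom_cons.
by rewrite addrC mulrC.
Qed.

Lemma dmonZ u (a : R) c (s : seq 'I_n) : dmon u (a *: c) s = a * dmon u c s.
Proof. by elim: s => [|i s IH] /=; rewrite ?mulr0 // IH mxE; ring. Qed.

Lemma slot_shiftZ (a : R) (c : 'cV[R]_n) W pre s :
  slot_shift (a *: c) W pre s = a * slot_shift c W pre s.
Proof. by elim: s pre => [|i s IH] pre /=; rewrite ?mulr0 // IH mxE; ring. Qed.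

End FirstComponents.

Section Energy.
Variables (R : realType) (n k : nat).
Implicit Types (Y G : seq 'I_n -> R).

(** Summing over all words, not only the nondecreasing ones, counts each entry of a symmetric tensor
    once per rearrangement. This is the squared Euclidean norm of tensors, which a slot-wise skew
    derivation leaves invariant. *)
Definition energy Y : R := \sum_(j < k.+1) \sum_(s <- words n j) Y s ^+ 2.

Definition num_words : R := \sum_(j < k.+1) \sum_(s <- words n j) 1.

Lemma energy_ge0 Y : 0 <= energy Y.
Proof. by apply: sumr_ge0 => j _; apply: sumr_ge0 => s _; exact: sqr_ge0. Qed.

Lemma energy_ge Y s : (size s <= k)%N -> Y s ^+ 2 <= energy Y.
Proof.
move=> hs; rewrite /energy (bigD1 (Ordinal (hs : (size s < k.+1)%N))) //=.
rewrite (big_rem s) /= ?mem_words // -addrA lerDl addr_ge0 // sumr_ge0 //.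
  by move=> t _; exact: sqr_ge0.
by move=> j _; apply: sumr_ge0 => t _; exact: sqr_ge0.
Qed.

Lemma norm_le_energy Y s : (size s <= k)%N -> `|Y s| <= Num.sqrt (energy Y).
Proof.
by move=> hs; rewrite -sqrtr_sqr ler_sqrt ?energy_ge0 // energy_ge.
Qed.

Lemma sum_words_le G beta j : (forall s, size s = j -> G s <= beta) -> (j <= k)%N ->
  0 <= beta -> \sum_(s <- words n j) G s <= num_words * beta.
Proof.
move=> hG hj b0; apply: (@le_trans _ _ ((\sum_(s <- words n j) 1) * beta)).
  rewrite mulr_suml big_seq [X in _ <= X]big_seq; apply: ler_sum => s.
  by rewrite mem_words mul1r => /eqP; exact: hG.
rewrite ler_wpM2r // /num_words (bigD1 (Ordinal (hj : (j < k.+1)%N))) //= lerDl.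
by apply: sumr_ge0 => i _; apply: sumr_ge0.
Qed.

Lemma num_words_ge0 : 0 <= num_words.
Proof. by apply: sumr_ge0 => i _; apply: sumr_ge0. Qed.

(* The skew part costs nothing even though its coefficient c is of size 1/eps. *)
Lemma energy_rate Y dY G (B : 'M[R]_n) (c g : R) j : (forall i m, B i m = - B m i) ->
  (forall s, size s = j -> dY s = c * slot_lin B Y [::] s + G s) ->
  (forall s, size s = j -> `|G s| <= g) -> 0 <= g -> (j <= k)%N ->
  \sum_(s <- words n j) (Y s * dY s + Y s * dY s) <=
    num_words * (2 * Num.sqrt (energy Y) * g).
Proof.
move=> hB hdY hG g0 hj.
have -> : \sum_(s <- words n j) (Y s * dY s + Y s * dY s) =
    \sum_(s <- words n j) 2 * (Y s * G s).
  have := @slot_lin_skew R n B Y j [::] hB.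
  move=> /(congr1 (fun x => 2 * c * x)); rewrite mulr0 /= => h.
  rewrite -[RHS]addr0 -[X in _ = _ + X]h mulr_sumr -big_split /= big_seq [RHS]big_seq.
  apply: eq_bigr => s; rewrite mem_words => /eqP hs.
  rewrite hdY //=; ring.
apply: sum_words_le => // [s hs|]; last by rewrite !mulr_ge0 ?sqrtr_ge0.
rewrite -mulrA ler_pM2l // (le_trans (ler_norm _)) // normrM.
by apply: ler_pM => //; [apply: norm_le_energy; rewrite hs|exact: hG].
Qed.

End Energy.

(** * Local error of the exponential step *)

Section LocalError.
Variables (R : realType) (n k : nat) (K : R).
Hypotheses (k0 : (0 < k)%N) (K0 : 0 <= K).

(** [kap] is the price of passing words of length at most k through Q or Q', [c2] bounds A_0, and
    [c3] collects the nonstiff rates, namely the shift and A_0 in the new coordinates. [W] is k + 1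
    times the number of words, and [c4] is the outcome of the Gronwall argument over all degrees. *)
Let kap : R := (1 + n%:R * K) ^+ k.
Let c2 : R := (k * (k.+1 * n.+1 ^ k))%:R * K.
Let c3 : R := k%:R * K + kap * (c2 * kap).
Let W0 : R := num_words R n k.
Let W : R := k.+1%:R * W0.
Let c4 : R := expR (2 * W * c3 + W * kap) * (W + W * kap).
Definition local_const : R := W * (2 * c3 + kap) * (c4 + 1).

Let kap_ge0 : 0 <= kap. Proof. by rewrite exprn_ge0 // addr_ge0 // mulr_ge0. Qed.
Let c2_ge0 : 0 <= c2. Proof. by rewrite mulr_ge0. Qed.
Let c3_ge0 : 0 <= c3. Proof. by rewrite addr_ge0 ?mulr_ge0. Qed.
Let W0_ge0 : 0 <= W0. Proof. exact: num_words_ge0. Qed.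
Let W_ge0 : 0 <= W. Proof. by rewrite mulr_ge0. Qed.
Let W0_le : W0 <= W. Proof. by rewrite ler_peMl // ler1n. Qed.
Let c4_ge0 : 0 <= c4. Proof. by rewrite mulr_ge0 ?expR_ge0 // addr_ge0 // mulr_ge0. Qed.

Lemma local_const_ge0 : 0 <= local_const.
Proof. by rewrite mulr_ge0 ?addr_ge0 ?mulr_ge0 ?addr_ge0 ?mulr_ge0. Qed.

Variables (eps h a rho : R) (A Q Q' B : 'M[R]_n) (f : 'cV[R]_n -> 'cV[R]_n)
  (zh Z' : 'cV[R]_n) (z : R -> 'cV[R]_n).
Hypotheses (h0 : 0 < h) (h1 : h <= 1) (rho0 : 0 <= rho).
Hypotheses (hQ'Q : Q' *m Q = 1%:M) (hQA : Q *m A = B *m Q)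
  (hB : forall i m, B i m = - B m i)
  (hQ : forall i m, `|Q i m| <= K) (hQ' : forall i m, `|Q' i m| <= K)
  (hzh : forall i, `|(eps^-1 *: (Q *m A *m zh)) i 0| <= K)
  (hf : forall s i, (size s <= k)%N -> `|pderivs s (fun y => f y i 0) zh| <= K)
  (hstep : lee_step k A f eps h zh Z')
  (hz : forall i, c1on a (a + h) (fun t => z t i 0)
     (fun t => (eps^-1 *: (A *m z t) + f (z t)) i 0)).

Definition taylor_defect t (xi : seq 'I_n) : R :=
  \sum_(l < size xi) monom (z t - zh) (chi xi l) *
    (f (z t) (tnth (in_tuple xi) l) 0 -
     taylor (k - size xi + 1) zh (fun y => f y (tnth (in_tuple xi) l) 0) (z t)).

Hypothesis hdef : forall t, a < t < a + h -> forall xi : seq 'I_n, (size xi <= k)%N ->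
  `|taylor_defect t xi| <= if size xi == 1%N then h * rho else rho.
Hypothesis hinit : \sum_i (Q *m (z a - zh)) i 0 ^+ 2 <= 1.

Let kap_ge (j : nat) : (j <= k)%N -> (n%:R * K) ^+ j <= kap.
Proof.
move=> hj; apply: (@le_trans _ _ ((1 + n%:R * K) ^+ j)).
  by apply: lerXn2r; rewrite ?nnegrE ?addr_ge0 ?mulr_ge0 // lerDr.
by apply: ler_weXn2l => //; rewrite lerDl mulr_ge0.
Qed.

(** Both Gronwall arguments end with (h rho)^2. Over all degrees its factors h stem from the length
    of the interval; in degree 1 they are already in the residual, and the length of the interval
    gives a further h. *)
Lemma local_error : \sum_i (Q *m (z (a + h) - Z')) i 0 ^+ 2 <=
  \sum_i (Q *m (z a - zh)) i 0 ^+ 2 +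
  h * (local_const * (\sum_i (Q *m (z a - zh)) i 0 ^+ 2 + (h * rho) ^+ 2)).
Proof.
have [M1 [M0 [hM1 hM0 hZ']]] := hstep.
set M := eps^-1 *: M1 + M0 in hZ'.
set N1 := \sum_i (Q *m (z a - zh)) i 0 ^+ 2.
have N1_le1 : N1 <= 1 := hinit.
have N1_ge0 : 0 <= N1 by apply: sumr_ge0 => i _; exact: sqr_ge0.
pose p t := expmx ((t - a) *: M) *m ext_e1 R n k.
pose D t := zext k zh (z t) - p t.
pose r t : 'cV[R]_(extdim n k) := \col_q taylor_defect t (midx_at q).
have ME V q : (M *m V) q 0 = eps^-1 * (M1 *m V) q 0 + (M0 *m V) q 0.
  by rewrite mulmxDl -scalemxAl mxE [X in X + _]mxE.
have cD q : c1on a (a + h) (fun t => D t q 0) (fun t => (M *m D t + r t) q 0).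
  have cz : c1on a (a + h) (fun t => monom (z t - zh) (midx_at q))
    (fun t => dmon (z t - zh) (eps^-1 *: (A *m z t) + f (z t)) (midx_at q)).
    apply: c1on_monom => i.
    apply: c1on_ext (c1onB (hz i) (c1on_cst _ _ (zh i 0))) => t.
      by rewrite !mxE.
    by rewrite subr0.
  apply: c1on_ext (c1onB cz (c1on_expmx M a (a + h) (ext_e1 R n k) q)) => t.
    by rewrite /D [RHS]mxE [X in _ = _ + X]mxE [X in _ = X + _]mxE.
  move=> _.
  rewrite /D mulmxBr [RHS]mxE [X in _ = X + _]mxE [(- (M *m p t)) q 0]mxE.
  rewrite addrAC; congr (_ - _).
  rewrite dmonD dmonZ ME.
  rewrite -addrA; congr (_ * _ + _).
    by rewrite -ev_midx_at (ext_linE hM1) ?size_midx_at.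
  rewrite hM0 /r mxE /taylor_defect -big_split /=.
  have -> : f (z t) = \col_i f (z t) i 0 by apply/colP => i; rewrite mxE.
  rewrite -sum_chi; apply: eq_bigr => l _.
  by rewrite !mxE; ring.
pose Y t s := evQ Q (D t) s.
pose dY t s := evQ Q (M *m D t + r t) s.
have cY s : c1on a (a + h) (fun t => Y t s) (fun t => dY t s).
  by apply: wlift_c1on => w; apply: c1on_sum => q; exact: c1onZ.
have evD t s : (size s <= k)%N -> `|ev (D t) s| <= kap * Num.sqrt (energy k (Y t)).
  move=> hs; rewrite (evQ_inv (D t) hQ'Q) //.
  apply: (@le_trans _ _ ((n%:R * K) ^+ size s * Num.sqrt (energy k (Y t)))).
    apply: (wlift_bound hQ' K0 (sqrtr_ge0 _)) => w hw.
    by apply: norm_le_energy; rewrite hw.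
  by rewrite ler_wpM2r ?sqrtr_ge0 ?kap_ge.
pose G t s := slot_shift (eps^-1 *: (Q *m A *m zh)) (Y t) [::] s + evQ Q (M0 *m D t) s
  + evQ Q (r t) s.
have dYE t s : (size s <= k)%N -> dY t s = eps^-1 * slot_lin B (Y t) [::] s + G t s.
  move=> hs; rewrite /dY.
  have := @evQ_scalar R n k Q s 1 (M *m D t) (r t).
  rewrite scale1r mul1r => ->; rewrite mulmxDl -scalemxAl evQ_scalar.
  rewrite (evQ_ext_lin _ hM1 hQA hs) /G slot_shiftZ; ring.
have hG t s : a < t < a + h -> (size s <= k)%N ->
    `|G t s| <= c3 * Num.sqrt (energy k (Y t)) +
                kap * (if size s == 1%N then h * rho else rho).
  move=> ht hs; set sg := Num.sqrt _.
  have sg0 : 0 <= sg by exact: sqrtr_ge0.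
  rewrite /G /c3 mulrDl (le_trans (ler_normD _ _)) // lerD //.
    rewrite (le_trans (ler_normD _ _)) // lerD //.
      apply: (@le_trans _ _ ((size s)%:R * K * sg)).
        apply: (slot_shift_bound hzh sg0) => w hw.
        by apply: norm_le_energy; rewrite (leq_trans _ hs) // -[size s]hw.
      by rewrite ler_wpM2r // ler_wpM2r // ler_nat.
    apply: (@le_trans _ _ ((n%:R * K) ^+ size s * (c2 * (kap * sg)))).
      apply: (wlift_bound hQ K0) => [|w _]; first by rewrite !mulr_ge0.
      apply: ev_bound; last by rewrite !mulr_ge0.
      move=> q _; rewrite /c2 -mulrA.
      by apply: (ext_nonlin_bound hM0 K0 hf) => w' hw'; exact: evD.
    by rewrite -!mulrA ler_wpM2r ?mulr_ge0 ?kap_ge.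
  set rs := if _ then _ else _.
  have rs0 : 0 <= rs by rewrite /rs; case: eqP => _ //; rewrite mulr_ge0 // ltW.
  apply: (@le_trans _ _ ((n%:R * K) ^+ size s * rs)); last by rewrite ler_wpM2r ?kap_ge.
  apply: (wlift_bound hQ K0 rs0) => w hw; apply: ev_bound => // q hq.
  by rewrite mxE (le_trans (hdef ht _)) ?size_midx_at // hq hw add0n.
pose S j t := \sum_(s <- words n j) Y t s ^+ 2.
pose dS j t := \sum_(s <- words n j) (Y t s * dY t s + Y t s * dY t s).
have cS j : c1on a (a + h) (S j) (dS j).
  apply: c1on_sum => s.
  by apply: c1on_ext (c1onM (cY s) (cY s)) => t *; rewrite ?expr2.
have E_ge0 t : 0 <= energy k (Y t) by exact: energy_ge0.
have hdS j t : (j <= k)%N -> a < t < a + h ->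
    dS j t <= W0 * (2 * Num.sqrt (energy k (Y t)) *
      (c3 * Num.sqrt (energy k (Y t)) + kap * (if j == 1%N then h * rho else rho))).
  move=> hj ht; apply: (energy_rate (G := G t) (c := eps^-1) hB) => //.
  - by move=> s hs; apply: dYE; rewrite hs.
  - by move=> s hs; rewrite -hs; apply: hG => //; rewrite hs.
  - by rewrite addr_ge0 ?mulr_ge0 ?sqrtr_ge0 //; case: eqP => _ //; rewrite mulr_ge0 // ltW.
have rj0 (j : nat) : 0 <= (if j == 1%N then h * rho else rho).
  by case: eqP => _ //; rewrite mulr_ge0 // ltW.
have rj_le (j : nat) : (if j == 1%N then h * rho else rho) <= rho.
  by case: eqP => _ //; exact: ler_piMl.
(* The rate W kap / h comes from the weighted inequality 2 sg rho <= E / h + h rho^2 below. It acts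
   over a length h only, so it costs no more than exp(W kap), and in return the forcing integrates
   to a multiple of (h rho)^2. *)
pose A1 : R := 2 * W * c3 + W * kap / h.
have A1_ge0 : 0 <= A1 by rewrite addr_ge0 ?divr_ge0 ?mulr_ge0 // ltW.
have hE t : a < t < a + h ->
    \sum_(j < k.+1) dS j t <= A1 * energy k (Y t) + W * kap * h * rho ^+ 2.
  move=> ht; set E := energy k (Y t); set sg := Num.sqrt E.
  have sg0 : 0 <= sg by exact: sqrtr_ge0.
  have sgE : sg ^+ 2 = E by rewrite sqr_sqrtr //; exact: E_ge0.
  apply: (@le_trans _ _ (\sum_(j < k.+1) W0 * (2 * sg * (c3 * sg + kap * rho)))).
    apply: ler_sum => j _; apply: (le_trans (hdS j t _ ht)); first by rewrite -ltnS.
    by rewrite ler_wpM2l // ler_wpM2l ?mulr_ge0 // lerD2l ler_wpM2l.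
  rewrite sumr_const card_ord -[X in X <= _]mulr_natl mulrA -/W.
  have amgm : 2 * sg * rho <= E / h + h * rho ^+ 2.
    have -> : E / h + h * rho ^+ 2 = 2 * sg * rho + (sg - h * rho) ^+ 2 / h.
      by rewrite -sgE; field; rewrite gt_eqF.
    by rewrite lerDl divr_ge0 ?sqr_ge0 // ltW.
  have -> : W * (2 * sg * (c3 * sg + kap * rho)) =
      2 * W * c3 * E + W * kap * (2 * sg * rho) by rewrite -sgE; ring.
  have -> : A1 * E + W * kap * h * rho ^+ 2 =
      2 * W * c3 * E + W * kap * (E / h + h * rho ^+ 2) by rewrite /A1; ring.
  by rewrite lerD2l ler_wpM2l // mulr_ge0.
(* [ext_e1] cancels the empty word and leaves the others untouched. In a longer monomial one factor
   supplies N1, and the remaining ones are at most 1 because N1 <= 1. *)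
have Ya s : (size s <= k)%N -> Y a s ^+ 2 <= N1.
  move=> hs; rewrite /Y /D /p subrr expmx0 mul1mx (ext_e1E _ zh).
  rewrite evQB !evQ_zext // subrr mulmx0 monom0.
  set w := Q *m _.
  case: s hs => [|i s] _; first by rewrite monom_nil /= subrr expr0n.
  rewrite /= subr0.
  have wi j : w j 0 ^+ 2 <= N1.
    rewrite /N1 (bigD1 j) //= lerDl; apply: sumr_ge0 => l _; exact: sqr_ge0.
  have w1 (s' : seq 'I_n) : monom w s' ^+ 2 <= 1.
    elim: s' => [|l s' IH]; first by rewrite monom_nil expr1n.
    rewrite monom_cons exprMn mulr_ile1 ?sqr_ge0 //.
    exact: le_trans (wi l) N1_le1.
  rewrite monom_cons exprMn -[X in _ <= X]mulr1; apply: ler_pM; rewrite ?sqr_ge0 //.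
have Ea : energy k (Y a) <= W * N1.
  rewrite /W -mulrA mulr_natl -[X in _ *+ X]card_ord -sumr_const.
  apply: ler_sum => j _; apply: sum_words_le => // [s hs|]; last by rewrite -ltnS.
  by apply: Ya; rewrite hs -ltnS.
have cE : c1on a (a + h) (fun t => energy k (Y t)) (fun t => \sum_(j < k.+1) dS j t).
  by apply: c1on_sum => j; exact: cS.
have B_ge0 : 0 <= W * kap * h * rho ^+ 2 by rewrite !mulr_ge0 ?sqr_ge0 // ltW.
have E_le t : a < t < a + h -> energy k (Y t) <= c4 * (N1 + (h * rho) ^+ 2).
  move=> /andP[at1 at2]; apply: (le_trans (gronwall cE A1_ge0 B_ge0 hE _)).
    by rewrite !ltW.
  rewrite /c4 -(mulrA (expR _)); apply: ler_pM; rewrite ?expR_ge0 //.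
  - apply: addr_ge0; first exact: E_ge0.
    by apply: mulr_ge0 => //; rewrite subr_ge0 ltW.
  - rewrite ler_expR; apply: (@le_trans _ _ (A1 * h)).
      by rewrite ler_wpM2l // lerBlDl ltW.
    rewrite /A1 mulrDl mulfVK ?gt_eqF // lerD2r ler_piMr // !mulr_ge0 //.
  - apply: (@le_trans _ _ (W * N1 + W * kap * h * rho ^+ 2 * h)).
      by rewrite lerD // ler_wpM2l // lerBlDl ltW.
    have -> : W * kap * h * rho ^+ 2 * h = W * kap * (h * rho) ^+ 2 by ring.
    set y := (h * rho) ^+ 2.
    have y0 : 0 <= W * y by rewrite mulr_ge0 ?sqr_ge0.
    have x0 : 0 <= W * kap * N1 by rewrite !mulr_ge0.
    by lra.
(* Gronwall with rate 0: the energy bound just proved enters on the right as a constant, so the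
   initial value keeps the coefficient 1. *)
have : S 1%N (a + h) <= S 1%N a + h * (local_const * (N1 + (h * rho) ^+ 2)).
  rewrite [h * (_ * _)]mulrC.
  have := @gronwall _ a (a + h) _ _ 0 (local_const * (N1 + (h * rho) ^+ 2)) (cS 1%N) (lexx 0).
  rewrite mulr_ge0 ?local_const_ge0 ?addr_ge0 ?sqr_ge0 // => /(_ isT) H.
  have := H _ (a + h); rewrite mul0r expR0 mul1r [a + h - a]addrC addKr; apply; last first.
    by rewrite lexx lerDl ltW.
  move=> t ht; rewrite mul0r add0r.
  apply: (le_trans (hdS 1%N t k0 ht)); rewrite eqxx.
  have := E_le t ht; set E := energy k (Y t); set sg := Num.sqrt E => hE'.
  have sg0 : 0 <= sg by exact: sqrtr_ge0.
  have sgE : sg ^+ 2 = E by rewrite sqr_sqrtr //; exact: E_ge0.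
  have amgm : 2 * sg * (h * rho) <= E + (h * rho) ^+ 2.
    have := sqr_ge0 (sg - h * rho); rewrite -sgE; lra.
  apply: (@le_trans _ _ (W * (2 * sg * (c3 * sg + kap * (h * rho))))).
    by rewrite ler_wpM2r // !mulr_ge0 ?addr_ge0 ?mulr_ge0 // ltW.
  have -> : local_const * (N1 + (h * rho) ^+ 2) =
      W * ((2 * c3 + kap) * ((c4 + 1) * (N1 + (h * rho) ^+ 2))).
    by rewrite /local_const -mulrA -mulrA.
  rewrite ler_wpM2l //.
  apply: (@le_trans _ _ ((2 * c3 + kap) * (E + (h * rho) ^+ 2))).
    have h2 := ler_wpM2l kap_ge0 amgm.
    have : 0 <= c3 * (h * rho) ^+ 2 by rewrite mulr_ge0 ?sqr_ge0.
    rewrite -subr_ge0 in h2; move=> h3; rewrite -subr_ge0.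
    have -> : (2 * c3 + kap) * (E + (h * rho) ^+ 2) - 2 * sg * (c3 * sg + kap * (h * rho)) =
      2 * (c3 * (h * rho) ^+ 2) + (kap * (E + (h * rho) ^+ 2) - kap * (2 * sg * (h * rho))).
      by rewrite -sgE; ring.
    by rewrite addr_ge0 // mulr_ge0.
  rewrite ler_wpM2l ?addr_ge0 ?mulr_ge0 //.
  have : 0 <= N1 + (h * rho) ^+ 2 by rewrite addr_ge0 ?sqr_ge0.
  by lra.
have S1E t : S 1%N t = \sum_i Y t [:: i] ^+ 2 by exact: sum_words1.
have Sa : S 1%N a = N1.
  rewrite S1E; apply: eq_bigr => i _; congr (_ ^+ 2).
  rewrite /Y /D /p subrr expmx0 mul1mx (ext_e1E _ zh).
  rewrite evQB !evQ_zext // subrr mulmx0 monom0.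
  by rewrite monom_cons monom_nil /= mulr1 subr0.
have Sh : S 1%N (a + h) = \sum_i (Q *m (z (a + h) - Z')) i 0 ^+ 2.
  rewrite S1E; apply: eq_bigr => i _; congr (_ ^+ 2).
  rewrite /Y /evQ /= mxE; apply: eq_bigr => m _; congr (_ * _).
  rewrite /D evB ev_zext // monom_cons monom_nil mulr1.
  rewrite -ext_projE // /p [a + h - a]addrC addKr mulmxA hZ' !mxE; ring.
by rewrite Sa Sh.
Qed.

End LocalError.

(** * Taylor remainders along lines *)

Section Lines.
Variables (R : realType) (n : nat).
Implicit Types (F : 'cV[R]_n -> R) (z v : 'cV[R]_n) (phi : R -> R).

Lemma derive_line_quotient F z v (s : R) :
  (fun h : R => h^-1 *: (((fun t => F (z + t *: v)) \o shift s) (h *: 1) - F (z + s *: v))) =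
  (fun h : R => h^-1 *: ((F \o shift (z + s *: v)) (h *: v) - F (z + s *: v))).
Proof.
apply/funext => h /=; congr (_ *: (F _ - _)).
by rewrite scalerDl addrCA -[h *: 1]/(h * 1) mulr1.
Qed.

Lemma is_derive_line F z v (s d : R) :
  is_derive s 1 (fun t => F (z + t *: v)) d <-> is_derive (z + s *: v) v F d.
Proof.
by split=> -[h1 h2]; split; move: h1 h2; rewrite /derivable /derive derive_line_quotient.
Qed.

Lemma is_derive_quadratic phi (s d C : R) :
  (forall h, `|phi (s + h) - phi s - h * d| <= C * h ^+ 2) -> is_derive s 1 phi d.
Proof.
move=> hC.
have C0 : 0 <= C by have := hC 1; rewrite expr1n mulr1; apply: le_trans.
have hc : (fun h : R => h^-1 *: ((phi \o shift s) (h *: 1) - phi s)) @ 0^' --> d.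
  apply/cvgrPdist_le => e e0; near=> h.
  have h0 : h != 0 by near: h; exact: nbhs_dnbhs_neq.
  rewrite /= -[h *: 1]/(h * 1) mulr1 [h + s]addrC -[_ *: _]/(_ * _).
  have -> : d - h^-1 * (phi (s + h) - phi s) = - (h^-1 * (phi (s + h) - phi s - h * d)).
    by field.
  rewrite normrN normrM normfV ler_pdivrMl ?normr_gt0 //.
  apply: (le_trans (hC h)).
  have -> : h ^+ 2 = `|h| ^+ 2 by rewrite real_normK ?num_real.
  rewrite expr2 mulrCA ler_wpM2l //.
  have he : `|h| <= e / (C + 1).
    near: h; apply: dnbhs0_le; rewrite divr_gt0 // ltr_wpDl //.
  apply: (@le_trans _ _ ((C + 1) * `|h|)); first by rewrite ler_wpM2r // lerDl.
  by rewrite mulrC -ler_pdivlMr // ltr_wpDl.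
split; first by apply/cvg_ex; exists d.
exact: (@cvg_lim _ _ _ _ _ _ _ hc).
Unshelve. all: by end_near. Qed.

Lemma is_derive_lipschitz phi (s d L : R) :
  (forall h, `|phi (s + h) - phi s| <= L * `|h|) -> is_derive s 1 phi d -> `|d| <= L.
Proof.
move=> hL [/cvg_ex[/= l hl] hd].
have dl : d = l by rewrite -hd; exact: (@cvg_lim _ _ _ _ _ _ _ hl).
rewrite leNgt; apply/negP => hLd.
have e0 : 0 < (`|d| - L) / 2 by rewrite divr_gt0 ?subr_gt0.
have /cvgrPdist_lt /(_ _ e0) H := hl.
have [h [hh h0]] : exists h : R, `|l - h^-1 *: (phi (h *: 1 + s) - phi s)| < (`|d| - L) / 2 /\ h != 0.
  apply: (@filter_ex _ (0^' : set_system R)); apply: filterI; first exact: H.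
  exact: (@nbhs_dnbhs_neq R 0).
move: hh; rewrite -dl -[h *: 1]/(h * 1) mulr1 [h + s]addrC -[_ *: _]/(_ * _).
have hq : `|h^-1 * (phi (s + h) - phi s)| <= L.
  by rewrite normrM normfV ler_pdivrMl ?normr_gt0 // mulrC.
have := lerB_dist d (h^-1 * (phi (s + h) - phi s)).
lra.
Qed.

(** Derivatives along lines that are linear in the direction are what Taylor expansion along
    segments uses. *)
Definition C1 F := forall z v, is_derive z v F (\sum_i v i 0 * pderiv i F z).

End Lines.

Section Planar.
Variables (R : realType).
Implicit Types (g : 'cV[R]_2 -> R) (x y v : 'cV[R]_2).

Definition l1 x : R := `|x 0 0| + `|x 1 0|.

Lemma l1_ge0 x : 0 <= l1 x. Proof. exact: addr_ge0. Qed.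

Lemma enorm_l1 x : enorm x <= l1 x.
Proof.
rewrite -[leRHS]ger0_norm ?l1_ge0 // -sqrtr_sqr ler_sqrt ?sqr_ge0 // !big_ord_recl big_ord0 addr0.
rewrite (_ : lift ord0 ord0 = 1); last by apply/val_inj.
rewrite (_ : ord0 = 0 :> 'I_2) //.
rewrite /l1 sqrrD !real_normK ?num_real //.
have : 0 <= `|x 0 0| * `|x 1 0| by exact: mulr_ge0.
by rewrite mulr2n; lra.
Qed.

Lemma norm_le_enorm x i : `|x i 0| <= enorm x.
Proof.
rewrite -sqrtr_sqr ler_sqrt; last by apply: sumr_ge0 => j _; exact: sqr_ge0.
by rewrite (bigD1 i) //= lerDl; apply: sumr_ge0 => j _; exact: sqr_ge0.
Qed.

Lemma coord_taylor g (L : R) i x t :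
  (forall x, derivable g x (delta_mx i 0)) ->
  (forall x y, `|pderiv i g x - pderiv i g y| <= L * l1 (x - y)) ->
  `|g (x + t *: delta_mx i 0) - g x - t * pderiv i g x| <= L * t ^+ 2.
Proof.
move=> hd hL; set e := delta_mx i 0 : 'cV[R]_2.
have le1 (c : R) : l1 (c *: e) = `|c|.
  rewrite /l1 !mxE; case: i {hd hL} @e => -[|[|//]] ? /=.
    by rewrite mulr1 mulr0 normr0 addr0.
  by rewrite mulr1 mulr0 normr0 add0r.
have L0 : 0 <= L.
  by have := le_trans (normr_ge0 _) (hL (1 *: e) 0); rewrite subr0 le1 normr1 mulr1.
have hc (a b : R) : c1on a b (fun s => g (x + s *: e) - s * pderiv i g x)
    (fun s => pderiv i g (x + s *: e) - 1 * pderiv i g x).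
  apply: c1onB.
    apply: c1on_derive => s; apply/is_derive_line; exact: derivableP.
  apply: c1on_ext (c1onZ (pderiv i g x) (c1on_derive a b (fun s => is_derive_id s 1)));
    by move=> s *; rewrite mulrC.
have hbd (s : R) : `|pderiv i g (x + s *: e) - 1 * pderiv i g x| <= L * `|s|.
  by rewrite mul1r (le_trans (hL _ _)) // addrC addKr le1.
have -> : g (x + t *: e) - g x - t * pderiv i g x =
    (g (x + t *: e) - t * pderiv i g x) - (g (x + 0 *: e) - 0 * pderiv i g x).
  by rewrite scale0r addr0 mul0r subr0; ring.
rewrite -[t ^+ 2]real_normK ?num_real // expr2 mulrA.
have [t0|t0] := leP 0 t.
  rewrite [X in _ <= _ * X]ger0_norm // -[X in _ <= _ * X]subr0.
  apply: (c1on_lip (hc 0 t)) => // s /andP[s0 st].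
  by rewrite (le_trans (hbd s)) // ler_wpM2l // (ger0_norm (ltW s0)) (ger0_norm t0) ltW.
rewrite -normrN opprB [X in _ <= _ * X](ltr0_norm t0) -[X in _ <= _ * X]sub0r.
apply: (c1on_lip (hc t 0)); last exact: ltW.
move=> s /andP[ts s0].
by rewrite (le_trans (hbd s)) // ler_wpM2l // (ltr0_norm s0) (ltr0_norm t0) lerN2 ltW.
Qed.

(** The regularity assumptions concern coordinate derivatives only. An increment is split into a
    move along the first axis to y' and one along the second; taking the second derivative at y'
    instead of y costs a quadratic term by the Lipschitz bound. *)
Lemma c1_planar g (L : R) :
  (forall i x, derivable g x (delta_mx i 0)) ->
  (forall i x y, `|pderiv i g x - pderiv i g y| <= L * l1 (x - y)) -> C1 g.
Proof.
move=> hd hL y v; rewrite -[y]addr0 -(scale0r v); apply/is_derive_line.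
rewrite scale0r addr0 !big_ord_recl big_ord0 addr0.
rewrite (_ : lift ord0 ord0 = 1); last by apply/val_inj.
rewrite (_ : ord0 = 0 :> 'I_2) //.
have L0 : 0 <= L.
  have := le_trans (normr_ge0 _) (hL 0 (delta_mx 0 0) 0).
  by rewrite subr0 /l1 !mxE /= normr1 normr0 addr0 mulr1.
apply: (@is_derive_quadratic _ _ _ _
  (L * (`|v 0 0| ^+ 2 + `|v 1 0| ^+ 2 + `|v 0 0| * `|v 1 0|))) => h.
rewrite add0r scale0r addr0.
pose e i : 'cV[R]_2 := delta_mx i 0.
pose y' := y + (h * v 0 0) *: e 0.
have -> : y + h *: v = y' + (h * v 1 0) *: e 1.
  apply/colP => i; rewrite !mxE -addrA; congr (_ + _).
  by case: i => -[|[|//]] hi /=; rewrite ?mulr1 ?mulr0 ?addr0 ?add0r;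
    congr (_ * v _ _); apply/val_inj.
have h1 := coord_taylor (y' ) (h * v 1 0) (hd 1) (hL 1).
have h2 := coord_taylor y (h * v 0 0) (hd 0) (hL 0).
have h3 : `|h * v 1 0 * (pderiv 1 g y' - pderiv 1 g y)| <=
    L * (`|v 0 0| * `|v 1 0|) * h ^+ 2.
  rewrite normrM; apply: (@le_trans _ _ (`|h * v 1 0| * (L * `|h * v 0 0|))).
    rewrite ler_wpM2l // (le_trans (hL _ _ _)) // /y' addrC addKr /l1 !mxE /=.
    by rewrite mulr1 mulr0 normr0 addr0.
  by rewrite !normrM -[h ^+ 2]real_normK ?num_real // le_eqVlt; apply/orP; left; apply/eqP; ring.
rewrite -/(e _) in h1 h2.
have -> : g (y' + (h * v 1 0) *: e 1) - g y - h * (v 0 0 * pderiv 0 g y + v 1 0 * pderiv 1 g y)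
  = (g (y' + (h * v 1 0) *: e 1) - g y' - h * v 1 0 * pderiv 1 g y') +
    h * v 1 0 * (pderiv 1 g y' - pderiv 1 g y) + (g y' - g y - h * v 0 0 * pderiv 0 g y).
  by ring.
rewrite (le_trans (ler_normD _ _)) // (le_trans (lerD (ler_normD _ _) (lexx _))) //.
rewrite !real_normK ?num_real //.
have := lerD (lerD h1 h3) h2; rewrite !exprMn => /le_trans; apply.
rewrite le_eqVlt; apply/orP; left; apply/eqP; ring.
Qed.

End Planar.

Section TaylorStep.
Variables (R : realType) (n : nat).
Implicit Types (g : 'cV[R]_n -> R) (zh u : 'cV[R]_n) (F : seq 'I_n -> R) (w : seq 'I_n).

Lemma sum_tuples_words j F : \sum_(t : j.-tuple 'I_n) F t = \sum_(w <- words n j) F w.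
Proof.
rewrite -big_enum /= -(big_map (@tval j 'I_n) xpredT F); apply: perm_big.
apply: uniq_perm; [by rewrite map_inj_uniq ?enum_uniq //; exact: val_inj|exact: words_uniq|].
move=> w; rewrite mem_words; apply/mapP/eqP => [[t _ ->]|hw]; first exact: size_tuple.
have hw' : size w == j by apply/eqP.
by exists (Tuple hw') => //; rewrite mem_enum.
Qed.

Lemma sum_words_cons j F :
  \sum_(w <- words n j.+1) F w = \sum_i \sum_(w <- words n j) F (i :: w).
Proof. by rewrite big_allpairs_dep /= big_enum. Qed.

Lemma sum_words_rcons j F :
  \sum_(w <- words n j.+1) F w = \sum_i \sum_(w <- words n j) F (rcons w i).
Proof.
elim: j F => [|j IH] F.
  by rewrite sum_words_cons; apply: eq_bigr => i _; rewrite !big_seq1.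
rewrite sum_words_cons; under eq_bigr do rewrite IH.
by rewrite exchange_big /=; apply: eq_bigr => i _; rewrite sum_words_cons.
Qed.

Lemma pderivs_rcons w i g : pderivs (rcons w i) g = pderivs w (pderiv i g).
Proof. by rewrite /pderivs foldr_rcons. Qed.

Lemma monom_scale u (s : R) w : monom (s *: u) w = s ^+ size w * monom u w.
Proof.
elim: w => [|i w IH]; first by rewrite !monom_nil mul1r.
by rewrite !monom_cons IH mxE exprS; ring.
Qed.

Let coef zh u j g := \sum_(w <- words n j) pderivs w g zh * monom u w.

(** The last letter of a word is the derivative taken first. Splitting words on the right thus
    expresses the coefficients of g through those of its first partial derivatives. *)
Let coefS zh u j g : coef zh u j.+1 g = \sum_i u i 0 * coef zh u j (pderiv i g).
Proof.
rewrite /coef sum_words_rcons; apply: eq_bigr => i _; rewrite mulr_sumr.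
by apply: eq_bigr => w _; rewrite pderivs_rcons monom_rcons; ring.
Qed.

Let taylor_line m zh u g (s : R) :
  taylor m zh g (zh + s *: u) = \sum_(j < m.+1) (j`!%:R^-1 * coef zh u j g) * s ^+ j.
Proof.
apply: eq_bigr => j _; rewrite -mulrA; congr (_ * _).
rewrite (sum_tuples_words j (fun w => pderivs w g zh * monom (zh + s *: u - zh) w)).
rewrite /coef mulr_suml big_seq [RHS]big_seq; apply: eq_bigr => w.
rewrite mem_words => /eqP hw; rewrite [zh + _]addrC addrK monom_scale hw; ring.
Qed.

Let taylor_line_derive m zh u g (s : R) :
  is_derive s 1 (fun s => taylor m.+1 zh g (zh + s *: u))
    (\sum_i u i 0 * taylor m zh (pderiv i g) (zh + s *: u)).
Proof.
pose p : {poly R} := \poly_(j < m.+2) (j`!%:R^-1 * coef zh u j g).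
have -> : (fun s => taylor m.+1 zh g (zh + s *: u)) = horner p.
  by apply/funext => t; rewrite taylor_line horner_poly.
have -> : \sum_i u i 0 * taylor m zh (pderiv i g) (zh + s *: u) = p^`().[s].
  under eq_bigr do rewrite taylor_line mulr_sumr.
  rewrite exchange_big /=.
  have -> : p^`() = \poly_(j < m.+1) (j`!%:R^-1 * coef zh u j.+1 g).
    apply/polyP => j; rewrite coef_deriv !coef_poly ltnS.
    case: ifP => // _; last by rewrite mul0rn.
    rewrite -[LHS]mulr_natl factS natrM invfM !mulrA mulfV ?mul1r // pnatr_eq0 //.
  rewrite horner_poly; apply: eq_bigr => j _; rewrite coefS mulr_sumr mulr_suml.
  by apply: eq_bigr => i _; ring.
exact: is_derive_poly.
Qed.

Lemma taylor0 zh g z : taylor 0 zh g z = g zh.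
Proof.
rewrite /taylor big_ord_recl big_ord0 addr0 invr1 mul1r.
rewrite (sum_tuples_words 0 (fun w => pderivs w g zh * monom (z - zh) w)) big_seq1.
by rewrite monom_nil mulr1.
Qed.

Lemma taylor_zh m zh g : taylor m zh g zh = g zh.
Proof.
have := taylor_line m zh 0 g 0; rewrite scale0r addr0 => ->.
rewrite big_ord_recl expr0 mulr1 /coef big_seq1 monom_nil invr1 mul1r mulr1.
by rewrite big1 ?addr0 // => j _; rewrite expr0n mulr0.
Qed.

(** Along the segment, the remainder of degree m + 1 vanishes at the start and its derivative is a
    combination of the degree m remainders of the partial derivatives. This lets Taylor estimates
    run by induction inside a class closed under differentiation. *)
Lemma taylor_step m zh u g (Bd : 'I_n -> R) : C1 g ->
  (forall i s, 0 <= s <= 1 -> `|pderiv i g (zh + s *: u) -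
     taylor m zh (pderiv i g) (zh + s *: u)| <= Bd i) ->
  `|g (zh + u) - taylor m.+1 zh g (zh + u)| <= \sum_i `|u i 0| * Bd i.
Proof.
move=> hg hB.
have h : c1on 0 1 (fun s => g (zh + s *: u) - taylor m.+1 zh g (zh + s *: u))
  (fun s => \sum_i u i 0 * pderiv i g (zh + s *: u) -
            \sum_i u i 0 * taylor m zh (pderiv i g) (zh + s *: u)).
  apply: c1onB; apply: c1on_derive => s; last exact: taylor_line_derive.
  by apply/is_derive_line; exact: hg.
have := c1on_lip (K := \sum_i `|u i 0| * Bd i) h _ ler01.
rewrite scale1r scale0r addr0 taylor_zh subrr !subr0 mulr1; apply => s /andP[s0 s1].
rewrite -sumrB (le_trans (ler_norm_sum _ _ _)) // ler_sum // => i _.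
by rewrite -mulrBr normrM ler_wpM2l // hB // !ltW.
Qed.

End TaylorStep.

(** * Functions affine in one velocity component *)

Section Regularity.
Variable R : realType.
Implicit Types (g : 'cV[R]_2 -> R) (L : R).

(** A single constant serves all orders, and the l1 distance keeps coordinate estimates linear. The
    derivatives of orders 1 to m are bounded by L, whereas g itself may grow linearly. *)
Definition lip_upto m L g := forall s : seq 'I_2, (size s <= m)%N ->
  ((size s < m)%N -> forall i x, derivable (pderivs s g) x (delta_mx i 0)) /\
  forall x y, `|pderivs s g x - pderivs s g y| <= L * l1 (x - y).

Lemma lip_uptoW m m' L g : (m' <= m)%N -> lip_upto m L g -> lip_upto m' L g.
Proof.
move=> h hg s hs; have [h1 h2] := hg s (leq_trans hs h); split=> // hs'.
by apply: h1; exact: leq_trans h.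
Qed.

Lemma lip_upto_pderiv m L g i : lip_upto m.+1 L g -> lip_upto m L (pderiv i g).
Proof.
move=> hg s hs; have := hg (rcons s i); rewrite size_rcons !ltnS => /(_ hs).
by rewrite pderivs_rcons.
Qed.

Lemma lip_upto_C1 m L g : lip_upto m.+1 L g -> C1 g.
Proof.
move=> hg; apply: (@c1_planar _ _ L) => [i x|i x y].
  by have [/(_ isT i x)] := hg [::] isT.
by have [_] := hg [:: i] isT; apply.
Qed.

Lemma lip_upto_bound m L g i x : lip_upto m.+1 L g -> `|pderiv i g x| <= L.
Proof.
move=> hg; have [/(_ isT i x) hd hL] := hg [::] isT.
have := derivableP hd; rewrite -[X in is_derive X]addr0 -(scale0r (delta_mx i 0)).
move=> /is_derive_line /is_derive_lipschitz; apply => h.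
rewrite scale0r addr0 add0r (le_trans (hL _ _)) //=.
rewrite addrC addKr /l1 !mxE; case: i hd => -[|[|//]] ? _ /=.
  by rewrite mulr1 mulr0 normr0 addr0.
by rewrite mulr1 mulr0 normr0 add0r.
Qed.

Lemma lip_upto_subc m L g (c : R) : lip_upto m L g -> lip_upto m L (fun x => g x - c).
Proof.
move=> hg s; case: (lastP s) => [|s' i] hs.
  have [h1 h2] := hg [::] hs; split=> [hm i x|x y] /=.
    by apply: (@derivableB _ _ _ g (cst c)) => //; exact: h1.
  by have -> : g x - c - (g y - c) = g x - g y by ring; exact: h2.
have -> : pderivs (rcons s' i) (fun x => g x - c) = pderivs (rcons s' i) g.
  rewrite !pderivs_rcons; congr pderivs; apply/funext => x.
  rewrite /pderiv (@deriveB _ _ _ g (cst c)) ?derive_cst ?subr0 //.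
  have [/(_ _ i x) h _] := hg [::] isT; apply: h.
  by move: hs; rewrite size_rcons; case: (m).
exact: hg.
Qed.

End Regularity.

Section PlanarClass.
Variable R : realType.
Local Notation point := 'cV[R]_(2 + 2 + 1).
Implicit Types (z v u zh : point) (g : 'cV[R]_2 -> R).

Definition x_idx (i : 'I_2) : 'I_(2 + 2 + 1) := lshift 1 (lshift 2 i).

Lemma num_xE z i : num_x z i 0 = z (x_idx i) 0.
Proof. by rewrite !mxE. Qed.

Lemma x_idx_inj : injective x_idx.
Proof. by move=> i j /lshift_inj /lshift_inj. Qed.

(** The common shape of all components of f: c1 g1(eps x) z_a is the magnetic term, c3 g3(x) the
    electric one, c4 the constant 1 of the time component. The term c2 g2(eps x) is absent from f
    but arises when the magnetic term is differentiated in z_a. *)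
Definition aff_w (eps : R) (a : 'I_(2 + 2 + 1)) (c1 : R) g1 (c2 : R) g2 (c3 : R) g3 (c4 : R) z : R :=
  c1 * g1 (eps *: num_x z) * z a 0 + c2 * g2 (eps *: num_x z) + c3 * g3 (num_x z) + c4.

Variables (eps : R) (a : 'I_(2 + 2 + 1)).
Hypothesis ha : forall i, a != x_idx i.

Let c1_scaled g (k : R) z v : C1 g ->
  is_derive (0 : R) 1 (fun t : R => g (k *: num_x (z + t *: v)))
    (\sum_i v (x_idx i) 0 * (k * pderiv i g (k *: num_x z))).
Proof.
move=> hg.
have -> : (fun t : R => g (k *: num_x (z + t *: v))) =
    fun t => g (k *: num_x z + t *: (k *: num_x v)).
  apply/funext => t; congr g; apply/colP => i; rewrite !mxE; ring.
have := hg (k *: num_x z + 0 *: (k *: num_x v)) (k *: num_x v).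
move=> /is_derive_line; rewrite scale0r addr0 => H; apply: (is_derive_eq H).
by apply: eq_bigr => i _; rewrite !mxE; ring.
Qed.

Lemma aff_w_derive c1 g1 c2 g2 c3 g3 c4 z v : C1 g1 -> C1 g2 -> C1 g3 ->
  is_derive z v (aff_w eps a c1 g1 c2 g2 c3 g3 c4)
   (\sum_i v (x_idx i) 0 * aff_w eps a (c1 * eps) (pderiv i g1) (c2 * eps) (pderiv i g2)
        c3 (pderiv i g3) 0 z + v a 0 * (c1 * g1 (eps *: num_x z))).
Proof.
move=> h1 h2 h3.
rewrite -[X in is_derive X]addr0 -(scale0r v); apply/is_derive_line.
have hza : is_derive (0 : R) 1 (fun t : R => (z + t *: v) a 0) (v a 0).
  have -> : (fun t : R => (z + t *: v) a 0) = cst (z a 0) + v a 0 \*: id.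
    by apply/funext => t; rewrite !mxE [RHS]/(_ + _ * _) mulrC.
  by apply: is_derive_eq; rewrite add0r [_ *: _]mulr1.
have e1 := c1_scaled eps z v h1; have e2 := c1_scaled eps z v h2.
have e3 : is_derive (0 : R) 1 (fun t : R => g3 (num_x (z + t *: v)))
    (\sum_i v (x_idx i) 0 * pderiv i g3 (num_x z)).
  have := c1_scaled 1 z v h3.
  under eq_fun do rewrite scale1r.
  by under eq_bigr do rewrite scale1r mul1r.
have := is_deriveD (is_deriveD (is_deriveD
  (is_deriveM (is_deriveZ c1 e1) hza)
  (is_deriveZ c2 e2)) (is_deriveZ c3 e3)) (is_derive_cst c4 (0 : R) 1).
have -> : (c1 \*: (fun t : R => g1 (eps *: num_x (z + t *: v))) *
     (fun t : R => (z + t *: v) a 0) + c2 \*: (fun t : R => g2 (eps *: num_x (z + t *: v))) +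
     c3 \*: (fun t : R => g3 (num_x (z + t *: v))) + cst c4) =
   (fun t : R => aff_w eps a c1 g1 c2 g2 c3 g3 c4 (z + t *: v)).
  by [].
move=> H; apply: (is_derive_eq H).
have z0 : z + 0 *: v = z by rewrite scale0r addr0.
set x := num_x z.
transitivity (c1 * g1 (eps *: num_x (z + 0 *: v)) * v a 0 +
  (z + 0 *: v) a 0 * (c1 * \sum_(i < 2) v (x_idx i) 0 * (eps * pderiv i g1 (eps *: x))) +
  c2 * (\sum_(i < 2) v (x_idx i) 0 * (eps * pderiv i g2 (eps *: x))) +
  c3 * (\sum_(i < 2) v (x_idx i) 0 * pderiv i g3 x) + 0); first by [].
rewrite z0; by rewrite /aff_w !big_ord_recl !big_ord0 -/x; ring.
Qed.

Lemma aff_w_pderiv c1 g1 c2 g2 c3 g3 c4 z j : C1 g1 -> C1 g2 -> C1 g3 ->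
  pderiv j (aff_w eps a c1 g1 c2 g2 c3 g3 c4) z =
   \sum_i (j == x_idx i)%:R * aff_w eps a (c1 * eps) (pderiv i g1) (c2 * eps) (pderiv i g2)
        c3 (pderiv i g3) 0 z + (j == a)%:R * (c1 * g1 (eps *: num_x z)).
Proof.
move=> h1 h2 h3.
rewrite /pderiv (@derive_val _ _ _ _ _ _ _ (aff_w_derive c1 c2 c3 c4 z (delta_mx j 0) h1 h2 h3)).
rewrite mxE eqxx andbT eq_sym; congr (_ + _).
by apply: eq_bigr => i _; rewrite mxE eqxx andbT eq_sym.
Qed.

Lemma aff_w_C1 c1 g1 c2 g2 c3 g3 c4 : C1 g1 -> C1 g2 -> C1 g3 ->
  C1 (aff_w eps a c1 g1 c2 g2 c3 g3 c4).
Proof.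
move=> h1 h2 h3 z v; apply: (is_derive_eq (aff_w_derive c1 c2 c3 c4 z v h1 h2 h3)).
under [RHS]eq_bigr do rewrite aff_w_pderiv // mulrDr mulr_sumr.
have dlt (l : 'I_(2 + 2 + 1)) (x : R) : \sum_j v j 0 * ((j == l)%:R * x) = v l 0 * x.
  rewrite (bigD1 l) //= eqxx mul1r big1 ?addr0 // => j /negbTE ->.
  by rewrite mul0r mulr0.
rewrite big_split /= dlt; congr (_ + _).
by rewrite exchange_big /=; apply: eq_bigr => i _; rewrite dlt.
Qed.

(* The class is closed under partial derivatives, up to the sizes of its coefficients. *)
Lemma aff_w_pderiv_cases c1 g1 c2 g2 c3 g3 c4 j : C1 g1 -> C1 g2 -> C1 g3 ->
  [\/ exists2 i, j = x_idx i & pderiv j (aff_w eps a c1 g1 c2 g2 c3 g3 c4) =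
        aff_w eps a (c1 * eps) (pderiv i g1) (c2 * eps) (pderiv i g2) c3 (pderiv i g3) 0,
      j = a /\ pderiv j (aff_w eps a c1 g1 c2 g2 c3 g3 c4) =
        aff_w eps a 0 (pderiv 0 g1) c1 g1 0 (pderiv 0 g1) 0 |
      pderiv j (aff_w eps a c1 g1 c2 g2 c3 g3 c4) =
        aff_w eps a 0 (pderiv 0 g1) 0 (pderiv 0 g1) 0 (pderiv 0 g1) 0].
Proof.
move=> h1 h2 h3.
have [/existsP[i /eqP ji]|/existsPn hj] := boolP [exists i, j == x_idx i].
  apply: Or31; exists i => //; apply/funext => z; rewrite aff_w_pderiv //.
  rewrite (bigD1 i) //= ji eqxx mul1r big1 => [|i' ii'].
    by rewrite eq_sym (negbTE (ha i)) mul0r !addr0.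
  by rewrite (inj_eq x_idx_inj) eq_sym (negbTE ii') mul0r.
have [ja|ja] := eqVneq j a; [apply: Or32; split=> //|apply: Or33]; apply/funext => z;
  rewrite aff_w_pderiv // big1 => [|i _]; rewrite ?(negbTE (hj i)) ?mul0r // ?(negbTE ja) ?ja ?eqxx.
  by rewrite /aff_w /=; ring.
by rewrite /aff_w /=; ring.
Qed.

End PlanarClass.

Section ClassBounds.
Variables (R : realType) (eps : R) (a : 'I_(2 + 2 + 1)).
Hypotheses (eps0 : 0 < eps) (eps1 : eps <= 1) (ha : forall i, a != x_idx i).
Variables (L : R) (zh : 'cV[R]_(2 + 2 + 1)).
Hypothesis L0 : 0 <= L.
Implicit Types (g : 'cV[R]_2 -> R).

Lemma lip_upto_derivs m g1 g2 g3 : lip_upto m.+1 L g1 -> lip_upto m.+1 L g2 -> lip_upto m.+1 L g3 ->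
  [/\ C1 g1, C1 g2 & C1 g3].
Proof. by move=> h1 h2 h3; split; [exact: (lip_upto_C1 h1)|exact: (lip_upto_C1 h2)|exact: (lip_upto_C1 h3)]. Qed.

Section Remainder.
Variables (H om wz : R).
Hypotheses (H0 : 0 <= H) (om0 : 0 <= om) (hwz : `|zh a 0| + om <= wz).

(** H bounds the displacement in x, om that of z_a, and wz the size of z_a along the segment. The
    remainder of a product g1(eps x) z_a has a part of order m + 1 in eps x times z_a and a part of
    order m times the displacement of z_a. *)
Definition remainder_scale m (c1 c2 c3 : R) : R :=
  `|c1| * ((eps * H) ^+ m.+1 * wz + (eps * H) ^+ m * om) +
  `|c2| * (eps * H) ^+ m.+1 + `|c3| * H ^+ m.+1.

Let eps_ge0 : 0 <= eps. Proof. exact: ltW. Qed.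
Let wz0 : 0 <= wz. Proof. by apply: le_trans hwz; exact: addr_ge0. Qed.
Let eH0 : 0 <= eps * H. Proof. exact: mulr_ge0. Qed.

Lemma remainder_scale_ge0 m c1 c2 c3 : 0 <= remainder_scale m c1 c2 c3.
Proof.
by rewrite !addr_ge0 // !mulr_ge0 ?exprn_ge0 // addr_ge0 // mulr_ge0 ?exprn_ge0.
Qed.

(** Induction on m through [taylor_step]. The factor 5 per step is the number of coordinates, the 2
    the number of terms in [l1]. At m = 0 the displacement of z_a multiplies g1 itself, hence the
    extra bound; an induction starting from m > 0 arrives there with a partial derivative of g1,
    which is bounded by L. *)
Lemma aff_w_remainder m c1 g1 c2 g2 c3 g3 c4 (u : 'cV[R]_(2 + 2 + 1)) :
  lip_upto m L g1 -> lip_upto m L g2 -> lip_upto m L g3 -> (m = 0%N -> forall x, `|g1 x| <= L) ->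
  (forall i, `|u (x_idx i) 0| <= H) -> `|u a 0| <= om ->
  `|aff_w eps a c1 g1 c2 g2 c3 g3 c4 (zh + u) -
    taylor m zh (aff_w eps a c1 g1 c2 g2 c3 g3 c4) (zh + u)| <= 2 * 5 ^+ m * L * remainder_scale m c1 c2 c3.
Proof.
elim: m c1 g1 c2 g2 c3 g3 c4 u => [|m IH] c1 g1 c2 g2 c3 g3 c4 u hg1 hg2 hg3 hb hux hua;
  set F := aff_w _ _ _ _ _ _ _ _ _.
  have lip g (k : R) : lip_upto 0 L g -> 0 <= k ->
      `|g (k *: num_x (zh + u)) - g (k *: num_x zh)| <= L * (2 * (k * H)).
    move=> hg k0; have [_ /(_ (k *: num_x (zh + u)) (k *: num_x zh)) h] := hg [::] isT.
    apply: (le_trans h); rewrite ler_wpM2l // /l1 mulr_natl mulr2n.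
    have hi i : `|(k *: num_x (zh + u) - k *: num_x zh) i 0| <= k * H.
      rewrite -scalerBr mxE normrM ger0_norm // ler_wpM2l //.
      rewrite (_ : (num_x (zh + u) - num_x zh) i 0 = u (x_idx i) 0) //.
      rewrite !mxE; ring.
    exact: lerD.
  rewrite taylor0 /F /aff_w expr0 mulr1 /remainder_scale expr1 expr0 mul1r.
  set x := num_x (zh + u); set x' := num_x zh.
  have h1 := lip g1 eps hg1 eps_ge0; have h2 := lip g2 eps hg2 eps_ge0.
  have h3 := lip g3 1 hg3 ler01; rewrite !scale1r mul1r in h3.
  rewrite -/x -/x' in h1 h2 h3.
  have -> : c1 * g1 (eps *: x) * (zh + u) a 0 + c2 * g2 (eps *: x) + c3 * g3 x + c4 -
     (c1 * g1 (eps *: x') * zh a 0 + c2 * g2 (eps *: x') + c3 * g3 x' + c4) =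
     c1 * ((g1 (eps *: x) - g1 (eps *: x')) * (zh + u) a 0 + g1 (eps *: x') * u a 0) +
     c2 * (g2 (eps *: x) - g2 (eps *: x')) + c3 * (g3 x - g3 x').
    by rewrite [(zh + u) a 0]mxE; ring.
  have hza : `|(zh + u) a 0| <= wz.
    by rewrite mxE (le_trans (ler_normD _ _)) // (le_trans _ hwz) // lerD2l.
  apply: (le_trans (ler_normD _ _)).
  apply: (@le_trans _ _ (`|c1| * (L * (2 * (eps * H)) * wz + L * om) +
     `|c2| * (L * (2 * (eps * H))) + `|c3| * (L * (2 * H)))).
    apply: lerD; last by rewrite normrM ler_wpM2l.
    apply: (le_trans (ler_normD _ _)); apply: lerD; last by rewrite normrM ler_wpM2l.
    rewrite normrM ler_wpM2l // (le_trans (ler_normD _ _)) //.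
    by apply: lerD; rewrite normrM; apply: ler_pM => //; exact: hb.
  have : 0 <= `|c1| * (L * om) by rewrite !mulr_ge0.
  by lra.
have [d1 d2 d3] := lip_upto_derivs hg1 hg2 hg3.
have reg0 i : lip_upto m L (pderiv i g1) by exact: lip_upto_pderiv.
have bd0 : m = 0%N -> forall x, `|pderiv 0 g1 x| <= L.
  by move=> _ x; exact: lip_upto_bound hg1.
pose K := 2 * 5 ^+ m * L.
have K0 : 0 <= K by rewrite !mulr_ge0 // exprn_ge0.
have key j : exists2 Bj : R, (forall s, 0 <= s <= 1 -> `|pderiv j F (zh + s *: u) -
    taylor m zh (pderiv j F) (zh + s *: u)| <= Bj) &
    `|u j 0| * Bj <= K * remainder_scale m.+1 c1 c2 c3.
  have hsu (s : R) l (B : R) : 0 <= s <= 1 -> `|u l 0| <= B -> `|(s *: u) l 0| <= B.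
    move=> /andP[s0 s1] h; rewrite mxE normrM (ger0_norm s0); apply: le_trans h.
    by rewrite ler_piMl.
  have [[i -> ->]|[-> ->]|->] := aff_w_pderiv_cases eps ha c1 c2 c3 c4 j d1 d2 d3.
  - exists (K * remainder_scale m (c1 * eps) (c2 * eps) c3).
      move=> s hs; apply: (IH _ _ _ _ _ _ _ _ (lip_upto_pderiv i hg1) (lip_upto_pderiv i hg2)
        (lip_upto_pderiv i hg3)).
      + by move=> _ x; exact: lip_upto_bound hg1.
      + by move=> l; exact: hsu.
      + exact: hsu.
    rewrite mulrCA ler_wpM2l //.
    apply: (@le_trans _ _ (H * remainder_scale m (c1 * eps) (c2 * eps) c3)).
      by rewrite ler_wpM2r ?remainder_scale_ge0.
    rewrite le_eqVlt; apply/orP; left; apply/eqP.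
    by rewrite /remainder_scale !normrM (ger0_norm eps_ge0) !exprS; ring.
  (* Differentiation in z_a moves c1 g1 into the second slot without a factor eps, and om replaces
     eps H. The slots with coefficient 0 are filled by [pderiv 0 g1], a function of the right
     regularity. *)
  - exists (K * remainder_scale m 0 c1 0).
      move=> s hs; apply: (IH _ _ _ _ _ _ _ _ (lip_upto_pderiv 0 hg1) (lip_uptoW (leqnSn m) hg1)
        (lip_upto_pderiv 0 hg1)) => //.
      + by move=> l; exact: hsu.
      + exact: hsu.
    rewrite mulrCA ler_wpM2l //.
    apply: (@le_trans _ _ (om * remainder_scale m 0 c1 0)).
      by rewrite ler_wpM2r ?remainder_scale_ge0.
    rewrite /remainder_scale normr0 !mul0r add0r addr0.
    have t1 : 0 <= `|c1| * ((eps * H) ^+ m.+2 * wz) by rewrite mulr_ge0 // mulr_ge0 // exprn_ge0.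
    have t2 : 0 <= `|c2| * (eps * H) ^+ m.+2 by rewrite mulr_ge0 // exprn_ge0.
    have t3 : 0 <= `|c3| * H ^+ m.+2 by rewrite mulr_ge0 // exprn_ge0.
    by lra.
  - exists (K * remainder_scale m 0 0 0).
      move=> s hs; apply: IH => //.
      + by move=> l; exact: hsu.
      + exact: hsu.
    rewrite {1}/remainder_scale normr0 !mul0r !addr0 !mulr0.
    by rewrite mulr_ge0 // remainder_scale_ge0.
have [Bd hBd1 hBd2] : exists2 Bd : 'I_(2 + 2 + 1) -> R,
    (forall j s, 0 <= s <= 1 -> `|pderiv j F (zh + s *: u) -
      taylor m zh (pderiv j F) (zh + s *: u)| <= Bd j) &
    forall j, `|u j 0| * Bd j <= K * remainder_scale m.+1 c1 c2 c3.
  exists (fun j => s2val (cid2 (key j))) => j; first exact: (s2valP (cid2 (key j))).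
  exact: (s2valP' (cid2 (key j))).
apply: (le_trans (taylor_step (aff_w_C1 eps a c1 c2 c3 c4 d1 d2 d3) hBd1)).
apply: (@le_trans _ _ (\sum_(j < 2 + 2 + 1) K * remainder_scale m.+1 c1 c2 c3)).
  by apply: ler_sum => j _.
by rewrite sumr_const card_ord -[X in X <= _]mulr_natl /K exprS; lra.
Qed.

End Remainder.

(** Coefficients of size 1 / eps become harmless after one derivative in x, which brings a factor
    eps; the undifferentiated terms are covered by the separate bounds by K. The result adds the
    four terms of [aff_w], the first with the factor |z_a| <= K. *)
Lemma aff_w_coef_bound m K s c1 g1 c2 g2 c3 g3 c4 :
  (size s <= m)%N -> lip_upto m L g1 -> lip_upto m L g2 -> lip_upto m L g3 ->
  L <= K -> `|zh a 0| <= K ->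
  `|c1| <= eps^-1 -> `|c2| <= eps^-1 -> `|c3| <= 1 ->
  `|c1 * g1 (eps *: num_x zh)| <= K -> `|c2 * g2 (eps *: num_x zh)| <= K ->
  `|c3 * g3 (num_x zh)| <= K -> `|c4| <= K ->
  `|pderivs s (aff_w eps a c1 g1 c2 g2 c3 g3 c4) zh| <= K * K + 3 * K.
Proof.
move=> hs hg1 hg2 hg3 LK hK.
have K0 : 0 <= K by exact: le_trans LK.
elim/last_ind: s m c1 g1 c2 g2 c3 g3 c4 hs hg1 hg2 hg3 => [|s j IH]
    m c1 g1 c2 g2 c3 g3 c4 hs hg1 hg2 hg3 h1 h2 h3 b1 b2 b3 b4.
  rewrite /= /aff_w (le_trans (ler_normD _ _)) //.
  have -> : K * K + 3 * K = K * K + K + K + K by ring.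
  rewrite lerD // (le_trans (ler_normD _ _)) // lerD // (le_trans (ler_normD _ _)) // lerD //.
  by rewrite normrM; apply: ler_pM.
case: m hs hg1 hg2 hg3 => [|m]; rewrite size_rcons // ltnS => hs hg1 hg2 hg3.
have [d1 d2 d3] := lip_upto_derivs hg1 hg2 hg3.
have bd i g x (c : R) : `|c| <= 1 -> lip_upto m.+1 L g -> `|c * pderiv i g x| <= K.
  move=> hc hg; rewrite normrM; apply: (@le_trans _ _ (1 * L)); last by rewrite mul1r.
  by apply: ler_pM => //; exact: lip_upto_bound hg.
have heps (c : R) : `|c| <= eps^-1 -> `|c * eps| <= 1.
  by move=> hc; rewrite normrM (gtr0_norm eps0) -ler_pdivlMr // div1r.
have e1 : 1 <= eps^-1 by rewrite invf_ge1.
rewrite pderivs_rcons.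
have rp i g : lip_upto m.+1 L g -> lip_upto m L (pderiv i g) by exact: lip_upto_pderiv.
have z1 : `|0 : R| <= 1 by rewrite normr0.
have z2 : `|0 : R| <= eps^-1 by rewrite normr0 (le_trans ler01).
have z3 (x : R) : `|0 * x| <= K by rewrite mul0r normr0.
have [[i _ ->]|[_ ->]|->] := aff_w_pderiv_cases eps ha c1 c2 c3 c4 j d1 d2 d3.
- apply: (IH m _ _ _ _ _ _ _ hs (rp i g1 hg1) (rp i g2 hg2) (rp i g3 hg3)).
  + exact: le_trans (heps _ h1) e1.
  + exact: le_trans (heps _ h2) e1.
  + exact: h3.
  + by apply: bd => //; exact: heps.
  + by apply: bd => //; exact: heps.
  + exact: bd.
  + by rewrite normr0.
- apply: (IH m _ _ _ _ _ _ _ hs (rp 0 g1 hg1) (lip_uptoW (leqnSn m) hg1) (rp 0 g1 hg1)) => //.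
  by rewrite normr0.
- apply: (IH m _ _ _ _ _ _ _ hs (rp 0 g1 hg1) (rp 0 g1 hg1) (rp 0 g1 hg1)) => //.
  by rewrite normr0.
Qed.

End ClassBounds.

(** * Charged-particle dynamics *)

Section Components.
Variable R : realType.
Local Notation point := 'cV[R]_(2 + 2 + 1).
Implicit Types (z u zh : point) (l : 'I_2).

Definition w_idx l : 'I_(2 + 2 + 1) := lshift 1 (rshift 2 l).
Definition t_idx : 'I_(2 + 2 + 1) := rshift (2 + 2) ord0.

Lemma idx_cases (i : 'I_(2 + 2 + 1)) : [\/ exists l, i = x_idx l, exists l, i = w_idx l | i = t_idx].
Proof.
rewrite -[i]fintype.splitK; case: (fintype.split i) => [j|j] /=.
  rewrite -[j]fintype.splitK; case: (fintype.split j) => [l|l] /=; [apply: Or31|apply: Or32]; by exists l.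
by apply: Or33; rewrite (ord1 j).
Qed.

Lemma w_idx_neq_x l l' : w_idx l != x_idx l'.
Proof. by apply/eqP => /lshift_inj /eqP; rewrite eq_sym eq_lrshift. Qed.

Lemma ord2_cases (P : 'I_2 -> Prop) : P 0 -> P 1 -> forall l, P l.
Proof.
by move=> h0 h1 -[[|[|//]] hl]; [have -> : Ordinal hl = 0|have -> : Ordinal hl = 1];
  try exact: val_inj.
Qed.

Lemma sum2 (F : 'I_2 -> R) : \sum_l F l = F 0 + F 1.
Proof.
rewrite !big_ord_recl big_ord0 addr0; congr (F _ + F _); exact: val_inj.
Qed.

Lemma Jmx0 (w : 'cV[R]_2) : (Jmx R *m w) 0 0 = w 1 0.
Proof. by rewrite mxE sum2 !mxE /=; ring. Qed.

Lemma Jmx1 (w : 'cV[R]_2) : (Jmx R *m w) 1 0 = - w 0 0.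
Proof. by rewrite mxE sum2 !mxE /=; ring. Qed.

Lemma norm_Jmx (w : 'cV[R]_2) (K : R) : (forall l, `|w l 0| <= K) ->
  forall l, `|(Jmx R *m w) l 0| <= K.
Proof.
by move=> h; apply: ord2_cases; rewrite ?Jmx0 ?Jmx1 ?normrN.
Qed.

Lemma Jmx_sqr : Jmx R *m Jmx R = - 1%:M.
Proof.
apply/matrixP; apply: ord2_cases; apply: ord2_cases;
  rewrite mxE sum2 !mxE /=; ring.
Qed.

Lemma Jmx_tr : (Jmx R)^T = - Jmx R.
Proof.
by apply/matrixP; apply: ord2_cases; apply: ord2_cases; rewrite !mxE /=; ring.
Qed.

(* In the coordinates (b0 x + J w, w, t) the stiff matrix is skew-symmetric; b0 x + J w is the
   slow guiding centre, whose error is a factor eps smaller than that of v. *)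
Definition gc_mx (b0 : R) : 'M[R]_(2 + 2 + 1) :=
  block_mx (block_mx b0%:M (Jmx R) 0 1%:M) 0 0 (1%:M : 'M[R]_1).
Definition gc_inv (b0 : R) : 'M[R]_(2 + 2 + 1) :=
  block_mx (block_mx b0^-1%:M (- (b0^-1 *: Jmx R)) 0 1%:M) 0 0 (1%:M : 'M[R]_1).
Definition gc_skew (b0 : R) : 'M[R]_(2 + 2 + 1) :=
  block_mx (block_mx 0 0 0 (b0 *: Jmx R)) 0 0 (0 : 'M[R]_1).

Lemma gc_invK b0 : b0 != 0 -> gc_inv b0 *m gc_mx b0 = 1%:M.
Proof.
move=> b00; rewrite /gc_inv /gc_mx !mulmx_block !(mul0mx, mulmx0, mul1mx, mulmx1, addr0, add0r).
rewrite mul_scalar_mx scale_scalar_mx mulVf // mul_scalar_mx subrr.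
by rewrite -[block_mx 1%:M 0 0 1%:M]scalar_mx_block -scalar_mx_block.
Qed.

(** The stiff part b0 w of b0 x' cancels against J (b0 J w), since J^2 = -1. *)
Lemma gc_mx_A1 b0 : gc_mx b0 *m cpd_A1 b0 = gc_skew b0.
Proof.
rewrite /gc_mx /cpd_A1 /cpd_A /gc_skew !mulmx_block.
rewrite !(mul0mx, mulmx0, mul1mx, mulmx1, addr0, add0r).
by rewrite -scalemxAr Jmx_sqr scalerN scalemx1 subrr.
Qed.

(** The skew matrix reads only w, which [gc_mx] keeps. With [gc_mx_A1] this is the intertwining
    relation Q A = B Q of [local_error]. *)
Lemma gc_skew_mx b0 : gc_skew b0 *m gc_mx b0 = gc_skew b0.
Proof.
rewrite /gc_mx /gc_skew !mulmx_block.
by rewrite !(mul0mx, mulmx0, mul1mx, mulmx1, addr0, add0r).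
Qed.

Lemma gc_skew_skew b0 i j : gc_skew b0 i j = - gc_skew b0 j i.
Proof.
have : (gc_skew b0)^T = - gc_skew b0.
  by rewrite /gc_skew !tr_block_mx !trmx0 linearZ /= Jmx_tr scalerN !opp_block_mx !oppr0.
by move=> /matrixP /(_ j i); rewrite [LHS]mxE [RHS]mxE.
Qed.

Lemma gc_mx_x b0 u l :
  (gc_mx b0 *m u) (x_idx l) 0 = b0 * u (x_idx l) 0 + (Jmx R *m dsubmx (usubmx u)) l 0.
Proof.
rewrite -[u in LHS]vsubmxK -[usubmx u in LHS]vsubmxK /gc_mx !mul_block_col.
by rewrite !(mul0mx, addr0) /x_idx !col_mxEu mxE mul_scalar_mx !mxE.
Qed.

Lemma gc_mx_w b0 u l : (gc_mx b0 *m u) (w_idx l) 0 = u (w_idx l) 0.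
Proof.
rewrite -[u in LHS]vsubmxK -[usubmx u in LHS]vsubmxK /gc_mx !mul_block_col.
by rewrite !(mul0mx, mul1mx, addr0, add0r) /w_idx col_mxEu col_mxEd !mxE.
Qed.

Lemma gc_mx_t b0 u : (gc_mx b0 *m u) t_idx 0 = u t_idx 0.
Proof.
rewrite -[u in LHS]vsubmxK /gc_mx !mul_block_col.
by rewrite !(mul0mx, mul1mx, addr0, add0r) /t_idx col_mxEd !mxE.
Qed.

Lemma gc_mx_recover b0 kap d u : 0 < b0 -> b0^-1 <= kap ->
  (forall i, `|(gc_mx b0 *m u) i 0| <= d) ->
  forall l, `|u (w_idx l) 0| <= d /\ `|u (x_idx l) 0| <= 2 * kap * d.
Proof.
move=> b0_gt0 b0V_le hu; have uw l : `|u (w_idx l) 0| <= d by rewrite -(gc_mx_w b0).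
move=> l; split=> //.
have hJ : `|(Jmx R *m dsubmx (usubmx u)) l 0| <= d.
  by apply: norm_Jmx => l'; have := uw l'; rewrite !mxE.
have hb : `|b0 * u (x_idx l) 0| <= 2 * d.
  have := hu (x_idx l); rewrite gc_mx_x => hq.
  have -> : b0 * u (x_idx l) 0 = (b0 * u (x_idx l) 0 + (Jmx R *m dsubmx (usubmx u)) l 0) -
    (Jmx R *m dsubmx (usubmx u)) l 0 by ring.
  by rewrite (le_trans (ler_normB _ _)) // mulr_natl mulr2n lerD.
have -> : u (x_idx l) 0 = b0^-1 * (b0 * u (x_idx l) 0) by rewrite mulKf // gt_eqF.
rewrite normrM [2 * _]mulrC -mulrA; apply: ler_pM => //.
by rewrite ger0_norm // invr_ge0 ltW.
Qed.

Lemma cpd_A1E b0 z : cpd_A1 b0 *m z =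
  col_mx (col_mx (dsubmx (usubmx z)) (b0 *: (Jmx R *m dsubmx (usubmx z)))) 0.
Proof.
rewrite -[z in LHS]vsubmxK -[usubmx z in LHS]vsubmxK /cpd_A1 /cpd_A !mul_block_col.
by rewrite !(mul0mx, mul1mx, addr0, add0r) -scalemxAl.
Qed.

Lemma gc_skewE b0 z :
  gc_skew b0 *m z = col_mx (col_mx 0 (b0 *: (Jmx R *m dsubmx (usubmx z)))) 0.
Proof.
rewrite -[z in LHS]vsubmxK -[usubmx z in LHS]vsubmxK /gc_skew !mul_block_col.
by rewrite !(mul0mx, mul1mx, addr0, add0r) -scalemxAl.
Qed.

Lemma block_entry_bound m1 m2 n1 n2 (K : R) (M1 : 'M[R]_(m1, n1)) (M2 : 'M[R]_(m1, n2))
    (M3 : 'M[R]_(m2, n1)) (M4 : 'M[R]_(m2, n2)) :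
  (forall i j, `|M1 i j| <= K) -> (forall i j, `|M2 i j| <= K) ->
  (forall i j, `|M3 i j| <= K) -> (forall i j, `|M4 i j| <= K) ->
  forall i j, `|block_mx M1 M2 M3 M4 i j| <= K.
Proof.
move=> h1 h2 h3 h4 i j; rewrite -[i]fintype.splitK -[j]fintype.splitK.
by case: (fintype.split i) => i'; case: (fintype.split j) => j' /=;
  rewrite ?(block_mxEul, block_mxEur, block_mxEdl, block_mxEdr).
Qed.

Lemma scalar_entry_bound n (a K : R) : `|a| <= K ->
  forall i j : 'I_n, `|(a%:M : 'M[R]_n) i j| <= K.
Proof.
by move=> h i j; rewrite mxE; case: eqP => _; rewrite ?mulr1n // mulr0n normr0 (le_trans _ h).
Qed.

Lemma Jmx_entry_bound i j : `|Jmx R i j| <= 1.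
Proof.
move: i j; apply: ord2_cases; apply: ord2_cases;
  by rewrite !mxE /= ?subr0 ?sub0r ?normrN ?normr1 ?normr0.
Qed.

Lemma gc_mx_bound b0 K : `|b0| <= K -> 1 <= K -> forall i j, `|gc_mx b0 i j| <= K.
Proof.
move=> h h1; have z m n (i : 'I_m) (j : 'I_n) : `|(0 : 'M[R]_(m, n)) i j| <= K.
  by rewrite mxE normr0 (le_trans ler01).
apply: block_entry_bound => //; last by apply: scalar_entry_bound; rewrite normr1.
apply: block_entry_bound => //; [exact: scalar_entry_bound| |].
  by move=> i j; exact: le_trans (Jmx_entry_bound _ _) h1.
by apply: scalar_entry_bound; rewrite normr1.
Qed.

Lemma gc_inv_bound b0 K : `|b0^-1| <= K -> 1 <= K -> forall i j, `|gc_inv b0 i j| <= K.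
Proof.
move=> h h1; have z m n (i : 'I_m) (j : 'I_n) : `|(0 : 'M[R]_(m, n)) i j| <= K.
  by rewrite mxE normr0 (le_trans ler01).
apply: block_entry_bound => //; last by apply: scalar_entry_bound; rewrite normr1.
apply: block_entry_bound => //; [exact: scalar_entry_bound| |].
  move=> i j; rewrite !mxE normrN normrM -[K]mulr1; apply: ler_pM => //.
  by have := Jmx_entry_bound i j; rewrite !mxE.
by apply: scalar_entry_bound; rewrite normr1.
Qed.

Section ForceField.
Variables (b : 'cV[R]_2 -> R) (E : 'cV[R]_2 -> 'cV[R]_2) (eps b0 : R).
Let f := cpd_f b E eps b0.

Lemma cpd_f_x z l : f z (x_idx l) 0 = 0.
Proof. by rewrite /f /cpd_f /x_idx col_mxEu /cpd_F col_mxEu mxE. Qed.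

Lemma cpd_f_t z : f z t_idx 0 = 1.
Proof. by rewrite /f /cpd_f /t_idx col_mxEd mxE. Qed.

Lemma cpd_f_w z l : f z (w_idx l) 0 =
  (b (eps *: num_x z) - b0) / eps * (Jmx R *m dsubmx (usubmx z)) l 0 + eps * E (num_x z) l 0.
Proof.
rewrite /f /cpd_f /w_idx col_mxEu /cpd_F col_mxEd mxE.
by rewrite ![((_ : R) *: (_ : 'cV_2)) l 0]mxE.
Qed.

Lemma cpd_f_cls i : 0 < eps -> exists a c1 c3 c4 l,
  [/\ exists l', a = w_idx l', `|c1| <= eps^-1, `|c3| <= eps, `|c4| <= 1 &
    (fun z => f z i 0) = aff_w eps a c1 (fun x => b x - b0) 0 (fun x => b x - b0)
                         c3 (fun x => E x l 0) c4].
Proof.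
move=> e0; have e0' := ltW e0; have e1 : 0 <= eps^-1 by rewrite invr_ge0.
have [[l ->]|[l ->]|->] := idx_cases i.
- exists (w_idx 0), 0, 0, 0, 0; split; rewrite ?normr0 //; first by exists 0.
  by apply/funext => z; rewrite cpd_f_x /aff_w; ring.
(* J exchanges the two velocity components: the first row reads w_1 with sign +, the second reads
   w_0 with sign -. *)
- move: l; apply: ord2_cases.
    exists (w_idx 1), eps^-1, eps, 0, 0; split; rewrite ?normr0 ?ger0_norm //; first by exists 1.
    apply/funext => z; rewrite cpd_f_w Jmx0 /aff_w !mxE; ring.
  exists (w_idx 0), (- eps^-1), eps, 0, 1.
  split; rewrite ?normr0 ?normrN ?ger0_norm //; first by exists 0.
  apply/funext => z; rewrite cpd_f_w Jmx1 /aff_w !mxE; ring.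
- exists (w_idx 0), 0, 0, 1, 0; split; rewrite ?normr0 ?normr1 //; first by exists 0.
  by apply/funext => z; rewrite cpd_f_t /aff_w; ring.
Qed.

End ForceField.

End Components.

(** Order count in degree j: j - 1 factors of size h and a remainder worth h^(k - j + 1) make
    h^k. *)
Lemma taylor_degree k j : (0 < j)%N -> (j <= k)%N ->
  (j.-1 + (k - j + 1) = k)%N /\ (1 <= k - j + 1 <= k)%N.
Proof. by lia. Qed.

(** * One step of the integrator for the charged particle, with constants uniform in eps *)

Section OneStep.
Variables (R : realType) (k : nat) (kap : R) (b : 'cV[R]_2 -> R) (E : 'cV[R]_2 -> 'cV[R]_2).
Hypotheses (k2 : (2 <= k)%N) (kap1 : 1 <= kap) (hregb : lip_upto k kap b)
  (hregE : forall l, lip_upto k kap (fun x => E x l 0))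
  (hEbd : forall x l, `|E x l 0| <= kap * (1 + l1 x)).

(** [Kc] comes from the bound on (b(eps x) - b0) / eps at Z, and [Kl] is what [aff_w_coef_bound]
    makes of it. [P] absorbs the powers of 3 kap and 5 kap in the remainders. [Cd] bounds the
    residuals: at most k letters, displacements of size 3 kap h, and one remainder. *)
Let Kc : R := 8 * kap ^+ 2.
Let Kl : R := Kc * Kc + 3 * Kc.
Let P : R := (5 * kap) ^+ k.+2.
Let Cd : R := k%:R * (3 * kap) ^+ k * (2 * 5 ^+ k * kap * (3 * P)).
Definition step_const : R := local_const (2 + 2 + 1) k Kl * (1 + Cd ^+ 2).

Let kap0 : 0 <= kap. Proof. exact: le_trans kap1. Qed.
Let kap_sq : kap <= kap ^+ 2. Proof. by rewrite expr2 ler_peMr. Qed.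
Let Kc_ge : 8 * kap <= Kc. Proof. by rewrite ler_wpM2l. Qed.
Let Kc1 : 1 <= Kc. Proof. have := Kc_ge; have := kap1; lra. Qed.
Let Kc_le_Kl : Kc <= Kl.
Proof. rewrite /Kl; have := mulr_ge0 (le_trans ler01 Kc1) (le_trans ler01 Kc1); have := Kc1; lra. Qed.
Let Kl0 : 0 <= Kl. Proof. by apply: le_trans Kc_le_Kl; apply: le_trans Kc1. Qed.
Let P1 : 1 <= P. Proof. by apply: exprn_ege1; have := kap1; lra. Qed.
Let Cd0 : 0 <= Cd.
Proof.
have P0 := le_trans ler01 P1; have e3 : 0 <= 3 * kap by rewrite mulr_ge0.
rewrite /Cd; apply: mulr_ge0; first by rewrite mulr_ge0 // exprn_ge0.
apply: mulr_ge0; last by rewrite mulr_ge0.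
by apply: mulr_ge0 => //; rewrite mulr_ge0 // exprn_ge0.
Qed.

Lemma step_const_ge0 : 0 <= step_const.
Proof. by rewrite mulr_ge0 ?addr_ge0 ?sqr_ge0 ?local_const_ge0. Qed.

Definition state (eps : R) (x v : R -> 'cV[R]_2) (t : R) : 'cV[R]_(2 + 2 + 1) :=
  col_mx (col_mx (x t) (eps *: v t)) (t%:M : 'cV[R]_1).

Lemma state_x eps x v t l : state eps x v t (x_idx l) 0 = x t l 0.
Proof. by rewrite /state /x_idx !col_mxEu. Qed.

Lemma state_w eps x v t l : state eps x v t (w_idx l) 0 = eps * v t l 0.
Proof. by rewrite /state /w_idx col_mxEu col_mxEd mxE. Qed.

Lemma state_t eps x v t : state eps x v t t_idx 0 = t.
Proof. by rewrite /state /t_idx col_mxEd mxE. Qed.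

Definition gc_err (eps b0 : R) (x v : R -> 'cV[R]_2) t (Z : 'cV[R]_(2 + 2 + 1)) : R :=
  \sum_i (gc_mx b0 *m (state eps x v t - Z)) i 0 ^+ 2.

Variables (eps h a b0 : R) (x0 : 'cV[R]_2) (x v : R -> 'cV[R]_2) (Z Z' : 'cV[R]_(2 + 2 + 1)).
Hypotheses (eps0 : 0 < eps) (eps1 : eps <= 1) (h0 : 0 < h) (h1 : h <= 1)
  (b0_gt0 : 0 < b0) (b0_le : b0 <= kap) (b0V_le : b0^-1 <= kap) (b0E : b0 = b (eps *: x0))
  (hx0 : forall l, `|x0 l 0| <= kap).
Hypotheses
  (hx : forall t l, a <= t <= a + h -> `|x t l 0| <= kap)
  (hv : forall t l, a <= t <= a + h -> `|v t l 0| <= kap)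
  (hw : forall t l, a <= t <= a + h -> `|eps * v t l 0 - eps * v a l 0| <= kap * (t - a))
  (cx : forall l, c1on a (a + h) (fun t => x t l 0) (fun t => v t l 0))
  (cv : forall l, c1on a (a + h) (fun t => v t l 0)
    (fun t => ((b (eps *: x t) / eps) *: (Jmx R *m v t) + E (x t)) l 0))
  (hstep : lee_step k (cpd_A1 b0) (cpd_f b E eps b0) eps h Z Z')
  (hsmall : gc_err eps b0 x v a Z <= (eps * h) ^+ 2).

Let z := state eps x v.
Let u t := z t - Z.
Let f := cpd_f b E eps b0.

Let zx := state_x eps x v.
Let zw := state_w eps x v.
Let zt := state_t eps x v.

Let a_in : a <= a <= a + h. Proof. by rewrite lexx lerDl ltW. Qed.
Let eh0 : 0 <= eps * h. Proof. by rewrite mulr_ge0 ?ltW. Qed.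
Let eps_ge0 : 0 <= eps. Proof. exact: ltW. Qed.
Let h_ge0 : 0 <= h. Proof. exact: ltW. Qed.

Let Qu0 i : `|(gc_mx b0 *m u a) i 0| <= eps * h.
Proof.
rewrite -[leRHS]ger0_norm // -!sqrtr_sqr ler_sqrt ?sqr_ge0 //.
apply: le_trans hsmall; rewrite /gc_err (bigD1 i) //= lerDl.
by apply: sumr_ge0 => j _; exact: sqr_ge0.
Qed.

Let u0w l : `|u a (w_idx l) 0| <= eps * h.
Proof. by rewrite -(gc_mx_w b0). Qed.

Let u0t : `|u a t_idx 0| <= eps * h.
Proof. by rewrite -(gc_mx_t b0). Qed.

Let u0x l : `|u a (x_idx l) 0| <= 2 * kap * (eps * h).
Proof. by have [] := gc_mx_recover b0_gt0 b0V_le Qu0 l.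
Qed.

Let uE t i : u t i 0 = (z t i 0 - z a i 0) + u a i 0.
Proof. by rewrite /u !mxE; ring. Qed.

Let ux t l : a <= t <= a + h -> `|u t (x_idx l) 0| <= 3 * kap * h.
Proof.
move=> /andP[at1 at2]; rewrite uE !zx.
have d : `|x t l 0 - x a l 0| <= kap * h.
  apply: (@le_trans _ _ (kap * (t - a))); last by rewrite ler_wpM2l // lerBlDl.
  apply: (c1on_lip (c1onW (lexx a) at2 (cx l))) => // s /andP[s1 s2].
  by apply: hv; rewrite (ltW s1) (le_trans (ltW s2)).
have e : eps * h <= h by rewrite ler_piMl.
have := ler_wpM2l (mulr_ge0 (ler0n R 2) kap0) e; have := u0x l.
have := ler_normD (x t l 0 - x a l 0) (u a (x_idx l) 0).
lra.
Qed.

(** The displacement of w is O(h) because w is Lipschitz in time, and O(eps) by [uw2] because w =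
    eps v. The first bound is used for the residual in degree 1, the second in higher degrees. *)
Let uw1 t l : a <= t <= a + h -> `|u t (w_idx l) 0| <= 2 * kap * h.
Proof.
move=> ht; have /andP[at1 at2] := ht; rewrite uE !zw.
have d : kap * (t - a) <= kap * h by rewrite ler_wpM2l // lerBlDl.
have e : eps * h <= kap * h by rewrite ler_wpM2r // (le_trans eps1).
have := hw l ht; have := u0w l.
have := ler_normD (eps * v t l 0 - eps * v a l 0) (u a (w_idx l) 0).
lra.
Qed.

Let uw2 t l : a <= t <= a + h -> `|u t (w_idx l) 0| <= 3 * kap * eps.
Proof.
move=> ht; rewrite uE !zw.
have d s : a <= s <= a + h -> `|eps * v s l 0| <= eps * kap.
  by move=> hs; rewrite normrM (ger0_norm eps_ge0) ler_wpM2l // hv.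
have e : eps * h <= eps * kap by rewrite ler_wpM2l // (le_trans h1).
have := d _ ht; have := d _ a_in; have := u0w l.
have := ler_normD (eps * v t l 0 - eps * v a l 0) (u a (w_idx l) 0).
have := ler_normB (eps * v t l 0) (eps * v a l 0).
lra.
Qed.

Let ut t : a <= t <= a + h -> `|u t t_idx 0| <= 2 * h.
Proof.
move=> /andP[at1 at2]; rewrite uE !zt.
have e : eps * h <= h by rewrite ler_piMl.
have ta : `|t - a| = t - a by rewrite ger0_norm // subr_ge0.
have := ler_normD (t - a) (u a t_idx 0); have := u0t; lra.
Qed.

Let u_all t i : a <= t <= a + h -> `|u t i 0| <= 3 * kap * h.
Proof.
move=> ht; have [[l ->]|[l ->]|->] := idx_cases i; first exact: ux.
  apply: (le_trans (uw1 l ht)); rewrite ler_wpM2r // ler_wpM2r //; lra.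
by apply: (le_trans (ut ht)); rewrite ler_wpM2r //; have := kap1; lra.
Qed.

Let Zx l : `|num_x Z l 0| <= 3 * kap.
Proof.
have -> : num_x Z l 0 = x a l 0 - u a (x_idx l) 0 by rewrite num_xE -zx /u !mxE; ring.
have e : eps * h <= 1 by rewrite mulr_ile1.
have := ler_wpM2l (mulr_ge0 (ler0n R 2) kap0) e; have := u0x l; have := hx l a_in.
have := ler_normB (x a l 0) (u a (x_idx l) 0); lra.
Qed.

Let Zw l : `|Z (w_idx l) 0| <= eps * (2 * kap).
Proof.
have -> : Z (w_idx l) 0 = eps * v a l 0 - u a (w_idx l) 0 by rewrite -zw /u !mxE; ring.
have e : eps * h <= eps * kap by rewrite ler_wpM2l // (le_trans h1).
have d : `|eps * v a l 0| <= eps * kap.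
  by rewrite normrM (ger0_norm eps_ge0) ler_wpM2l // hv.
have := u0w l; have := ler_normB (eps * v a l 0) (u a (w_idx l) 0); lra.
Qed.

Let Zw2 l : `|Z (w_idx l) 0| <= 2 * kap.
Proof. by apply: (le_trans (Zw l)); rewrite ler_piMl // mulr_ge0. Qed.

(** Both b0 and the value at Z are taken at arguments scaled by eps, so the magnetic coefficient of
    f, with its 1 / eps, is bounded before any differentiation. *)
Let bdiff : `|b (eps *: num_x Z) - b0| <= eps * Kc.
Proof.
rewrite b0E; have [_ hL] := hregb (leq0n k : (size [::] <= k)%N).
apply: (le_trans (hL _ _)); rewrite -scalerBr /l1 !mxE !normrM !(ger0_norm eps_ge0) -mulrDr.
rewrite mulrCA ler_wpM2l // /Kc.
have d l : `|num_x Z l 0 - x0 l 0| <= 4 * kap.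
  have := Zx l; have := hx0 l; have := ler_normB (num_x Z l 0) (x0 l 0); lra.
have -> : 8 * kap ^+ 2 = kap * (4 * kap + 4 * kap) by ring.
rewrite ler_wpM2l // lerD //.
  by have := d 0; rewrite !mxE.
by have := d 1; rewrite !mxE.
Qed.

Let hf s i : (size s <= k)%N -> `|pderivs s (fun y => f y i 0) Z| <= Kl.
Proof.
move=> hs; have [a' [c1 [c3 [c4 [l [[l' ea] hc1 hc3 hc4 ->]]]]]] := cpd_f_cls b E b0 i eps0.
have ha' j : a' != x_idx j by rewrite ea w_idx_neq_x.
have e1 : 1 <= eps^-1 by rewrite invf_ge1.
have hbc := lip_upto_subc b0 hregb.
apply: (aff_w_coef_bound eps0 eps1 ha' kap0 hs hbc hbc (hregE l)).
- by have := Kc_ge; have := kap1; lra.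
- by rewrite ea (le_trans (Zw2 _)) //; have := Kc_ge; have := kap1; lra.
- exact: hc1.
- by rewrite normr0 (le_trans ler01).
- exact: le_trans hc3 eps1.
- rewrite normrM; apply: (@le_trans _ _ (eps^-1 * (eps * Kc))); first exact: ler_pM.
  by rewrite mulKf // gt_eqF.
- by rewrite mul0r normr0 (le_trans ler01 Kc1).
- rewrite normrM -[Kc]mul1r; apply: ler_pM => //; first exact: le_trans hc3 eps1.
  apply: (le_trans (hEbd _ _)); have -> : Kc = kap * (kap * 8) by rewrite /Kc; ring.
  rewrite ler_wpM2l // /l1; have := Zx 0; have := Zx 1; have := kap1; lra.
- exact: le_trans hc4 Kc1.
Qed.

Let rem_gen t i m om : (1 <= m <= k)%N -> a <= t <= a + h -> 0 <= om -> om <= 3 * kap ->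
  (forall l, `|u t (w_idx l) 0| <= om) ->
  `|f (z t) i 0 - taylor m Z (fun y => f y i 0) (z t)| <=
    2 * 5 ^+ k * kap * (eps^-1 * ((eps * (3 * kap * h)) ^+ m.+1 * (5 * kap) +
       (eps * (3 * kap * h)) ^+ m * om) + eps * (3 * kap * h) ^+ m.+1).
Proof.
move=> /andP[m1 mk] ht om0 om3 huw.
have [a' [c1 [c3 [c4 [l [[l' ea] hc1 hc3 hc4 hE]]]]]] := cpd_f_cls b E b0 i eps0.
have ha' j : a' != x_idx j by rewrite ea w_idx_neq_x.
have hbc := lip_uptoW mk (lip_upto_subc b0 hregb).
have H0 : 0 <= 3 * kap * h by rewrite !mulr_ge0.
have hwz : `|Z a' 0| + om <= 5 * kap.
  by rewrite ea; have := Zw2 l'; lra.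
have := @aff_w_remainder _ eps a' eps0 ha' kap Z kap0 (3 * kap * h) om (5 * kap) H0 om0 hwz m
  c1 (fun x => b x - b0) 0 (fun x => b x - b0) c3 (fun x => E x l 0) c4 (u t)
  hbc hbc (lip_uptoW mk (hregE l)).
have -> : Z + u t = z t by rewrite /u addrC subrK.
rewrite -hE => /(_ _ _ _) H; apply: (le_trans (H _ _ _)).
- by move=> m0; rewrite m0 in m1.
- by move=> j; exact: ux.
- by rewrite ea.
have eH0 : 0 <= eps * (3 * kap * h) by rewrite mulr_ge0.
apply: ler_pM.
- by rewrite mulr_ge0 // mulr_ge0 // exprn_ge0.
- exact: (remainder_scale_ge0 eps0 H0 om0 hwz).
- by rewrite ler_wpM2r // ler_wpM2l // ler_weXn2l //; lra.
rewrite /remainder_scale normr0 mul0r addr0; apply: lerD.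
  by rewrite ler_wpM2r // addr_ge0 // mulr_ge0 ?exprn_ge0 // mulr_ge0.
by rewrite ler_wpM2r // exprn_ge0.
Qed.

(** Here om is h or eps, according to the bound used for w, and hh is the power of h aimed at:
    h^(m+1) in degree 1, h^m in higher degrees. The three terms of [rem_gen] give the factor 3 P. *)
Let rem_le t i m om hh : (1 <= m <= k)%N -> a <= t <= a + h -> 0 <= om <= 1 ->
  (forall l, `|u t (w_idx l) 0| <= 3 * kap * om) ->
  h ^+ m.+1 <= hh -> eps ^+ m.-1 * om * h ^+ m <= eps * hh ->
  `|f (z t) i 0 - taylor m Z (fun y => f y i 0) (z t)| <=
    2 * 5 ^+ k * kap * (3 * P) * (eps * hh).
Proof.
move=> hm ht /andP[om0 om1] huw hh1 hh2.
have g0 : 0 <= 3 * kap by rewrite mulr_ge0.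
apply: (le_trans (rem_gen i hm ht _ _ huw)).
- exact: mulr_ge0.
- by rewrite ler_piMr.
have /andP[m1 mk] := hm.
rewrite -[X in _ <= X]mulrA ler_wpM2l //; first by rewrite mulr_ge0 // mulr_ge0 // exprn_ge0.
have powP j (c : R) : (j <= k.+1)%N -> 0 <= c <= 5 * kap -> (3 * kap) ^+ j * c <= P.
  move=> hj /andP[c0 c5]; rewrite /P.
  apply: (@le_trans _ _ ((5 * kap) ^+ j * (5 * kap))).
    apply: ler_pM => //; first exact: exprn_ge0.
    by apply: lerXn2r; rewrite ?nnegrE ?mulr_ge0 // ler_wpM2r //; lra.
  rewrite -exprSr ler_weXn2l //; first by have := kap1; lra.
have q1 : (3 * kap) ^+ m.+1 * (5 * kap) <= P by apply: powP => //; rewrite lexx mulr_ge0.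
have q2 : (3 * kap) ^+ m * (3 * kap) <= P.
  by apply: powP; [exact: leq_trans mk _|rewrite g0 /= ler_wpM2r //; lra].
have q3 : (3 * kap) ^+ m.+1 * 1 <= P.
  by apply: powP => //; rewrite ler01 /=; have := kap1; lra.
have hm1 : eps ^+ m <= eps by rewrite -[leRHS]expr1 ler_wiXn2l.
have hh0 : 0 <= hh by apply: le_trans hh1; exact: exprn_ge0.
have t1 : eps ^+ m * h ^+ m.+1 <= eps * hh.
  by apply: ler_pM => //; exact: exprn_ge0.
have t3 : eps * h ^+ m.+1 <= eps * hh by rewrite ler_wpM2l.
have e1 : eps^-1 * ((eps * (3 * kap * h)) ^+ m.+1 * (5 * kap)) =
    (3 * kap) ^+ m.+1 * (5 * kap) * (eps ^+ m * h ^+ m.+1).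
  by rewrite !exprMn [eps ^+ m.+1]exprS; field; rewrite gt_eqF.
have e2 : eps^-1 * ((eps * (3 * kap * h)) ^+ m * (3 * kap * om)) =
    (3 * kap) ^+ m * (3 * kap) * (eps ^+ m.-1 * om * h ^+ m).
  case: (m) m1 => // m' _ /=; rewrite !exprMn [eps ^+ m'.+1]exprS; field.
  by rewrite gt_eqF.
have e3 : eps * (3 * kap * h) ^+ m.+1 = (3 * kap) ^+ m.+1 * 1 * (eps * h ^+ m.+1).
  by rewrite exprMn; ring.
have P0 : 0 <= P by exact: le_trans P1.
rewrite mulrDr e1 e2 e3.
have -> : 3 * P * (eps * hh) = P * (eps * hh) + P * (eps * hh) + P * (eps * hh) by ring.
have n1 : 0 <= (3 * kap) ^+ m by exact: exprn_ge0.
have n2 : 0 <= (3 * kap) ^+ m.+1 by exact: exprn_ge0.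
apply: lerD; last by apply: ler_pM; rewrite ?mulr_ge0 // exprn_ge0.
apply: lerD; apply: ler_pM => //.
- by rewrite !mulr_ge0.
- by rewrite mulr_ge0 // exprn_ge0.
- exact: mulr_ge0.
- by rewrite mulr_ge0 ?exprn_ge0 // mulr_ge0 // exprn_ge0.
Qed.

Let monom_le t s : a <= t <= a + h -> `|monom (u t) s| <= (3 * kap * h) ^+ size s.
Proof.
move=> ht; elim: s => [|i s IH]; first by rewrite monom_nil normr1.
by rewrite monom_cons normrM /= exprS; apply: ler_pM => //; exact: u_all.
Qed.

Let defect_le t xi : a < t < a + h -> (size xi <= k)%N ->
  `|taylor_defect k f Z z t xi| <= if size xi == 1%N then h * (Cd * (eps * h ^+ k))
                                   else Cd * (eps * h ^+ k).
Proof.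
move=> /andP[/ltW t1 /ltW t2] hxi.
have ht : a <= t <= a + h by rewrite t1 t2.
have g0 : 0 <= 3 * kap by rewrite mulr_ge0.
have P0 : 0 <= P by exact: le_trans P1.
have base0 : 0 <= 2 * 5 ^+ k * kap * (3 * P).
  apply: mulr_ge0; last exact: mulr_ge0.
  by apply: mulr_ge0 => //; rewrite mulr_ge0 // exprn_ge0.
have gen hh : 0 <= hh -> (forall l : 'I_(size xi),
    `|f (z t) (tnth (in_tuple xi) l) 0 - taylor (k - size xi + 1) Z
       (fun y => f y (tnth (in_tuple xi) l) 0) (z t)| <=
     2 * 5 ^+ k * kap * (3 * P) * (eps * hh)) ->
    `|taylor_defect k f Z z t xi| <= Cd * (eps * (h ^+ (size xi).-1 * hh)).
  move=> hh0 hl.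
  apply: (@le_trans _ _ ((size xi)%:R * ((3 * kap * h) ^+ (size xi).-1 *
      (2 * 5 ^+ k * kap * (3 * P) * (eps * hh))))).
    apply: norm_sum_le => l; rewrite normrM; apply: ler_pM => //.
    by rewrite -(size_chi (ltn_ord l)); exact: monom_le.
  rewrite exprMn; set c := 2 * 5 ^+ k * kap * (3 * P) in base0 *.
  have -> : (size xi)%:R * ((3 * kap) ^+ (size xi).-1 * h ^+ (size xi).-1 * (c * (eps * hh))) =
     (size xi)%:R * (3 * kap) ^+ (size xi).-1 * c * (eps * (h ^+ (size xi).-1 * hh)) by ring.
  have hp : 0 <= h ^+ (size xi).-1 by exact: exprn_ge0.
  rewrite ler_wpM2r ?mulr_ge0 // /Cd -/c ler_wpM2r //; apply: ler_pM => //.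
  - exact: exprn_ge0.
  - by rewrite ler_nat.
  - rewrite ler_weXn2l //; first by have := kap1; lra.
    by apply: leq_trans hxi; exact: leq_pred.
have hk0 : 0 <= h ^+ k by exact: exprn_ge0.
have [s1|s1] := eqVneq (size xi) 1%N.
  have -> : h * (Cd * (eps * h ^+ k)) = Cd * (eps * (h ^+ (size xi).-1 * h ^+ k.+1)).
    by rewrite s1 expr0 mul1r exprS; ring.
  apply: gen => [|l]; first exact: exprn_ge0.
  have km : (k - size xi + 1 = k)%N by rewrite s1 (subnK (ltnW k2)).
  rewrite km; apply: (@rem_le t _ k h) => //.
  - by rewrite leqnn (ltnW k2).
  - by rewrite h_ge0 h1.
  - by move=> l'; apply: (le_trans (uw1 l' ht)); rewrite ler_wpM2r // ler_wpM2r //; lra.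
  (* The requirement is eps^(k-1) <= eps, and this is where k >= 2 enters: the magnetic term, after
     the loss of 1 / eps, keeps one factor eps. *)
  - rewrite exprS mulrA ler_wpM2r // ler_wpM2r //.
    by rewrite -[leRHS]expr1 ler_wiXn2l // -ltnS prednK // ltnW.
have [s0|s0] := posnP (size xi).
  rewrite /taylor_defect big1 ?normr0; last by move=> [l hl] _; exfalso; rewrite s0 in hl.
  by rewrite mulr_ge0 // mulr_ge0.
have [d1 d2] := taylor_degree s0 hxi.
have -> : h ^+ k = h ^+ (size xi).-1 * h ^+ (k - size xi + 1).
  by rewrite -exprD d1.
apply: gen => [|l]; first exact: exprn_ge0.
apply: (@rem_le t _ _ eps) => //.
- by rewrite eps_ge0 eps1.
- by move=> l'; exact: uw2.
- by rewrite exprS ler_piMl // exprn_ge0.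
- by rewrite addn1 /= -exprSr -addn1 ler_wpM2r ?exprn_ge0 // -[leRHS]expr1 ler_wiXn2l // addn1.
Qed.

Lemma one_step : gc_err eps b0 x v (a + h) Z' <=
  gc_err eps b0 x v a Z +
  h * (step_const * (gc_err eps b0 x v a Z + eps ^+ 2 * h ^+ (2 * k.+1))).
Proof.
have e1 : 1 <= eps^-1 by rewrite invf_ge1.
have Kl1 : 1 <= Kl by apply: le_trans Kc_le_Kl.
have kapKl : kap <= Kl by apply: le_trans Kc_le_Kl; have := Kc_ge; have := kap1; lra.
have b0n : `|b0| = b0 by rewrite ger0_norm ?ltW.
(* Q A_1 Z contains only b0 J w, and w = O(eps) at Z absorbs the 1 / eps. *)
have hzh i : `|(eps^-1 *: (gc_mx b0 *m cpd_A1 b0 *m Z)) i 0| <= Kl.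
  rewrite gc_mx_A1 gc_skewE mxE.
  have [[l ->]|[l ->]|->] := idx_cases i.
  - by rewrite /x_idx !col_mxEu mxE mulr0 normr0.
  - rewrite /w_idx col_mxEu col_mxEd mxE !normrM b0n ger0_norm ?invr_ge0 //.
    have hJ := @norm_Jmx _ (dsubmx (usubmx Z)) (eps * (2 * kap)) _ l.
    apply: (@le_trans _ _ (eps^-1 * (kap * (eps * (2 * kap))))).
      rewrite ler_wpM2l ?invr_ge0 //; apply: ler_pM => //; first exact: ltW.
      by apply: hJ => l'; have := Zw l'; rewrite !mxE.
    have -> : eps^-1 * (kap * (eps * (2 * kap))) = 2 * kap ^+ 2 by field; rewrite gt_eqF.
    apply: le_trans Kc_le_Kl; rewrite /Kc ler_wpM2r ?sqr_ge0 //; lra.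
  - by rewrite /t_idx col_mxEd mxE mulr0 normr0.
have hz i : c1on a (a + h) (fun t => z t i 0)
    (fun t => (eps^-1 *: (cpd_A1 b0 *m z t) + f (z t)) i 0).
  have dz t : dsubmx (usubmx (z t)) = eps *: v t by rewrite /z /state col_mxKu col_mxKd.
  have nz t : num_x (z t) = x t by rewrite /num_x /z /state !col_mxKu.
  have en0 : eps != 0 by rewrite gt_eqF.
  have [[l ->]|[l ->]|->] := idx_cases i.
  - apply: c1on_ext (cx l) => t; first by rewrite zx.
    move=> _; rewrite mxE /f cpd_f_x addr0 mxE cpd_A1E /x_idx !col_mxEu dz mxE mulKf //.
  - apply: c1on_ext (c1onZ eps (cv l)) => t; first by rewrite zw.
    move=> _; rewrite [RHS]mxE /f cpd_f_w [X in _ = X + _]mxE cpd_A1E /w_idx col_mxEu col_mxEd.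
    rewrite dz nz -scalemxAr !mxE; field.
    by rewrite en0.
  - apply: c1on_ext (c1on_derive _ _ (fun s => is_derive_id s 1)) => t; first by rewrite zt.
    by move=> _; rewrite mxE /f cpd_f_t mxE cpd_A1E /t_idx col_mxEd mxE mulr0 add0r.
have hinit : \sum_i (gc_mx b0 *m (z a - Z)) i 0 ^+ 2 <= 1.
  apply: (le_trans hsmall); rewrite exprMn mulr_ile1 ?sqr_ge0 //.
    by rewrite -(expr1n _ 2) lerXn2r ?nnegrE.
  by rewrite -(expr1n _ 2) lerXn2r ?nnegrE.
have k0 : (0 < k)%N by exact: ltnW.
have rho0 : 0 <= Cd * (eps * h ^+ k) by rewrite mulr_ge0 // mulr_ge0 // exprn_ge0.
have := @local_error R (2 + 2 + 1) k Kl k0 Kl0 eps h a (Cd * (eps * h ^+ k))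
  (cpd_A1 b0) (gc_mx b0) (gc_inv b0) (gc_skew b0) f Z Z' z h0 h1 rho0.
rewrite gc_mx_A1 gc_skew_mx => /(_ _ erefl (gc_skew_skew b0)) H.
have {}H := H _ _ _ _ hf hstep hz (fun t ht xi hxi => @defect_le t xi ht hxi) hinit.
rewrite -/(gc_err eps b0 x v a Z) -/(gc_err eps b0 x v (a + h) Z') in H.
apply: (le_trans (H _ _ _ _)).
- by apply: gc_invK; rewrite gt_eqF.
- by apply: gc_mx_bound; rewrite ?b0n ?(le_trans b0_le).
- by apply: gc_inv_bound => //; rewrite ger0_norm ?invr_ge0 ?(ltW b0_gt0) // (le_trans b0V_le).
- by move=> i; have := hzh i; rewrite gc_mx_A1.
set N := gc_err eps b0 x v a Z.
have N0 : 0 <= N by apply: sumr_ge0 => i _; exact: sqr_ge0.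
rewrite lerD2l ler_wpM2l // /step_const -mulrA ler_wpM2l ?local_const_ge0 //.
have -> : (h * (Cd * (eps * h ^+ k))) ^+ 2 = Cd ^+ 2 * (eps ^+ 2 * h ^+ (2 * k.+1)).
  by rewrite mulnC exprM [h ^+ k.+1]exprS; ring.
set Y := eps ^+ 2 * _.
have Y0 : 0 <= Y by rewrite mulr_ge0 ?sqr_ge0 // exprn_ge0.
have c0 : 0 <= Cd ^+ 2 * N by rewrite mulr_ge0 ?sqr_ge0.
by rewrite mulrDl mul1r mulrDr; lra.
Qed.

End OneStep.

(** * A priori bounds on the exact solution, uniform in eps *)

Section APriori.
Variable R : realType.

Lemma lip_upto_le m (L L' : R) g : L <= L' -> lip_upto m L g -> lip_upto m L' g.
Proof.
move=> h hg s hs; have [h1 h2] := hg s hs; split=> // x y.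
by apply: (le_trans (h2 x y)); rewrite ler_wpM2r // l1_ge0.
Qed.

(** There are finitely many words of length at most k, so the sum of their Lipschitz constants
    serves for all of them. *)
Lemma glob_lipschitz_upto_lip k (g : 'cV[R]_2 -> R) : glob_lipschitz_upto k g ->
  exists2 L, 0 <= L & lip_upto k L g.
Proof.
move=> hg.
have /choice[Lf hLf] : forall s : seq 'I_2, exists L : R, (size s <= k)%N ->
    forall x y, `|pderivs s g x - pderivs s g y| <= L * enorm (x - y).
  move=> s; case: (boolP (size s <= k)%N) => hs; last by exists 0.
  by have [_ _ [L hL]] := hg s hs; exists L.
pose L := \sum_(j < k.+1) \sum_(s <- words 2 j) `|Lf s|.
have hL s : (size s <= k)%N -> `|Lf s| <= L.
  move=> hs; rewrite /L (bigD1 (Ordinal (hs : (size s < k.+1)%N))) //=.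
  rewrite (big_rem s) /= ?mem_words // -addrA lerDl addr_ge0 // sumr_ge0 //.
  by move=> j _; apply: sumr_ge0.
have L0 : 0 <= L by apply: sumr_ge0 => j _; apply: sumr_ge0.
exists L => // s hs; have [h1 _ _] := hg s hs; split=> // x y.
apply: (le_trans (hLf s hs x y)).
apply: (@le_trans _ _ (`|Lf s| * enorm (x - y))).
  by rewrite ler_wpM2r ?sqrtr_ge0 // ler_norm.
by apply: ler_pM; rewrite ?sqrtr_ge0 ?hL // enorm_l1.
Qed.

Lemma within_coord (A : set R) n (f : R -> 'cV[R]_n) i :
  {within A, continuous f} -> {within A, continuous (fun t => f t i 0)}.
Proof.
move=> hf t; apply: (@cvg_comp _ _ _ f (fun M : 'cV[R]_n => M i 0) _ _ _ (hf t)).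
exact: coord_continuous.
Qed.

Lemma is_derive_coord n (f : R -> 'cV[R]_n) (t : R) d i :
  is_derive t (1 : R) f d -> is_derive t (1 : R) (fun t => f t i 0) (d i 0).
Proof.
move=> [h1 <-]; rewrite derive_mx // mxE; apply: derivableP.
by have /derivable_mxP := h1; apply.
Qed.

Lemma cpd_solution_c1on (b : 'cV[R]_2 -> R) E eps T x0 v0 x v l :
  cpd_solution b E eps T x0 v0 x v ->
  c1on 0 T (fun t => x t l 0) (fun t => v t l 0) /\
  c1on 0 T (fun t => v t l 0)
    (fun t => ((b (eps *: x t) / eps) *: (Jmx R *m v t) + E (x t)) l 0).
Proof.
move=> [cx cv hd _]; split; split; try exact: within_coord; move=> t ht;
  have [h1 h2] := hd t ht; exact: is_derive_coord.
Qed.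

Variables (T M kap : R) (b : 'cV[R]_2 -> R) (E : 'cV[R]_2 -> 'cV[R]_2).
Hypotheses (T0 : 0 < T) (M0 : 0 <= M) (kap1 : 1 <= kap).
Hypothesis hEbd : forall x l, `|E x l 0| <= kap * (1 + l1 x).

(** The rate of |x|^2 + |v|^2 is 2 x.v + 2 v.E <= |x|^2 + 2 |v|^2 + |E|^2, and the linear growth of
    E gives |E|^2 <= 6 kap^2 (1 + |x|^2). In [apriori_const], 4 M^2 counts four initial coordinates,
    and the leading 1 turns a bound on a square into one on the modulus without a root. *)
Let A : R := 2 + 12 * kap ^+ 2.
Definition apriori_const : R := 1 + expR (A * T) * (4 * M ^+ 2 + A * T).

Let kap0 : 0 <= kap. Proof. exact: le_trans kap1. Qed.
Let A0 : 0 <= A. Proof. by rewrite addr_ge0 // mulr_ge0 // sqr_ge0. Qed.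

Lemma apriori_const_ge1 : 1 <= apriori_const.
Proof.
by rewrite lerDl mulr_ge0 ?expR_ge0 // addr_ge0 // mulr_ge0 ?sqr_ge0 // ltW.
Qed.

(* J is skew, so the large magnetic term does no work and the energy bound is uniform in eps. *)
Lemma apriori eps x0 v0 x v t : cpd_solution b E eps T x0 v0 x v ->
  enorm x0 <= M -> enorm v0 <= M -> 0 <= t <= T ->
  forall l, `|x t l 0| <= apriori_const /\ `|v t l 0| <= apriori_const.
Proof.
move=> hs hx0 hv0 ht l.
pose g t := \sum_l x t l 0 * x t l 0 + \sum_l v t l 0 * v t l 0.
pose F t l := ((b (eps *: x t) / eps) *: (Jmx R *m v t) + E (x t)) l 0.
have cg : c1on 0 T g (fun t => \sum_l (x t l 0 * v t l 0 + x t l 0 * v t l 0) +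
    \sum_l (v t l 0 * F t l + v t l 0 * F t l)).
  by apply: c1onD; apply: c1on_sum => l';
    have [h1 h2] := cpd_solution_c1on l' hs; apply: c1onM.
have hg s : 0 < s < T -> \sum_l (x s l 0 * v s l 0 + x s l 0 * v s l 0) +
    \sum_l (v s l 0 * F s l + v s l 0 * F s l) <= A * g s + A.
  move=> _; rewrite /g /F !sum2 ![((_ *: _ + _) : 'cV_2) _ _]mxE.
  rewrite ![((_ / _) *: _ : 'cV_2) _ _]mxE Jmx0 Jmx1.
  have e0 := hEbd (x s) 0; have e1 := hEbd (x s) 1.
  have q l' : `|E (x s) l' 0| <= kap * (1 + l1 (x s)) ->
      E (x s) l' 0 ^+ 2 <= 3 * kap ^+ 2 * (1 + x s 0 0 ^+ 2 + x s 1 0 ^+ 2).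
    move=> e; apply: (@le_trans _ _ ((kap * (1 + l1 (x s))) ^+ 2)).
      rewrite -[leLHS]real_normK ?num_real // lerXn2r ?nnegrE //.
      by rewrite mulr_ge0 // addr_ge0 // l1_ge0.
    rewrite exprMn; have -> : 3 * kap ^+ 2 * (1 + x s 0 0 ^+ 2 + x s 1 0 ^+ 2) =
      kap ^+ 2 * (3 * (1 + x s 0 0 ^+ 2 + x s 1 0 ^+ 2)) by ring.
    rewrite ler_wpM2l ?sqr_ge0 // /l1.
    rewrite -[x s 0 0 ^+ 2]real_normK ?num_real // -[x s 1 0 ^+ 2]real_normK ?num_real //.
    set p := `|x s 0 0|; set r := `|x s 1 0|.
    have := sqr_ge0 (1 - p); have := sqr_ge0 (1 - r); have := sqr_ge0 (p - r).
    lra.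
  have q0 := q 0 e0; have q1 := q 1 e1.
  have := sqr_ge0 (x s 0 0 - v s 0 0); have := sqr_ge0 (x s 1 0 - v s 1 0).
  have := sqr_ge0 (v s 0 0 - E (x s) 0 0); have := sqr_ge0 (v s 1 0 - E (x s) 1 0).
  have k1 : 0 <= kap ^+ 2 * (v s 0 0 ^+ 2 + v s 1 0 ^+ 2 + x s 0 0 ^+ 2 + x s 1 0 ^+ 2).
    by rewrite mulr_ge0 ?sqr_ge0 // !addr_ge0 ?sqr_ge0.
  have k2 : 0 <= kap ^+ 2 by exact: sqr_ge0.
  have k3 : 0 <= kap ^+ 2 * (v s 0 0 ^+ 2 + v s 1 0 ^+ 2).
    by rewrite mulr_ge0 ?sqr_ge0 // !addr_ge0 ?sqr_ge0.
  have k4 : 0 <= kap ^+ 2 * (x s 0 0 ^+ 2 + x s 1 0 ^+ 2).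
    by rewrite mulr_ge0 ?sqr_ge0 // !addr_ge0 ?sqr_ge0.
  have k5 := sqr_ge0 (x s 0 0); have k6 := sqr_ge0 (x s 1 0).
  rewrite /A; lra.
have g0 : g 0 <= 4 * M ^+ 2.
  have [_ _ _ [xE vE]] := hs; rewrite /g xE vE.
  have sq (y : 'cV[R]_2) l' : enorm y <= M -> y l' 0 * y l' 0 <= M ^+ 2.
    move=> hy; rewrite -expr2 -[leLHS]real_normK ?num_real // lerXn2r ?nnegrE //.
    exact: le_trans (norm_le_enorm _ _) hy.
  rewrite !sum2; have := sq x0 0 hx0; have := sq x0 1 hx0.
  by have := sq v0 0 hv0; have := sq v0 1 hv0; lra.
have gt : g t <= expR (A * T) * (4 * M ^+ 2 + A * T).
  apply: (le_trans (gronwall cg A0 A0 hg ht)); rewrite subr0.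
  have /andP[t0 tT] := ht.
  apply: ler_pM; rewrite ?expR_ge0 //.
  - rewrite addr_ge0 ?mulr_ge0 // addr_ge0 // sumr_ge0 // => l' _;
      by rewrite -expr2 sqr_ge0.
  - by rewrite ler_expR ler_wpM2l.
  - by rewrite lerD // ler_wpM2l.
have le1 (y : R) : y ^+ 2 <= g t -> `|y| <= apriori_const.
  move=> hy; rewrite /apriori_const; set G := expR _ * _ in gt *.
  have := sqr_ge0 (`|y| - 1); have : `|y| ^+ 2 <= G.
    by rewrite real_normK ?num_real // (le_trans hy).
  have := normr_ge0 y; nra.
have sg (y : R -> 'cV[R]_2) : y t l 0 ^+ 2 <= \sum_l' y t l' 0 * y t l' 0.
  rewrite (bigD1 l) //= -expr2 lerDl sumr_ge0 // => l' _; by rewrite -expr2 sqr_ge0.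
have sp (y : R -> 'cV[R]_2) : 0 <= \sum_l' y t l' 0 * y t l' 0.
  by apply: sumr_ge0 => l' _; rewrite -expr2 sqr_ge0.
split; apply: le1; rewrite /g.
  by have := sg x; have := sp v; lra.
by have := sg v; have := sp x; lra.
Qed.

End APriori.

Theorem theorem1 (R : realType) (T : R) (hT : 0 < T) (k : nat) (hk : (2 <= k)%N)
  (U : 'cV[R]_2 -> R) (E : 'cV[R]_2 -> 'cV[R]_2) (b : 'cV[R]_2 -> R) (c0 : R)
  (hU : forall x : 'cV[R]_2, differentiable U x)
  (hE : forall x : 'cV[R]_2, E x = - grad U x)
  (hc0 : 0 < c0) (hb : forall x : 'cV[R]_2, c0 <= b x)
  (hEreg : forall i : 'I_2, glob_lipschitz_upto k (fun x => E x i 0))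
  (hbreg : glob_lipschitz_upto k b)
  (x0 v0 : R -> 'cV[R]_2)
  (hinit : exists M : R, forall eps : R, 0 < eps <= 1 ->
     enorm (x0 eps) <= M /\ enorm (v0 eps) <= M) :
  exists C h0 : R, [/\ 0 < C, 0 < h0 &
    forall (eps : R) (N : nat), 0 < eps <= 1 -> (0 < N)%N ->
    let h := T / N%:R in h < h0 ->
    forall (x v : R -> 'cV[R]_2) (Z : nat -> 'cV[R]_(2 + 2 + 1)),
      cpd_solution b E eps T (x0 eps) (v0 eps) x v ->
      numerical_solution k b E eps h N (x0 eps) (v0 eps) Z ->
      forall n : nat, (n <= N)%N ->
        enorm (num_x (Z n) - x (n%:R * h)) <= C * eps * h ^+ k.+1 /\
        enorm (num_v eps (Z n) - v (n%:R * h)) <= C * h ^+ k.+1].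
Proof.
have [M hM] := hinit.
have M0 : 0 <= M.
  by have [h _] := hM 1 ltac:(by rewrite ltr01 lexx); apply: le_trans h; exact: sqrtr_ge0.
have [Lb Lb0 regb] := glob_lipschitz_upto_lip hbreg.
have [L0 L00 regE0] := glob_lipschitz_upto_lip (hEreg 0).
have [L1 L10 regE1] := glob_lipschitz_upto_lip (hEreg 1).
(* The values at 0 are included so that [kE] also gives the linear growth bound on E. *)
pose kE : R := 1 + L0 + L1 + `|E 0 0 0| + `|E 0 1 0|.
have kE1 : 1 <= kE by rewrite /kE -!addrA lerDl !addr_ge0.
have regE l : lip_upto k kE (fun x => E x l 0).
  have n0 := normr_ge0 (E 0 0 0); have n1 := normr_ge0 (E 0 1 0).
  by move: l; apply: ord2_cases; [apply: lip_upto_le regE0|apply: lip_upto_le regE1]; rewrite /kE; lra.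
have hEbd x l : `|E x l 0| <= kE * (1 + l1 x).
  have [_ /(_ x 0)] := regE l [::] isT; rewrite subr0 /= => h.
  rewrite mulrDr mulr1 -[E x l 0](subrK (E 0 l 0)) addrC.
  apply: (le_trans (ler_normD _ _)); apply: lerD => //.
  have n0 := normr_ge0 (E 0 0 0); have n1 := normr_ge0 (E 0 1 0).
  by move: l {h}; apply: ord2_cases; rewrite /kE; lra.
pose K := apriori_const T M kE.
have K1 : 1 <= K by exact: apriori_const_ge1.
have K0 : 0 <= K by exact: le_trans K1.
(* b may be unbounded, so it is estimated only where the exact solution and the initial points can
   be. *)
pose B : R := `|b 0| + Lb * (2 * K + 2 * M).
have B0 : 0 <= B by rewrite addr_ge0 // mulr_ge0 // addr_ge0 // mulr_ge0.
have hB eps (y : 'cV[R]_2) : 0 < eps <= 1 -> (forall l, `|y l 0| <= K + M) ->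
    `|b (eps *: y)| <= B.
  move=> /andP[e0 e1] hy; have [_ /(_ (eps *: y) 0)] := regb [::] isT.
  rewrite subr0 /= => h.
  rewrite -[b (eps *: y)](subrK (b 0)) addrC.
  apply: (le_trans (ler_normD _ _)); apply: lerD => //; apply: (le_trans h).
  rewrite ler_wpM2l // /l1 !mxE !normrM (gtr0_norm e0).
  have s l : eps * `|y l 0| <= K + M by apply: (le_trans _ (hy l)); rewrite ler_piMl.
  by have := s 0; have := s 1; lra.
(* One constant for all hypotheses of [one_step]: B K + kE (1 + 2 K) is the bound on w', and 1 / c0
   that on 1 / b0. *)
pose kap : R := 1 + kE + K + M + Lb + B + B * K + kE * (1 + 2 * K) + c0^-1.
have BK0 : 0 <= B * K by exact: mulr_ge0.
have kEK0 : 0 <= kE * (1 + 2 * K).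
  by rewrite mulr_ge0 ?(le_trans ler01 kE1) // addr_ge0 // mulr_ge0.
have c0V : 0 <= c0^-1 by rewrite invr_ge0 ltW.
have kE0 : 0 <= kE by exact: le_trans kE1.
have kapE : kE <= kap by rewrite /kap; lra.
have kap1 : 1 <= kap by rewrite /kap; lra.
have kap0 : 0 <= kap by exact: le_trans kap1.
have regb' : lip_upto k kap b by apply: lip_upto_le regb; rewrite /kap; lra.
have regE' l : lip_upto k kap (fun x => E x l 0) by exact: lip_upto_le (regE l).
have hEbd' x l : `|E x l 0| <= kap * (1 + l1 x).
  by apply: (le_trans (hEbd x l)); rewrite ler_wpM2r // addr_ge0 // l1_ge0.
pose Cs := step_const k kap.
have Cs0 : 0 <= Cs by exact: step_const_ge0.
pose e0 := expR (Cs * T).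
have e01 : 1 <= e0 by rewrite -expR0 ler_expR mulr_ge0 // ltW.
have e00 : 0 < e0 by exact: expR_gt0.
(* Each of the two components of x costs 2 kap times the error d = eps h^(k+1) e0 in the
   guiding-centre coordinates. The threshold is chosen to have h e0 <= 1. *)
exists (4 * kap * e0), e0^-1; split; [|by rewrite invr_gt0|].
  by rewrite !mulr_gt0 // (lt_le_trans ltr01).
move=> eps N heps N0 h hh x v Z hs [Z0 hstep].
have /andP[eps0 eps1] := heps; have eps_ge0 := ltW eps0.
have N0' : 0 < N%:R :> R by rewrite ltr0n.
have h_gt0 : 0 < h by rewrite divr_gt0.
have h_ge0 := ltW h_gt0.
have he0 : h * e0 <= 1 by rewrite -ler_pdivlMr // div1r ltW.
have h1 : h <= 1 by apply: (le_trans _ he0); rewrite ler_peMr.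
have NT : N%:R * h = T by rewrite mulrC divfK // gt_eqF.
set b0 := b (eps *: x0 eps) in hstep.
have [hx0 hv0] := hM eps heps.
have x0l l : `|x0 eps l 0| <= M by apply: le_trans hx0; exact: norm_le_enorm.
have b0c : c0 <= b0 by exact: hb.
have b0_gt0 : 0 < b0 by exact: lt_le_trans b0c.
have b0_le : b0 <= kap.
  apply: (@le_trans _ _ B); last by rewrite /kap; lra.
  apply: (le_trans (ler_norm b0)); apply: (hB eps (x0 eps) heps) => l.
  by apply: (le_trans (x0l l)); rewrite lerDr.
have b0V_le : b0^-1 <= kap.
  apply: (@le_trans _ _ c0^-1); last by rewrite /kap; lra.
  by rewrite lef_pV2 ?posrE.
have tn n : (n <= N)%N -> 0 <= n%:R * h <= T.
  move=> hn; rewrite mulr_ge0 //= -NT ler_wpM2r // ler_nat //.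
have ap t : 0 <= t <= T -> forall l, `|x t l 0| <= K /\ `|v t l 0| <= K.
  by move=> ht l; have := apriori M0 kE1 hEbd hs hx0 hv0 ht l.
pose eta := h ^+ (2 * k.+1).
have eta0 : 0 <= eta by exact: exprn_ge0.
have e2 : 0 <= eps ^+ 2 by exact: sqr_ge0.
(* By h^(2k) <= h and h e0 <= 1, the accumulated error stays within the smallness hypothesis of
   [one_step]. *)
have small : eps ^+ 2 * eta * e0 <= (eps * h) ^+ 2.
  rewrite exprMn -mulrA ler_wpM2l // /eta mulnS exprD -mulrA ler_piMr ?sqr_ge0 //.
  apply: le_trans he0; rewrite ler_wpM2r ?(ltW e00) //.
  by rewrite -[leRHS]expr1 ler_wiXn2l // muln_gt0 (ltnW hk).
(* Adding the forcing eps^2 eta to the squared error makes the recursion homogeneous: the sum grows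
   by at most 1 + Cs h <= exp(Cs h) per step. *)
have main n : (n <= N)%N ->
    gc_err eps b0 x v (n%:R * h) (Z n) + eps ^+ 2 * eta <=
    eps ^+ 2 * eta * expR (Cs * (n%:R * h)).
  elim: n => [|n IH] hn.
    rewrite mul0r mulr0 expR0 mulr1 /gc_err.
    have -> : state eps x v 0 = Z 0%N.
      have [_ _ _ [xE vE]] := hs; rewrite Z0 /state xE vE; congr col_mx.
      by apply/matrixP => i j; rewrite !mxE mul0rn.
    by rewrite subrr mulmx0 big1 ?add0r // => i _; rewrite mxE expr0n.
  have {}IH := IH (ltnW hn); set a := n%:R * h in IH *.
  have aS : n.+1%:R * h = a + h by rewrite -natr1 mulrDl mul1r.
  have /andP[a0 aT] := tn n (ltnW hn).
  have /andP[_ ahT] := tn n.+1 hn; rewrite aS in ahT *.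
  have tT t : a <= t <= a + h -> 0 <= t <= T.
    by move=> /andP[t1 t2]; rewrite (le_trans a0 t1) (le_trans t2 ahT).
  have kapK : K <= kap by rewrite /kap; lra.
  have cxv l := cpd_solution_c1on l hs.
  have hsm : gc_err eps b0 x v a (Z n) <= (eps * h) ^+ 2.
    apply: le_trans small; apply: (@le_trans _ _ (eps ^+ 2 * eta * expR (Cs * a))).
      by apply: le_trans IH; rewrite lerDl mulr_ge0.
    by rewrite ler_wpM2l ?mulr_ge0 // ler_expR ler_wpM2l.
  have := @one_step R k kap b E hk kap1 regb' regE' hEbd' eps h a b0 (x0 eps) x v (Z n) (Z n.+1)
    eps0 eps1 h_gt0 h1 b0_gt0 b0_le b0V_le erefl.
  move=> /(_ _ _ _ _ _ _ (hstep n hn) hsm) H.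
  have {H} : gc_err eps b0 x v (a + h) (Z n.+1) <= gc_err eps b0 x v a (Z n) +
      h * (Cs * (gc_err eps b0 x v a (Z n) + eps ^+ 2 * eta)).
    apply: H.
    - by move=> l; apply: (le_trans (x0l l)); rewrite /kap; lra.
    - by move=> t l ht; apply: le_trans kapK; have [] := ap t (tT t ht) l.
    - by move=> t l ht; apply: le_trans kapK; have [] := ap t (tT t ht) l.
    (* In w' = b(eps x) J v + eps E(x) the 1 / eps of v' has cancelled, so w is Lipschitz in time
       uniformly in eps. *)
    - move=> t l /andP[t1 t2].
      have c := c1onW a0 (le_trans t2 ahT) (c1onZ eps (cxv l).2).
      apply: (c1on_lip c) => // s /andP[s1 s2].
      have hs' : 0 <= s <= T by apply: tT; rewrite (ltW s1) (le_trans (ltW s2)).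
      have xb l' : `|x s l' 0| <= K by have [] := ap s hs' l'.
      have vb l' : `|v s l' 0| <= K by have [] := ap s hs' l'.
      rewrite mxE [X in _ * (X + _)]mxE mulrDr mulrA [eps * _]mulrC divfK ?gt_eqF //.
      apply: (le_trans (ler_normD _ _)).
      apply: (@le_trans _ _ (B * K + kE * (1 + 2 * K))); last by rewrite /kap; lra.
      apply: lerD; rewrite normrM.
        apply: ler_pM => //; last exact: norm_Jmx.
        by apply: hB => // l'; apply: (le_trans (xb l')); rewrite lerDl.
      rewrite (gtr0_norm eps0); apply: (@le_trans _ _ `|E (x s) l 0|); first by rewrite ler_piMl.
      apply: (le_trans (hEbd _ _)); rewrite ler_wpM2l // /l1.
      by have := xb 0; have := xb 1; lra.
    - by move=> l; exact: c1onW a0 ahT (cxv l).1.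
    - by move=> l; exact: c1onW a0 ahT (cxv l).2.
  set G := gc_err eps b0 x v a (Z n) in IH *; set Y := eps ^+ 2 * eta in IH *.
  move=> H; apply: (@le_trans _ _ ((G + Y) * (1 + Cs * h))).
    have -> : (G + Y) * (1 + Cs * h) = G + h * (Cs * (G + Y)) + Y by ring.
    by rewrite lerD2r.
  rewrite [Cs * (a + h)]mulrDr expRD mulrA; apply: ler_pM => //.
  - rewrite addr_ge0 ?mulr_ge0 //; apply: sumr_ge0 => i _; exact: sqr_ge0.
  - by rewrite addr_ge0 // mulr_ge0.
  - exact: expR_ge1Dx.
move=> n hn; set t := n%:R * h.
have hk1 : 0 <= h ^+ k.+1 by exact: exprn_ge0.
pose d := eps * h ^+ k.+1 * e0.
have d0 : 0 <= d by rewrite !mulr_ge0 // ltW.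
have hG : gc_err eps b0 x v t (Z n) <= d ^+ 2.
  have /andP[_ tT] := tn n hn.
  have Y0 : 0 <= eps ^+ 2 * eta by exact: mulr_ge0.
  apply: (@le_trans _ _ (eps ^+ 2 * eta * expR (Cs * t))).
    by apply: le_trans (main n hn); rewrite lerDl.
  (* Since e0 >= 1, d may carry e0 itself in place of its square root. *)
  have -> : d ^+ 2 = eps ^+ 2 * eta * (e0 * e0).
    by rewrite /d /eta mulnC exprM; ring.
  rewrite ler_wpM2l //; apply: (@le_trans _ _ e0); first by rewrite ler_expR ler_wpM2l.
  by rewrite ler_peMr // ltW.
set u := state eps x v t - Z n.
have hQ i : `|(gc_mx b0 *m u) i 0| <= d.
  rewrite -[leRHS]ger0_norm // -!sqrtr_sqr ler_sqrt ?sqr_ge0 //.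
  apply: le_trans hG; rewrite /gc_err (bigD1 i) //= lerDl.
  by apply: sumr_ge0 => j _; exact: sqr_ge0.
have hu := gc_mx_recover b0_gt0 b0V_le hQ.
have xE l : (num_x (Z n) - x t) l 0 = - u (x_idx l) 0.
  transitivity (Z n (x_idx l) 0 - state eps x v t (x_idx l) 0).
    by rewrite state_x -num_xE mxE [X in _ + X]mxE.
  rewrite /u; set S := state _ _ _ _; rewrite !mxE; ring.
have vE l : (num_v eps (Z n) - v t) l 0 = - (eps^-1 * u (w_idx l) 0).
  have vS : v t l 0 = eps^-1 * (state eps x v t) (w_idx l) 0.
    by rewrite state_w mulKf // gt_eqF.
  rewrite mxE [X in _ + X]mxE vS.
  rewrite /u; set S := state _ _ _ _; rewrite !mxE; ring.
split; apply: (le_trans (enorm_l1 _)); rewrite /l1 ?xE ?vE !normrN.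
  have [_ h2] := hu 0; have [_ h3] := hu 1.
  by apply: (le_trans (lerD h2 h3)); rewrite /d; lra.
rewrite !normrM (ger0_norm (_ : 0 <= eps^-1)) ?invr_ge0 // -mulrDr ler_pdivrMl //.
have [h2 _] := hu 0; have [h3 _] := hu 1.
apply: (le_trans (lerD h2 h3)); rewrite /d.
have -> : eps * (4 * kap * e0 * h ^+ k.+1) = 4 * kap * (eps * h ^+ k.+1 * e0) by ring.
rewrite -/d -mulr2n -[leLHS]mulr_natl ler_wpM2r //.
by apply: (@le_trans _ _ (4 * 1)); [rewrite mulr1 ler_nat|rewrite ler_wpM2l].
Qed.
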